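(* Consider the regression model $\mathcal Y_i=g(i/n)+\varepsilon_i$, $i=1,\dots,n$, where $(\varepsilon_i)$ are i.i.d., $\varepsilon_i\ge0$, and for some $\lambda>0$, $P(\varepsilon_i\le x)=\lambda x+O(x^2)$ as $x\downarrow0$. Assume also $\bar F_\varepsilon(y)=P(\varepsilon_i>y)\lesssim(1+y)^{-\rho}$, $y\ge 0$, for some $\rho>0$. Let $g\in\mathcal C^\beta(R)$ with $\beta\in(0,1]$, $R>0$, let $w:[0,1]\to\mathbb R$, and let $\theta^{(n)}=\frac1n\sum_{i=1}^n g(i/n)w(i/n)$. Then the block-wise estimator $\tilde\theta_n^{block}$ with block size $h$ ($h^{-1},nh\in\mathbb N$; defined in the context) satisfies, for $h\to0$ with $nh\to\infty$ and uniformly in $n,h,R,\beta$, $$\big|\mathbb E[\tilde\theta_n^{block}-\theta^{(n)}]\big|\lesssim (Rh^\beta+(nh)^{-1})^2\|w\|_1,\qquad \operatorname{Var}(\tilde\theta_n^{block})\lesssim h\,(Rh^\beta+(nh)^{-1})^2\|w\|_2^2 .$$ In particular, uniformly over $\beta\ge\beta_0>1/2$ and $R\le R_0<\infty$, with block size $h\asymp(Rn)^{-1/(\beta+1)}$ (in the same regime $h\to0$, $nh\to\infty$), $$(\mathbb E[\tilde\theta_n^{block}-\theta^{(n)}])^2=o(\operatorname{Var}(\tilde\theta_n^{block})),\qquad \operatorname{Var}(\tilde\theta_n^{block})\lesssim R^{1/(\beta+1)}n^{-(2\beta+1)/(\beta+1)}\|w\|_2^2 .$$ If $\varepsilon_i\sim\mathrm{Exp}(\lambda)$,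 then for any $\beta\in(0,1]$, $R,\lambda>0$ one has the more precise result $$\mathbb E[\tilde\theta_n^{block}]=\theta^{(n)},\qquad \operatorname{Var}(\tilde\theta_n^{block})\le\frac{2Rh^\beta+(n\lambda h)^{-1}}{n\lambda}\|w\|_2^2 .$$
   Context: $\mathcal C^{\beta}(R)=\{f:[0,1]\to\mathbb R \mid |f(y)-f(x)|\le R|y-x|^\beta\ \forall x,y\in[0,1]\}$. $\|w\|_p=(\frac1n\sum_{i=1}^n|w(i/n)|^p)^{1/p}$ is the standardised $\ell^p$-norm. $a\lesssim b$ means $a\le Cb$ for a constant $C$ (here depending only on the law of $\varepsilon_i$ and, in the second display, on $\beta_0,R_0$ and the constants in $h\asymp(Rn)^{-1/(\beta+1)}$); $a\asymp b$ means $a\lesssim b$ and $b\lesssim a$. $\mathrm{Exp}(\lambda)$ is the exponential distribution with rate $\lambda$. Estimator: for $k=0,\dots,h^{-1}-1$ let $\tilde I_k=\{i\in\{1,\dots,n\}:kh<i/n\le(k+1)h\}$, $\mathcal Y_k^*=\min_{i\in\tilde I_k}\mathcal Y_i$, $$\tilde\theta_k=\frac1{nh}\sum_{i\in\tilde I_k}\Big(\mathcal Y_i\wedge(\mathcal Y_k^*+Rh^\beta)-\lambda^{-1}\mathbf 1\big(\mathcal Y_i\le\mathcal Y_k^*+Rh^\beta\big)\Big)w(i/n),$$ and $\tilde\theta_n^{block}=\sum_{k=0}^{h^{-1}-1}\tilde\theta_k h$. *)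

(* Defs.v *)
From HB Require Import structures.
From mathcomp Require Import all_boot all_order all_algebra.
From mathcomp Require Import all_classical all_reals all_analysis.

Set Implicit Arguments.
Unset Strict Implicit.
Unset Printing Implicit Defensive.
Import Order.TTheory GRing.Theory Num.Theory.
Import numFieldNormedType.Exports.
Local Open Scope classical_set_scope.
Local Open Scope ring_scope.

Section Model.
Context {R : realType}.

(* 'I_n starts at 0: the index i stands for observation number i.+1. *)
Definition design (n : nat) (i : 'I_n) : R := i.+1%:R / n%:R.

(* Functions on [0, 1] are represented by total functions R -> R; no value
   outside [0, 1] is ever used. *)
Definition holder_class (beta rad : R) (g : R -> R) : Prop :=
  {in `[0, 1] &, forall x y, `|g y - g x| <= rad * `|y - x| `^ beta}.

Definition std_norm (n : nat) (p : R) (w : R -> R) : R :=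
  (n%:R^-1 * \sum_(i < n) `|w (design i)| `^ p) `^ p^-1.

Definition mutually_independent (d : measure_display) (T : measurableType d)
    (P : probability T R) (n : nat) (X : 'I_n -> {RV P >-> R}) : Prop :=
  forall (J : {set 'I_n}) (A : 'I_n -> set R),
    (forall i, measurable (A i)) ->
    P (\bigcap_(i in [set` J]) (X i @^-1` A i)) =
      (\prod_(i in J) P (X i @^-1` A i))%E.

Definition has_law (d : measure_display) (T : measurableType d)
    (P : probability T R) (X : {RV P >-> R}) (mu : set R -> \bar R) : Prop :=
  forall A : set R, measurable A -> distribution P X A = mu A.

Definition iid_with_law (d : measure_display) (T : measurableType d)
    (P : probability T R) (n : nat) (mu : set R -> \bar R)
    (X : 'I_n -> {RV P >-> R}) : Prop :=
  mutually_independent X /\ forall i, has_law (X i) mu.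

Definition error_law (lambda rho : R) (mu : probability R R) : Prop :=
  [/\ mu `[0, +oo[%classic = 1%E,
      (fun x : R => fine (mu `]-oo, x]%classic) - lambda * x : R^o) =O_ (0^'+)
        (fun x : R => x ^+ 2 : R^o) &
      exists C : R, forall y : R, 0 <= y ->
        (mu `]y, +oo[%classic <= (C * (1 + y) `^ (- rho))%:E)%E].

Definition admissible_block_size (n : nat) (h : R) : Prop :=
  [/\ (0 < n)%N, 0 < h, h^-1 \is a Num.nat & n%:R * h \is a Num.nat].

Definition block (n : nat) (h : R) (k : nat) : {set 'I_n} :=
  [set i : 'I_n | k%:R * h < design i <= k.+1%:R * h].

(* The minimum is taken in \bar R, where the neutral element +oo is
   available; every block is nonempty when h is admissible, so it is then
   the minimum of finitely many reals. *)
Definition block_min (n : nat) (h : R) (y : 'I_n -> R) (k : nat) : R :=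
  fine (\big[mine/+oo%E]_(i in block n h k) (y i)%:E).

Definition block_term (n : nat) (beta rad lambda h : R) (w : R -> R)
    (y : 'I_n -> R) (k : nat) : R :=
  let t := block_min h y k + rad * h `^ beta in
  (n%:R * h)^-1 * \sum_(i in block n h k)
    (Num.min (y i) t - lambda^-1 * (y i <= t)%R%:R) * w (design i).

Definition block_estimator (n : nat) (beta rad lambda h : R) (w : R -> R)
    (y : 'I_n -> R) : R :=
  \sum_(0 <= k < Num.truncn h^-1) block_term beta rad lambda h w y k * h.

Definition theta (n : nat) (g w : R -> R) : R :=
  n%:R^-1 * \sum_(i < n) g (design i) * w (design i).

Definition observation (d : measure_display) (T : measurableType d)
    (P : probability T R) (n : nat) (g : R -> R)
    (eps : 'I_n -> {RV P >-> R}) (omega : T) (i : 'I_n) : R :=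
  g (design i) + eps i omega.

Definition theta_block (d : measure_display) (T : measurableType d)
    (P : probability T R) (n : nat) (beta rad lambda h : R) (g w : R -> R)
    (eps : 'I_n -> {RV P >-> R}) (omega : T) : R :=
  block_estimator beta rad lambda h w (observation g eps omega).

End Model.

(* Main.v *)
(* The estimation error is n^-1 sum_i w(i/n) Z_i, where Z_i depends on the error
   e_i through phi(e, s) = min(e, s) - lam^-1 1(e <= s) and the level s = S_i is
   determined by the other observations of the block, hence is independent of
   e_i. So E Z_i = E psi(S_i), where psi(s) = E phi(e_i, s) is O(s^2) in general
   and 0 for the exponential law.

   For i, j in the same block let M_ij be Z_i with observation j left out of the
   block. Whichever of the two observations is the larger one, the other one's
   residual is insensitive to it, so (Z_i - M_ij)(Z_j - M_ji) = 0. Expanding and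
   conditioning,
     E Z_i Z_j = E M_ij psi(S_j) + E M_ji psi(S_i) - E M_ij psi(U_ji),
   U_ji being the level of M_ji; the right-hand side is 0 for the exponential law
   and O(rate^2), or O(rate^3 + rate^4), in general. Distinct blocks are
   independent. With m = n h observations in a block, S_i is at most
   2 R h^beta plus a minimum of m - 1 errors, whose moments are controlled by the
   tail condition, and this bounds E Z_i and E Z_i^2.

   In the balanced regime rate = O(1/m), Var Z_i is at least of order 1/m while the
   off-diagonal covariances of a block sum to O(1/m^2), so Var >= c |w|_2^2 / (n m);
   bias^2 / Var is then O(n / m^3) = O(h^(2 beta_0 - 1)), which tends to 0. *)
Require Import Defs.
From HB Require Import structures.
From mathcomp Require Import all_boot all_order all_algebra.
From mathcomp Require Import all_classical all_reals all_analysis.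
From mathcomp Require Import measurable_realfun ring lra zify.
Set Implicit Arguments.
Unset Strict Implicit.
Unset Printing Implicit Defensive.
Import Order.TTheory GRing.Theory Num.Theory.
Import numFieldNormedType.Exports.
Local Open Scope classical_set_scope.
Local Open Scope ring_scope.

(** * Independence *)

(** Two obstacles shape the proof. As rho > 0 is arbitrary, a single error may have no mean, so only
    minima over many errors have usable moments, and all estimates go through the minimum of the
    other errors of a block. And the rate is not assumed small, since R h^beta is free in the first
    two bounds. Hence psi is bounded both by C s and by C s^2. The linear bound gives covariances
    O(rate^2) whatever the size of the rate. The quadratic one gives the bias, and the covariance
    bound rate^3 + rate^4 needed for the lower variance bound: at rate O(1/m), m covariances of
    order m^-2 would be as large as the diagonal.

    The quadratic bound is a cancellation: E min(e, s) and lam^-1 P(e <= s) are both s + O(s^2), and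
    they coincide for the exponential law.

    The vanishing product is used in the form Z_i Z_j = M_ij Z_j + M_ji Z_i - M_ij M_ji. In each
    product on the right some error enters one factor only, and there only as the truncated value,
    so that it can be integrated out first. *)

Section pi_system_independence.
Local Open Scope ereal_scope.
Context d (T : measurableType d) (R : realType) (P : probability T R).

(** For fixed [B] the set functions P(. [&] B) and P(.) P(B) are finite measures that agree on a
    pi-system containing the whole space, hence on the sigma-algebra it generates. *)
Lemma indep_sigma_l (G : set (set T)) (B : set T) :
  G `<=` measurable -> setI_closed G -> G setT -> measurable B ->
  (forall A, G A -> P (A `&` B) = P A * P B) ->
  forall A, <<s G >> A -> P (A `&` B) = P A * P B.
Proof.
move=> Gm GI GT mB GB A sGA.
pose r := NngNum (fine_ge0 (measure_ge0 P B)).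
have rE C : P C * P B = mscale r P C.
  by rewrite /mscale /= muleC fineK//; exact: fin_num_measure.
rewrite rE; have -> : P (A `&` B) = mrestr P mB A by [].
apply: (g_sigma_algebra_measure_unique G Gm (fun=> setT)) => //.
- by rewrite bigcup_const.
- by move=> C GC; rewrite -[RHS]rE -GB.
- move=> _; change (P (setT `&` B) < +oo).
  by rewrite setTI (le_lt_trans (probability_le1 _ _))// ltry.
Qed.

Lemma indep_sigma (G H : set (set T)) :
  G `<=` measurable -> setI_closed G -> G setT ->
  H `<=` measurable -> setI_closed H -> H setT ->
  (forall A B, G A -> H B -> P (A `&` B) = P A * P B) ->
  forall A B, <<s G >> A -> <<s H >> B -> P (A `&` B) = P A * P B.
Proof.
move=> Gm GI GT Hm HI HT GH A B sGA sHB.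
have mB : measurable B by apply: (smallest_sub _ _ sHB) => //; exact: sigma_algebra_measurable.
apply: (indep_sigma_l Gm) => // C GC.
rewrite setIC muleC; apply: (indep_sigma_l Hm) => //; first exact: Gm.
by move=> D HD; rewrite setIC muleC GH.
Qed.

End pi_system_independence.

Section joint_law.
Local Open Scope ereal_scope.
Context d (T : measurableType d) (R : realType) (P : probability T R).
Context d1 (T1 : measurableType d1) d2 (T2 : measurableType d2).
Variables (X : T -> T1) (W : T -> T2) (mu : probability T1 R).
Hypotheses (mX : measurable_fun setT X) (mW : measurable_fun setT W).
Hypothesis Xmu : forall A, measurable A -> P (X @^-1` A) = mu A.
Hypothesis XW : forall A B, measurable A -> measurable B ->
  P (W @^-1` B `&` X @^-1` A) = P (W @^-1` B) * P (X @^-1` A).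

HB.instance Definition _ := isMeasurableFun.Build _ _ _ _ W mW.
Let nu : probability T2 R := distribution P W.

Let WXp (w : T) : T2 * T1 := (W w, X w).
Let mWXp : measurable_fun setT WXp.
Proof. exact: measurable_fun_pair. Qed.
HB.instance Definition _ := isMeasurableFun.Build _ _ _ _ WXp mWXp.

Let joint : {measure set (T2 * T1)%type -> \bar R} := distribution P WXp.

(** Independence is the product formula on rectangles, and rectangles determine the product measure.
    From here on the joint law can be replaced by [nu \x mu], to which Fubini applies. *)
Let jointE (A : set (T2 * T1)%type) : measurable A -> (nu \x mu) A = joint A.
Proof.
move=> mA; apply: product_measure_unique => // {mA}A B mA mB.
change (P (W @^-1` A `&` X @^-1` B) = P (W @^-1` A) * mu B).
by rewrite XW// Xmu.
Qed.

Let joint_intE (f : T2 * T1 -> \bar R) :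
  \int[distribution P WXp]_z f z = \int[nu \x mu]_z f z.
Proof.
by apply: eq_measure_integral => A mA _; apply/esym; exact: jointE.
Qed.

(** Takes the place of conditional expectation: conditioning on [W] means integrating [X] out under
    its law with the value of [W] frozen. *)
Lemma ge0_joint_integral (f : T2 * T1 -> \bar R) :
  measurable_fun setT f -> (forall x, 0 <= f x) ->
  \int[P]_w f (W w, X w) = \int[P]_w \int[mu]_x f (W w, x).
Proof.
move=> mf f0.
rewrite -[LHS](ge0_integral_distribution WXp mf f0).
rewrite joint_intE.
rewrite fubini_tonelli1// /nu ge0_integral_distribution//.
- exact: measurable_fun_fubini_tonelli_F.
- by move=> y; exact: integral_ge0.
Qed.

Lemma joint_integral (f : T2 * T1 -> \bar R) :
  measurable_fun setT f -> P.-integrable setT (fun w => f (W w, X w)) ->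
  \int[P]_w f (W w, X w) = \int[P]_w \int[mu]_x f (W w, x) /\
  P.-integrable setT (fun w => \int[mu]_x f (W w, x)).
Proof.
move=> mf fi.
have ij : joint.-integrable setT f.
  exact: (integrable_pushforward (phi := WXp)).
have ip : (nu \x mu).-integrable setT f.
  apply/integrableP; split => //.
  by case/integrableP : ij => _; rewrite joint_intE.
have -> : \int[P]_w f (W w, X w) = \int[nu \x mu]_z f z.
  by rewrite -joint_intE integral_distribution.
have iG := integrable_fubini_F ip.
have mG := measurable_int _ iG.
have iW : P.-integrable setT (fubini_F mu f \o W).
  apply/integrableP; split; first exact: measurableT_comp.
  case/integrableP : iG => _; rewrite /nu ge0_integral_distribution//.
  exact: measurableT_comp.
split => //.
rewrite -integral12_prod_meas1//.
by rewrite /nu integral_distribution.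
Qed.

End joint_law.

Section independent_family.
Context d (T : measurableType d) (R : realType) (P : probability T R) (n : nat).
Variable X : 'I_n -> T -> R.
Hypothesis mX : forall i, measurable_fun setT (X i).
Implicit Types J K : {set 'I_n}.

Definition cylinders J : set (set T) :=
  [set E | exists A : 'I_n -> set R, (forall i, measurable (A i)) /\
     E = \bigcap_(i in [set` J]) (X i @^-1` A i)].

(** Measurability for the sigma-algebra of the errors indexed by [J]. Being an instance of
    [measurable_fun], it inherits all closure lemmas for measurable functions. *)
Definition depends_on J d' (U : measurableType d') (Y : T -> U) :=
  measurable_fun (setT : set (g_sigma_algebraType (cylinders J))) Y.

Lemma cylinders_measurable J : cylinders J `<=` measurable.
Proof.
move=> _ [A [mA ->]]; apply: fin_bigcap_measurable => // i _.
by rewrite -[X in measurable X]setTI; exact: mX.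
Qed.

Lemma cylinders_setI J : setI_closed (cylinders J).
Proof.
move=> _ _ [A [mA ->]] [B [mB ->]]; exists (fun i => A i `&` B i).
split; first by move=> i; exact: measurableI.
by rewrite -bigcapI.
Qed.

Lemma cylinders_setT J : cylinders J setT.
Proof. by exists (fun=> setT); split => //; apply/seteqP; split. Qed.

Lemma cylindersS J K : J \subset K -> cylinders J `<=` cylinders K.
Proof.
move=> /fintype.subsetP JK _ [A [mA ->]].
exists (fun i => if i \in J then A i else setT).
split; first by move=> i; case: ifP.
apply/seteqP; split=> w /= h i /= iK.
  by case: ifPn => // iJ; exact: h.
by have := h i (JK _ iK); rewrite /= iK.
Qed.

Lemma depends_on_coord J i : i \in J -> depends_on J (X i).
Proof.
move=> iJ _ B mB; apply: sub_sigma_algebra.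
exists (fun j => if j == i then B else setT); split; first by move=> j; case: ifP.
apply/seteqP; split => w /=; rewrite ?setTI.
  by move=> [_ Bw] j _ /=; case: eqP => // ->.
by move=> /(_ i iJ) /=; rewrite eqxx.
Qed.

Lemma depends_onS J K d' (U : measurableType d') (Y : T -> U) :
  J \subset K -> depends_on J Y -> depends_on K Y.
Proof.
move=> JK mY _ B mB; have := mY measurableT B mB; rewrite !setTI.
by apply: sub_sigma_algebra2; exact: cylindersS.
Qed.

Lemma depends_on_measurable J d' (U : measurableType d') (Y : T -> U) :
  depends_on J Y -> measurable_fun [set: T] Y.
Proof.
move=> mY _ B mB; have := mY measurableT B mB; rewrite !setTI.
by apply: smallest_sub; [exact: sigma_algebra_measurable|exact: cylinders_measurable].
Qed.

Hypothesis indX : forall J (A : 'I_n -> set R), (forall i, measurable (A i)) ->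
  P (\bigcap_(i in [set` J]) (X i @^-1` A i)) = (\prod_(i in J) P (X i @^-1` A i))%E.

(** As [J] and [K] are disjoint, a cylinder over [J] and one over [K] intersect in a single cylinder
    over the union, whose probability factors; independence of the two pi-systems passes to their
    sigma-algebras. Here [truncated_residual] is only a bound variable, a second function next to
    [Y]. *)
Lemma depends_on_indep J K d1 (U1 : measurableType d1) d2 (U2 : measurableType d2)
    (Y : T -> U1) (truncated_residual : T -> U2) A B : disjoint (mem J) (mem K) ->
  depends_on J Y -> depends_on K truncated_residual -> measurable A -> measurable B ->
  P (Y @^-1` A `&` truncated_residual @^-1` B) = (P (Y @^-1` A) * P (truncated_residual @^-1` B))%E.
Proof.
move=> JK mY mZ mA mB.
apply: (indep_sigma (@cylinders_measurable J) (@cylinders_setI J) (@cylinders_setT J)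
  (@cylinders_measurable K) (@cylinders_setI K) (@cylinders_setT K)); last 2 first.
- by have := mY measurableT A mA; rewrite setTI.
- by have := mZ measurableT B mB; rewrite setTI.
move=> {mA mB A B} _ _ [A [mA ->]] [B [mB ->]].
pose C i := if i \in J then A i else B i.
have mC i : measurable (C i) by rewrite /C; case: ifP.
have CA i : i \in J -> C i = A i by rewrite /C => ->.
have CB i : i \in K -> C i = B i.
  by move=> iK; rewrite /C ifF//; apply/negP => iJ; move: (disjointFr JK iJ); rewrite iK.
have -> : \bigcap_(i in [set` J]) (X i @^-1` A i) `&`
    \bigcap_(i in [set` K]) (X i @^-1` B i) =
    \bigcap_(i in [set` J :|: K]) (X i @^-1` C i).
  apply/seteqP; split => w.
    move=> [wA wB] i /=; rewrite finset.in_setU => /orP[iJ|iK].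
      by rewrite CA//; exact: wA.
    by rewrite CB//; exact: wB.
  move=> wC; split => i /= iJK.
    by rewrite -CA//; apply: wC; rewrite /= finset.in_setU iJK.
  by rewrite -CB//; apply: wC; rewrite /= finset.in_setU iJK orbT.
rewrite !indX// (eq_bigl [predU J & K]); last by move=> i; rewrite !inE.
rewrite bigU//=; congr (_ * _)%E.
  by apply: eq_bigr => i iJ; rewrite CA.
by apply: eq_bigr => i iJ; rewrite CB.
Qed.

Variable mu : probability R R.
Hypothesis lawX : forall i A, measurable A -> P (X i @^-1` A) = mu A.

Lemma ge0_integral_cond i J d' (U : measurableType d') (W : T -> U)
    (f : U * R -> \bar R) : i \notin J -> depends_on J W ->
  measurable_fun setT f -> (forall x, 0 <= f x)%E ->
  (\int[P]_w f (W w, X i w) = \int[P]_w \int[mu]_x f (W w, x))%E.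
Proof.
move=> iJ mW; apply: ge0_joint_integral => //.
- exact: depends_on_measurable mW.
- exact: lawX.
- move=> A B mA mB; apply: (depends_on_indep _ mW (@depends_on_coord [set i]%SET i _)) => //.
  + by rewrite disjoint_sym disjoints1.
  + by rewrite inE.
Qed.

Lemma integral_cond i J d' (U : measurableType d') (W : T -> U)
    (f : U * R -> \bar R) : i \notin J -> depends_on J W ->
  measurable_fun setT f -> P.-integrable setT (fun w => f (W w, X i w)) ->
  (\int[P]_w f (W w, X i w) = \int[P]_w \int[mu]_x f (W w, x))%E /\
  P.-integrable setT (fun w => \int[mu]_x f (W w, x))%E.
Proof.
move=> iJ mW; apply: joint_integral => //.
- exact: depends_on_measurable mW.
- exact: lawX.
- move=> A B mA mB; apply: (depends_on_indep _ mW (@depends_on_coord [set i]%SET i _)) => //.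
  + by rewrite disjoint_sym disjoints1.
  + by rewrite inE.
Qed.

End independent_family.

(** * Truncated residuals *)

Section truncation.
Context {R : realType}.
Variable lam : R.

(* When an observation with error [x] is truncated at distance [s] above its
   regression function, this is its contribution
   min(x, s) - lam^-1 1(x <= s) to the estimation error. *)
Definition phi (x : R) (s : \bar R) : R :=
  if (x%:E <= s)%E then x - lam^-1 else fine s.

(** A level that [x] does not exceed can never be the one that truncates it. *)
Lemma phi_mine x u v : (x%:E <= v)%E -> phi x (mine u v) = phi x u.
Proof.
move=> xv; rewrite /phi.
have [uv|vu] := leP u v; first by [].
by rewrite xv (le_trans xv (ltW vu)).
Qed.

Lemma measurable_phi d (T : measurableType d) (f : T -> R) (g : T -> \bar R) :
  measurable_fun setT f -> measurable_fun setT g ->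
  measurable_fun setT (fun w => phi (f w) (g w)).
Proof.
move=> mf mg; apply: measurable_fun_ifT.
- by apply: measurable_fun_lee => //; exact/measurable_EFinP.
- exact: measurable_funB.
- exact: measurableT_comp.
Qed.

Hypothesis lam_gt0 : 0 < lam.

(** The indicator is kept because its mean P(e <= s) is O(s); bounding it by 1 would lose the
    smallness of E|phi|. *)
Lemma phi_bound (x s : R) : 0 <= x -> 0 <= s ->
  `|phi x s%:E| <= s + lam^-1 * (x <= s)%R%:R.
Proof.
move=> x0 s0; rewrite /phi lee_fin; have L : 0 < lam^-1 by rewrite invr_gt0.
case: ifPn => xs /=; last by rewrite mulr0 addr0 ger0_norm.
rewrite mulr1; apply: le_trans (ler_normB _ _) _.
by rewrite ger0_norm// gtr0_norm// lerD2r.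
Qed.

(** A bound free of the level, which is infinite when a block has a single observation. It serves
    for errors with a second moment, such as exponential ones. *)
Lemma phi_bound_dominated (x : R) (s : \bar R) : 0 <= x -> (0 <= s)%E ->
  `|phi x s| <= x + lam^-1.
Proof.
move=> x0 s0; rewrite /phi; have L : 0 < lam^-1 by rewrite invr_gt0.
case: ifPn => xs /=.
  by apply: le_trans (ler_normB _ _) _; rewrite ger0_norm// gtr0_norm.
move: s s0 xs => [s| |]//=; rewrite ?leey// !lee_fin => s0; rewrite -ltNge => sx.
by rewrite ger0_norm// (le_trans (ltW sx))// lerDl ltW.
Qed.

End truncation.

(** * Leaving observations out of a block *)

Section leave_one_out.
Context {R : realType}.
Variables (lam r : R) (n : nat) (g : 'I_n -> R) (blk : 'I_n -> nat).
Implicit Types (K : {set 'I_n}) (x : 'I_n -> R).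

Definition others (i : 'I_n) : {set 'I_n} :=
  [set j | (blk j == blk i) && (j != i)].

(* The observation [g i + x i] is truncated at [min_(j in K) (g j + x j) + r]
   exactly when the error [x i] is truncated at [slack K i x]. Removing [i] from
   its own block does not change the truncated value, so that in
   [truncated_residual] the level is independent of the error it truncates. *)
Definition slack K (i : 'I_n) x : \bar R :=
  \big[mine/+oo%E]_(j in K) (g j + x j + r - g i)%:E.

Definition xmin K x : \bar R := \big[mine/+oo%E]_(j in K) (x j)%:E.

Definition truncated_residual i x := phi lam (x i) (slack (others i) i x).
(** The M_ij of the overview: neither error [i] nor error [j] enters the level, so the whole
    expression does not involve error [j]. *)
Definition truncated_residual2 i j x := phi lam (x i) (slack (others i :\ j) i x).

Lemma othersP i j : (j \in others i) = (blk j == blk i) && (j != i).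
Proof. by rewrite inE. Qed.

Lemma others2_sym i j : blk i = blk j -> others i :\ j = others j :\ i.
Proof.
by move=> ij; apply/setP => l; rewrite !inE ij; case: (l == j); case: (l == i);
  rewrite ?andbT ?andbF.
Qed.

Lemma slackS K K' i x : K \subset K' -> (slack K' i x <= slack K i x)%E.
Proof. by move=> /fintype.subsetP KK'; apply: sub_bigmin. Qed.

Lemma slack_others i j x : j \in others i ->
  slack (others i) i x = mine (slack (others i :\ j) i x) (g j + x j + r - g i)%:E.
Proof.
move=> ji; rewrite /slack -{1}(finset.setD1K ji) finset.big_setU1/=; last first.
  by rewrite !inE eqxx.
by rewrite minC.
Qed.

Hypothesis r_ge0 : 0 <= r.

Lemma truncated_residual_eq2 i j x : j \in others i -> g i + x i <= g j + x j ->
  truncated_residual i x = truncated_residual2 i j x.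
Proof.
move=> ji yij; rewrite /truncated_residual /truncated_residual2 (slack_others _ ji) phi_mine// lee_fin.
have := r_ge0.
lra.
Qed.

(* Whichever of the observations i and j is the smaller one, its residual does
   not change when the other one is removed from the block. *)
Lemma truncated_residual_orth i j x : blk i = blk j -> i != j ->
  (truncated_residual i x - truncated_residual2 i j x) * (truncated_residual j x - truncated_residual2 j i x) = 0.
Proof.
move=> bij ij; have ji : j \in others i by rewrite othersP bij eqxx eq_sym.
have ij' : i \in others j by rewrite othersP bij eqxx.
have [yij|yji] := lerP (g i + x i) (g j + x j).
  by rewrite (truncated_residual_eq2 ji yij) subrr mul0r.
by rewrite (truncated_residual_eq2 ij' (ltW yji)) subrr mulr0.
Qed.

Hypothesis g_osc : forall i j, blk i = blk j -> `|g i - g j| <= r.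

(** The margin [r] absorbs the oscillation of [g]: for [i] and [j] in one block, g_j + r - g_i lies
    in [0, 2r], so observation [j] puts the level between x_j and x_j + 2r. *)
Lemma slack_ge K i x (a : \bar R) : {in K, forall j, blk j = blk i} ->
  (forall j, j \in K -> (a <= (x j)%:E)%E) -> (a <= slack K i x)%E.
Proof.
move=> Ki ax; apply: le_bigmin; first exact: leey.
move=> j jK; apply: (le_trans (ax _ jK)); rewrite lee_fin.
by have := g_osc (Ki _ jK); rewrite ler_norml; lra.
Qed.

Lemma slack_le K i j x : j \in K -> blk j = blk i ->
  (slack K i x <= (x j + 2 * r)%:E)%E.
Proof.
move=> jK ji; apply: (@bigmin_inf _ _ _ _ j) => //; rewrite lee_fin.
by have := g_osc ji; rewrite ler_norml; lra.
Qed.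

Lemma slack_le_xmin K i x : {in K, forall j, blk j = blk i} ->
  (slack K i x <= xmin K x + (2 * r)%:E)%E.
Proof.
move=> Ki; rewrite /xmin.
have [/eqP K0|[j jK]] := set_0Vmem K.
  by rewrite (eqP K0) finset.big_set0 leey.
have [|j0 j0K ->] := eq_bigmin (x := +oo%E) j (mem K) (fun j => (x j)%:E) jK.
  by move=> *; exact: leey.
by rewrite -EFinD; apply: slack_le => //; exact: Ki.
Qed.

Lemma slack_ge_xmin K i x : {in K, forall j, blk j = blk i} ->
  (xmin K x <= slack K i x)%E.
Proof. by move=> Ki; apply: slack_ge => // j jK; by apply: (@bigmin_inf _ _ _ _ j). Qed.

Lemma slack_ge0 K i x : {in K, forall j, blk j = blk i} ->
  (forall j, 0 <= x j) -> (0 <= slack K i x)%E.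
Proof. by move=> Ki x0; apply: slack_ge => // j _; rewrite lee_fin. Qed.

Lemma others_blk i : {in others i, forall j, blk j = blk i}.
Proof. by move=> j; rewrite othersP => /andP[/eqP]. Qed.

Lemma others2_blk i j : {in others i :\ j, forall l, blk l = blk i}.
Proof. by move=> l; rewrite finset.in_setD1 => /andP[_ /others_blk]. Qed.

(** If the observation [i] is at most the threshold, it is also at most the leave-one-out level,
    which can only be higher. Otherwise the minimum is attained at another observation and the two
    levels coincide. *)
Lemma block_residualE (K : {set 'I_n}) i x : K =i [pred j | blk j == blk i] ->
  let t := fine (\big[mine/+oo%E]_(j in K) (g j + x j)%:E) + r in
  Num.min (g i + x i) t - lam^-1 * (g i + x i <= t)%R%:R = g i + truncated_residual i x.
Proof.
move=> Ki t; have iK : i \in K by rewrite Ki inE.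
have [|j0 j0K tE] := eq_bigmin (x := +oo%E) i (mem K) (fun j => (g j + x j)%:E) iK.
  by move=> *; exact: leey.
have t_le j : j \in K -> t <= g j + x j + r.
  move=> jK; rewrite /t tE/= lerD2r -lee_fin -tE.
  by apply: (@bigmin_inf _ _ _ _ j).
have {}tE : t = g j0 + x j0 + r by rewrite /t tE.
rewrite /truncated_residual /phi; case: (lerP (g i + x i) t) => it.
  have -> : ((x i)%:E <= slack (others i) i x)%E.
    apply: le_bigmin => [|j ji]; first exact: leey.
    rewrite lee_fin; have := t_le j; rewrite Ki inE (others_blk ji) eqxx => /(_ isT).
    lra.
  by rewrite mulr1; ring.
(* Were the minimum attained at [i], the threshold would be g_i + x_i + r, which is not below g_i +
   x_i. *)
have j0i : j0 \in others i.
  rewrite othersP; move: (j0K); rewrite [_ \in _]Ki inE => -> /=.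
  by apply/eqP => j0i; move: it r_ge0; rewrite tE j0i; lra.
have -> : slack (others i) i x = (t - g i)%:E.
  apply/eqP; rewrite eq_le; apply/andP; split.
    by apply: (@bigmin_inf _ _ _ _ j0) => //; rewrite tE.
  apply: le_bigmin => [|j ji]; first exact: leey.
  by rewrite lee_fin lerD2r t_le// Ki inE (others_blk ji).
rewrite lee_fin ifF/=; last by apply/negbTE; rewrite -ltNge; lra.
by rewrite mulr0; ring.
Qed.

End leave_one_out.

(** * The exponential law *)

Section density.
Context d (T : measurableType d) (R : realType).
Variables (m nu : {measure set T -> \bar R}) (p : T -> R).
Hypotheses (mp : measurable_fun setT p) (p_ge0 : forall x, (0 <= p x)%R).
Hypothesis nuE : forall A, measurable A -> nu A = (\int[m]_(x in A) (p x)%:E)%E.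

Import HBNNSimple.

Let integral_density_nnsfun (f : {nnsfun T >-> R}) :
  (\int[nu]_x (f x)%:E = \int[m]_x ((f x)%:E * (p x)%:E))%E.
Proof.
have mfr r : measurable (f @^-1` [set r]) by exact: measurable_sfunP.
have mfi r : measurable_fun setT (\1_(f @^-1` [set r]) : T -> R).
  exact: (@measurable_indic _ T R setT _ (mfr r)).
under [LHS]eq_integral do rewrite fimfunE -fsumEFin//.
rewrite [LHS]ge0_integral_fsum//; last 2 first.
  - move=> r; apply/measurable_EFinP; apply: measurable_funM => //.
  - by move=> n x _; rewrite EFinM nnfun_muleindic_ge0.
under [RHS]eq_integral.
  move=> x xD; rewrite fimfunE -fsumEFin// ge0_mule_fsuml; last first.
    by move=> r; rewrite EFinM nnfun_muleindic_ge0.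
  over.
rewrite [RHS]ge0_integral_fsum//; last 2 first.
  - move=> r; apply: emeasurable_funM => //; last exact/measurable_EFinP.
    by apply/measurable_EFinP; apply: measurable_funM => //; exact: mfi.
  - by move=> r x _; rewrite EFinM mule_ge0// ?lee_fin// -lee_fin EFinM nnfun_muleindic_ge0.
apply: eq_fsbigr => r; rewrite inE => -[x _ <-].
have fx0 : (0 <= (f x)%:E :> \bar R)%E by rewrite lee_fin.
under eq_integral do rewrite EFinM.
rewrite ge0_integralZl//; last by exact/measurable_EFinP/mfi.
rewrite integral_indic// setIT.
under [RHS]eq_integral do rewrite EFinM -muleA.
rewrite [RHS]ge0_integralZl//; last 2 first.
  - apply: emeasurable_funM => //; last exact/measurable_EFinP.
    exact/measurable_EFinP/mfi.
  - by move=> y _; rewrite mule_ge0// lee_fin.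
rewrite nuE//; congr (_ * _)%E.
rewrite integral_mkcond; apply: eq_integral => y _.
rewrite patchE indicE; case: ifP => _; first by rewrite mul1e.
by rewrite mul0e.
Qed.

(** The density formula is given for sets only; it passes to simple functions by linearity and to
    nonnegative functions by monotone convergence. *)
Lemma ge0_integral_density (f : T -> \bar R) :
  measurable_fun setT f -> (forall x, 0 <= f x)%E ->
  (\int[nu]_x f x = \int[m]_x (f x * (p x)%:E))%E.
Proof.
move=> mf f0.
pose f_ := nnsfun_approx measurableT mf.
transitivity (lim (\int[nu]_x (f_ n x)%:E @[n --> \oo])%E).
  rewrite -monotone_convergence//=.
  - apply: eq_integral => ? /[!inE] xD; apply/esym/cvg_lim => //=.
    exact: cvg_nnsfun_approx.
  - by move=> n; exact/measurable_EFinP/measurable_funTS.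
  - by move=> n ? _; rewrite lee_fin.
  - by move=> ? _ ? ? mn; rewrite lee_fin; exact/lefP/nd_nnsfun_approx.
under eq_fun do rewrite integral_density_nnsfun.
rewrite -monotone_convergence//=.
- apply: eq_integral => x _; rewrite limeMr//.
    by congr (_ * _)%E; apply/cvg_lim => //; exact: cvg_nnsfun_approx.
  apply/cvg_ex; exists (f x); exact: cvg_nnsfun_approx.
- by move=> n; apply: emeasurable_funM => //; exact/measurable_EFinP.
- by move=> n x _; rewrite mule_ge0// lee_fin.
- move=> x _ a b ab; apply: lee_wpmul2r; rewrite ?lee_fin//.
  exact/lefP/nd_nnsfun_approx.
Qed.

End density.

Section exponential_moments.
Context {R : realType}.
Variable lam : R.
Hypothesis lam_gt0 : 0 < lam.
Notation leb := (@lebesgue_measure R).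

(* The exponential law of the library lives on the display of the Lebesgue
   measure, not on the default one. *)
Let id_ (x : measurableTypeR R) : R := x.
Let mid_ : measurable_fun [set: measurableTypeR R] id_.
Proof. exact: measurable_id. Qed.
HB.instance Definition _ := isMeasurableFun.Build _ _ _ _ id_ mid_.

Let expP : probability (measurableTypeR R) R :=
  exponential_distribution_exponential_prob__canonical__probability_measure_Probability
    lam_gt0.

Definition exponential_law : probability R R := distribution expP id_.

Lemma exponential_lawE A : exponential_law A = exponential_prob lam A.
Proof. by []. Qed.

Lemma ge0_integral_exponential (f : R -> \bar R) :
  measurable_fun setT f -> (forall x, 0 <= f x)%E ->
  (\int[exponential_law]_x f x =
   \int[leb]_(x in `[0%R, +oo[) (f x * (lam * expR (- lam * x))%:E))%E.
Proof.
move=> mf f0; rewrite ge0_integral_distribution//.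
rewrite (@ge0_integral_density _ _ _ leb expP (exponential_pdf lam))//.
- rewrite [RHS]integral_mkcond; apply: eq_integral => x _.
  rewrite /exponential_pdf !patchE; case: ifP => // _; by rewrite mule0.
- exact: measurable_exponential_pdf.
- by move=> x; exact/exponential_pdf_ge0/ltW.
Qed.

Implicit Types q : {poly R}.

Let F q : R -> R := - (horner q * (expR \o horner (- lam *: 'X))).

(* [lam q - q'] over [exp (lam x)] has the primitive [- q / exp (lam x)] *)
Let f q (x : R) : R := (lam * q.[x] - q^`().[x]) * expR (- lam * x).

Let FE q x : F q x = - (q.[x] * expR (- lam * x)).
Proof. by rewrite /F !fctE /= hornerZ hornerX. Qed.

Let dF q (x : R) : is_derive x (1 : R) (F q) (f q x).
Proof.
apply: is_derive_eq; rewrite /f /= /GRing.scale /=.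
rewrite derivZ derivX !hornerZ hornerX hornerC; ring.
Qed.

Let cvg_expRN n : (x ^+ n * expR (- lam * x)) @[x --> +oo] --> (0 : R).
Proof.
have K0 : 0 <= (n.+1`!%:R / lam ^+ n.+1 : R).
  by rewrite divr_ge0// exprn_ge0// ltW.
apply: (@squeeze_cvgr _ _ _ _ (fun=> 0) (fun x => (n.+1`!%:R / lam ^+ n.+1) * x^-1)).
- near=> x; have x0 : 0 < x by near: x; exact: nbhs_pinfty_gt.
  rewrite mulr_ge0 ?expR_ge0 ?exprn_ge0 ?(ltW x0)//=.
  have lx : 0 < lam * x by rewrite mulr_gt0.
  (* The exponential dominates its Taylor term of degree n+1; the extra degree leaves a factor
     1/x. *)
  have := expR_ge1Dxn n (ltW lx).
  rewrite mulNr expRN => h.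
  have e0 : 0 < expR (lam * x) := expR_gt0 _.
  rewrite ler_pdivrMr//.
  have {}h : (lam * x) ^+ n.+1 / n.+1`!%:R <= expR (lam * x) by apply: le_trans h; lra.
  apply: le_trans (ler_wpM2l _ h); last by rewrite mulr_ge0// invr_ge0 ltW.
  rewrite exprMn [X in _ <= X](_ : _ = x ^+ n)//.
  have L0 : lam ^+ n.+1 != 0 by rewrite expf_neq0// gt_eqF.
  have k0 : (n.+1`!%:R : R) != 0 by rewrite pnatr_eq0 -lt0n fact_gt0.
  rewrite (exprS x); field.
  by rewrite L0 k0 gt_eqF.
- exact: cvg_cst.
- rewrite -[X in _ --> X](mulr0 (n.+1`!%:R / lam ^+ n.+1)).
  apply: cvgM; first exact: cvg_cst.
  apply/gtr0_cvgV0; last exact: cvg_id.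
  exact: nbhs_pinfty_gt.
Unshelve. all: by end_near. Qed.

Let cvg_F q : F q x @[x --> +oo] --> (0 : R).
Proof.
rewrite (_ : F q = fun x => \sum_(i < size q) (- q`_i * (x ^+ i * expR (- lam * x)))); last first.
  apply/funext => x; rewrite FE horner_coef mulr_suml -sumrN.
  by apply: eq_bigr => i _; rewrite [RHS]mulNr mulrA.
pose G i (x : R) := - q`_i * (x ^+ i * expR (- lam * x)).
have cG i : G i x @[x --> +oo] --> (0 : R).
  rewrite -[X in _ --> X](mulr0 (- q`_i)).
  by apply: cvgM; [exact: cvg_cst|exact: cvg_expRN].
suff H (s : seq 'I_(size q)) :
  (fun x => \sum_(i <- s) G i x) @ +oo --> (0 : R) by exact: H.
elim: s => [|i s IH].
  rewrite (_ : (fun x => _) = cst 0); first exact: cvg_cst.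
  by apply/funext => x; rewrite big_nil.
rewrite (_ : (fun x => _) = (fun x => G i x + \sum_(j <- s) G j x)).
  by rewrite -[X in _ --> X](addr0 0); exact: cvgD.
by apply/funext => x; rewrite big_cons.
Qed.

Let cF q : continuous (F q : R -> R).
Proof.
move=> x; apply/differentiable_continuous/derivable1_diffP.
exact: (@ex_derive _ _ _ _ _ _ _ (dF q x)).
Qed.

Let cf q : continuous (f q : R -> R).
Proof.
move=> x.
rewrite (_ : f q = - F (lam *: q - q^`())).
  by apply: continuousN; exact: cF.
by apply/funext => y; rewrite /f fctE FE opprK !hornerE.
Qed.

Lemma integral_poly_exp_seg q (s : R) : 0 <= s ->
  (\int[leb]_(x in `[0%R, s]) ((lam * q.[x] - q^`().[x]) * expR (- lam * x))%:E =
  (q.[0] - q.[s] * expR (- lam * s))%:E)%E.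
Proof.
rewrite le_eqVlt => /predU1P[<-|s0].
  by rewrite set_itv1 integral_set1 mulr0 expR0 mulr1 subrr.
rewrite (@continuous_FTC2 _ (f q) (F q) 0 s)//.
- by rewrite !FE -EFinB mulr0 expR0 mulr1 opprK addrC.
- exact/continuous_subspaceT/cf.
- split.
  + by move=> z _; exact: (@ex_derive _ _ _ _ _ _ _ (dF q z)).
  + by apply: cvg_at_right_filter; exact: cF.
  + by apply: cvg_at_left_filter; exact: cF.
- by move=> z _; rewrite derive1E (@derive_val _ _ _ _ _ _ _ (dF q z)).
Qed.

Lemma integral_poly_exp_ray q (a : R) :
  (forall x, a <= x -> 0 <= lam * q.[x] - q^`().[x]) ->
  (\int[leb]_(x in `[a, +oo[) ((lam * q.[x] - q^`().[x]) * expR (- lam * x))%:E =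
  (q.[a] * expR (- lam * a))%:E)%E.
Proof.
move=> p0.
rewrite (@ge0_continuous_FTC2y _ (f q) (F q) a 0)//.
- by rewrite FE -EFinB sub0r opprK.
- by move=> x ax; rewrite mulr_ge0 ?expR_ge0 ?p0.
- exact/continuous_subspaceT/cf.
- by apply: cvg_at_right_filter; exact: cF.
- by move=> z _; rewrite derive1E (@derive_val _ _ _ _ _ _ _ (dF q z)).
Qed.

End exponential_moments.

Section exponential_law.
Context {R : realType}.
Variable lam : R.
Hypothesis lam_gt0 : 0 < lam.
Notation leb := (@lebesgue_measure R).
Notation mu := (exponential_law lam_gt0).
Implicit Types (q : {poly R}) (s : R).

(** Multiplied by the density lam exp(-lam x), an integrand q - q'/lam has the primitive -q(x)
    exp(-lam x), so that its mean is read off from boundary values. Each moment below amounts to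
    solving q - q'/lam = p for a polynomial q. *)
Let dq q (x : R) := q.[x] - lam^-1 * q^`().[x].

Let dqE q x : dq q x * (lam * expR (- lam * x)) =
  (lam * q.[x] - q^`().[x]) * expR (- lam * x).
Proof. by rewrite /dq; field; rewrite gt_eqF. Qed.

Let measurable_horner q : measurable_fun [set: R] (horner q).
Proof. by apply: continuous_measurable_fun; exact: continuous_horner. Qed.

Let measurable_dq q : measurable_fun [set: R] (dq q).
Proof. by apply: measurable_funB => //; exact: measurable_funM. Qed.

Let measurable_maxr0 : measurable_fun [set: R] (fun x : R => Num.max x 0).
Proof. exact: measurable_maxr. Qed.

Let dq_ge0 q : (forall x, 0 <= x -> 0 <= q.[x] - lam^-1 * q^`().[x]) ->
  forall x, 0 <= x -> 0 <= lam * q.[x] - q^`().[x].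
Proof.
move=> q0 x x0; rewrite (_ : _ - _ = lam * dq q x).
  by rewrite mulr_ge0 ?q0// ltW.
by rewrite /dq; field; rewrite gt_eqF.
Qed.

(** The shape met with truncated errors: polynomial up to the level [s], constant beyond it. The
    positive part appears because the errors are later replaced by their positive parts. *)
Lemma integral_exponential_piece q s c : 0 <= s -> 0 <= c ->
  (forall x, 0 <= x -> 0 <= q.[x] - lam^-1 * q^`().[x]) ->
  (\int[mu]_x (if Num.max x 0 <= s then
       q.[Num.max x 0] - lam^-1 * q^`().[Num.max x 0] else c)%:E =
  (q.[0] - q.[s] * expR (- lam * s) + c * expR (- lam * s))%:E)%E.
Proof.
move=> s0 c0 q0.
rewrite ge0_integral_exponential//; last 2 first.
- apply/measurable_EFinP; apply: measurable_fun_ifT => //.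
  + exact: measurable_fun_ler.
  + exact: (measurableT_comp (measurable_dq q)).
- move=> x; rewrite lee_fin; case: ifP => // _; apply: q0.
  by rewrite le_max lexx orbT.
rewrite (@itv_bndbnd_setU _ _ _ (BRight s)) ?bnd_simp//.
have e0 x : 0 <= lam * expR (- lam * x) by rewrite mulr_ge0 ?expR_ge0// ltW.
rewrite ge0_integral_setU//=; last 3 first.
- apply: measurable_funTS; apply: emeasurable_funM.
    apply/measurable_EFinP; apply: measurable_fun_ifT => //.
    + exact: measurable_fun_ler.
    + exact: (measurableT_comp (measurable_dq q)).
  apply/measurable_EFinP; apply: measurable_funM => //.
  by apply: measurableT_comp => //; exact: measurable_funM.
- move=> x _; rewrite mule_ge0 ?lee_fin//; case: ifP => // _; apply: q0.
  by rewrite le_max lexx orbT.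
- apply/disj_setPS => y [/=]; rewrite !in_itv/= => /andP[_ ys].
  by rewrite andbT ltNge ys.
rewrite EFinD; congr (_ + _)%E.
  rewrite -integral_poly_exp_seg//; apply: eq_integral => x.
  rewrite inE/= in_itv/= => /andP[x0 xs].
  by rewrite max_l// xs -EFinM -dqE.
transitivity (\int[leb]_(x in `]s, +oo[) ((lam * c%:P.[x] - (c%:P)^`().[x]) * expR (- lam * x))%:E)%E.
  apply: eq_integral => x; rewrite inE/= in_itv/= andbT => sx.
  rewrite max_l ?(ltW (le_lt_trans s0 sx))// leNgt sx/= derivC !hornerC -EFinM.
  by congr EFin; ring.
rewrite integral_itv_obnd_cbnd; last first.
  apply/measurable_EFinP; apply: measurable_funTS; apply: measurable_funM.
    by apply: measurable_funB => //; exact: measurable_funM.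
  by apply: measurableT_comp => //; exact: measurable_funM.
rewrite integral_poly_exp_ray ?hornerC// => x sx.
by rewrite derivC !hornerC subr0 mulr_ge0// ltW.
Qed.

Lemma integral_exponential_ray q :
  (forall x, 0 <= x -> 0 <= q.[x] - lam^-1 * q^`().[x]) ->
  (\int[mu]_x (q.[Num.max x 0] - lam^-1 * q^`().[Num.max x 0])%:E = q.[0]%:E)%E.
Proof.
move=> q0.
rewrite ge0_integral_exponential//; last 2 first.
- apply/measurable_EFinP; exact: (measurableT_comp (measurable_dq q)).
- by move=> x; rewrite lee_fin; apply: q0; rewrite le_max lexx orbT.
have := integral_poly_exp_ray lam_gt0 (dq_ge0 q0).
rewrite mulr0 expR0 mulr1 => <-.
apply: eq_integral => x; rewrite inE/= in_itv/= andbT => x0.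
by rewrite max_l// -EFinM -dqE.
Qed.

End exponential_law.

Section exponential_residual.
Context {R : realType}.
Variable lam : R.
Hypothesis lam_gt0 : 0 < lam.
Notation leb := (@lebesgue_measure R).
Notation mu := (exponential_law lam_gt0).

(** The survival function of the law, with its limit 0 at the infinite level. *)
Definition exp_tail (s : \bar R) : R := if s is r%:E then expR (- lam * r) else 0.

Let invl_ge0 : 0 <= lam^-1. Proof. by rewrite invr_ge0 ltW. Qed.

Lemma integral_exponential_phi_sq (s : \bar R) : (0 <= s)%E ->
  (\int[mu]_x (phi lam (Num.max x 0) s ^+ 2)%:E = (lam^-2 * (1 - exp_tail s))%:E)%E.
Proof.
(* The solution of q - q'/lam = (x - 1/lam)^2. As q(s) exceeds s^2 by lam^-2, the boundary terms at
   [s] combine to -lam^-2 exp(-lam s). *)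
pose q : {poly R} := 'X^2 + (lam^-2)%:P.
have qE x : q.[x] = x ^+ 2 + lam^-2 by rewrite /q hornerD hornerXn hornerC.
have dqE x : q^`().[x] = x + x.
  by rewrite /q derivD derivC addr0 derivXn expr1 hornerMn hornerX mulr2n.
have qqE x : q.[x] - lam^-1 * q^`().[x] = (x - lam^-1) ^+ 2.
  by rewrite qE dqE -exprVn; ring.
have q0 x : 0 <= x -> 0 <= q.[x] - lam^-1 * q^`().[x] by rewrite qqE sqr_ge0.
case: s => [s| |]//=; first rewrite lee_fin => s0.
- transitivity (\int[mu]_x (if (Num.max x 0 <= s)%R then
      (q.[Num.max x 0] - lam^-1 * q^`().[Num.max x 0])%R else (s ^+ 2)%R)%:E)%E.
    apply: eq_integral => x _; rewrite /phi lee_fin; case: ifP => //.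
    by rewrite qqE.
  rewrite (integral_exponential_piece lam_gt0 s0 (sqr_ge0 s) q0) !qE.
  by congr EFin; ring.
- move=> _; rewrite subr0 mulr1 -[X in X%:E](_ : q.[0] = lam^-2); last by rewrite qE; ring.
  rewrite -(integral_exponential_ray lam_gt0 q0).
  by apply: eq_integral => x _; rewrite /phi leey qqE.
Qed.

Lemma integral_exponential_sq :
  (\int[mu]_x ((Num.max x 0) ^+ 2)%:E = (2 * lam^-2)%:E)%E.
Proof.
pose q : {poly R} := 'X^2 + (2 / lam) *: 'X + (2 * lam^-2)%:P.
have qE x : q.[x] = x ^+ 2 + (2 / lam) * x + 2 * lam^-2.
  by rewrite /q !hornerD hornerXn hornerC hornerZ hornerX.
have dqE x : q^`().[x] = x + x + 2 / lam.
  rewrite /q !derivD derivC addr0 derivXn expr1 derivZ derivX hornerD.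
  by rewrite hornerMn hornerX hornerZ hornerC mulr1 mulr2n.
have qqE x : q.[x] - lam^-1 * q^`().[x] = x ^+ 2.
  by rewrite qE dqE -exprVn; ring.
have q0 x : 0 <= x -> 0 <= q.[x] - lam^-1 * q^`().[x] by rewrite qqE sqr_ge0.
rewrite -[X in X%:E](_ : q.[0] = 2 * lam^-2); last by rewrite qE; ring.
rewrite -(integral_exponential_ray lam_gt0 q0).
by apply: eq_integral => x _; rewrite qqE.
Qed.

(** Both E min(e, s) and P(e <= s)/lam equal (1 - exp(-lam s))/lam. They are integrated separately,
    as [u] and [v], because the moment formulas are for nonnegative functions. *)
Lemma integral_exponential_phi (s : \bar R) : (0 <= s)%E ->
  (\int[mu]_x (phi lam (Num.max x 0) s)%:E = 0)%E.
Proof.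
move=> s0.
pose u x := if ((Num.max x 0)%:E <= s)%E then Num.max x 0 else fine s.
pose v x := if ((Num.max x 0)%:E <= s)%E then lam^-1 else 0.
have m0 : measurable_fun [set: R] (fun x : R => Num.max x 0) by exact: measurable_maxr.
have mb : measurable_fun [set: R] (fun x : R => (Num.max x 0)%:E <= s)%E.
  by apply: measurable_fun_lee => //; exact/measurable_EFinP.
have u0 x : 0 <= u x.
  by rewrite /u; case: ifP => _; rewrite ?fine_ge0// le_max lexx orbT.
have v0 x : 0 <= v x by rewrite /v; case: ifP.
have mu_ : measurable_fun [set: R] u by exact: measurable_fun_ifT.
have mv : measurable_fun [set: R] v by exact: measurable_fun_ifT.
have uE : (\int[mu]_x (u x)%:E = (lam^-1 * (1 - exp_tail s))%:E)%E.
  pose q : {poly R} := 'X + (lam^-1)%:P.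
  have qE x : q.[x] = x + lam^-1 by rewrite /q hornerD hornerX hornerC.
  have qqE x : q.[x] - lam^-1 * q^`().[x] = x.
    by rewrite qE /q derivD derivC addr0 derivX hornerC; ring.
  have q0 x : 0 <= x -> 0 <= q.[x] - lam^-1 * q^`().[x] by rewrite qqE.
  rewrite /u; case: s s0 {u v mb u0 v0 mu_ mv} => [s| |]//=; first rewrite lee_fin => s0.
  - transitivity (\int[mu]_x (if (Num.max x 0 <= s)%R then
      (q.[Num.max x 0] - lam^-1 * q^`().[Num.max x 0])%R else s)%:E)%E.
      by apply: eq_integral => x _; rewrite lee_fin; case: ifP => //; rewrite qqE.
    rewrite (integral_exponential_piece lam_gt0 s0 s0 q0) !qE.
    by congr EFin; ring.
  - move=> _; rewrite subr0 mulr1 -[X in X%:E](_ : q.[0] = lam^-1); last by rewrite qE; ring.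
    rewrite -(integral_exponential_ray lam_gt0 q0).
    by apply: eq_integral => x _; rewrite leey qqE.
have vE : (\int[mu]_x (v x)%:E = (lam^-1 * (1 - exp_tail s))%:E)%E.
  pose q : {poly R} := (lam^-1)%:P.
  have qqE x : q.[x] - lam^-1 * q^`().[x] = lam^-1.
    by rewrite /q derivC !hornerC; ring.
  have q0 x : 0 <= x -> 0 <= q.[x] - lam^-1 * q^`().[x] by rewrite qqE.
  rewrite /v; case: s s0 {u v mb u0 v0 mu_ mv uE} => [s| |]//=; first rewrite lee_fin => s0.
  - transitivity (\int[mu]_x (if (Num.max x 0 <= s)%R then
      (q.[Num.max x 0] - lam^-1 * q^`().[Num.max x 0])%R else 0)%:E)%E.
      by apply: eq_integral => x _; rewrite lee_fin; case: ifP => //; rewrite qqE.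
    rewrite (integral_exponential_piece lam_gt0 s0 (lexx 0) q0) !hornerC.
    by congr EFin; ring.
  - move=> _; rewrite subr0 mulr1 -[X in X%:E](_ : q.[0] = lam^-1); last by rewrite hornerC.
    rewrite -(integral_exponential_ray lam_gt0 q0).
    by apply: eq_integral => x _; rewrite leey qqE.
transitivity (\int[mu]_x ((u x)%:E - (v x)%:E))%E.
  apply: eq_integral => x _; rewrite /phi /u /v; case: ifP => _; rewrite -EFinB ?subr0//.
have iu : mu.-integrable setT (EFin \o u).
  apply/integrableP; split; first exact/measurable_EFinP.
  under eq_integral do rewrite /= ger0_norm//.
  by rewrite uE ltry.
have iv : mu.-integrable setT (EFin \o v).
  apply/integrableP; split; first exact/measurable_EFinP.
  under eq_integral do rewrite /= ger0_norm//.
  by rewrite vE ltry.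
by rewrite integralB// uE vE subee.
Qed.

Lemma exponential_law_ray (a : R) : 0 <= a ->
  (mu `[a, +oo[%classic = (expR (- lam * a))%:E)%E.
Proof.
move=> a0; rewrite exponential_lawE /exponential_prob.
rewrite -[RHS](_ : ((1%:P : {poly R}).[a] * expR (- lam * a))%:E = _)%E; last first.
  by rewrite hornerC mul1r.
rewrite -integral_poly_exp_ray//; last first.
  by move=> x _; rewrite derivC !hornerC subr0 mulr1 ltW.
apply: eq_integral => x; rewrite inE/= in_itv/= andbT => ax.
by rewrite exponential_pdfE ?(le_trans a0)// derivC !hornerC subr0 mulr1.
Qed.

(** The variable exp(-lam e) is uniform on the unit interval. Its k-th power is the probability,
    given e, that k further errors are all at least e; so 1/(k+1) is the chance of being the
    smallest of k+1 errors. *)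
Lemma integral_exponential_expR (k : nat) :
  (\int[mu]_x (expR (- lam * Num.max x 0) ^+ k)%:E = (k.+1%:R^-1)%:E)%E.
Proof.
have K0 : (0 : R) < k.+1%:R by rewrite ltr0n.
have m0 : measurable_fun [set: R] (fun x : R => (expR (- lam * Num.max x 0) ^+ k)%:E).
  apply/measurable_EFinP; apply: measurable_funX; apply: measurableT_comp => //.
  by apply: measurable_funM => //; exact: measurable_maxr.
rewrite ge0_integral_exponential//.
have l0 : 0 < k.+1%:R * lam by rewrite mulr_gt0.
have := integral_poly_exp_ray l0 (q := (k.+1%:R^-1)%:P) (a := 0).
rewrite mulr0 expR0 hornerC mulr1 => <-; last first.
  by move=> x _; rewrite derivC !hornerC subr0 mulr_ge0// ltW// invr_gt0.
apply: eq_integral => x; rewrite inE/= in_itv/= andbT => x0.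
rewrite max_l// -EFinM derivC !hornerC subr0; congr EFin.
have -> : - (k.+1%:R * lam) * x = k.+1%:R * (- lam * x) by ring.
rewrite expRM_natl exprS; field.
by rewrite gt_eqF.
Qed.

End exponential_residual.

(** * Second moments *)

Section square_integrable.
Context d (T : measurableType d) (R : realType) (P : probability T R).
Implicit Types f g : T -> R.
Notation L2 := (Lfun P 2%:E).

Lemma Lfun_measurable f p : f \in Lfun P p -> measurable_fun setT f.
Proof. by rewrite inE => /andP[/[!inE]]. Qed.

Lemma Lfun2_sqr f : measurable_fun setT f ->
  (\int[P]_w (f w ^+ 2)%:E < +oo)%E -> f \in L2.
Proof.
move=> mf fi; apply/andP; split; rewrite inE//= /finite_norm unlock.
apply: poweR_lty; apply: le_lt_trans fi.
by under eq_integral do rewrite /= powR_mulrn// real_normK ?num_real//.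
Qed.

Lemma Lfun2_dominated f g : measurable_fun setT f -> (forall w, `|f w| <= g w) ->
  g \in L2 -> f \in L2.
Proof.
move=> mf fg gL; apply: Lfun2_sqr => //.
have /Lfun2_integrable_sqr/integrableP[mg] := gL.
apply: le_lt_trans; apply: ge0_le_integral => //.
- by move=> w _; rewrite lee_fin sqr_ge0.
- by apply/measurable_EFinP; exact: measurable_funX.
- exact: measurableT_comp.
- move=> w _; rewrite lee_fin /= ger0_norm ?sqr_ge0//.
  by rewrite -real_normK ?num_real// ler_sqr ?nnegrE// (le_trans _ (fg w)).
Qed.

Lemma Lfun2_integrable f : f \in L2 -> P.-integrable setT (EFin \o f).
Proof. by move=> fL; apply/Lfun1_integrable/Lfun_subset12 => //; rewrite fin_num_measure. Qed.

Lemma Lfun2_integrableM f g : f \in L2 -> g \in L2 ->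
  P.-integrable setT (fun w => (f w * g w)%:E).
Proof. by move=> fL gL; apply/(Lfun1_integrable _ (f \* g)); exact: Lfun2_mul_Lfun1. Qed.

Lemma Lfun2_lin (I : finType) (c : I -> R) (F : I -> T -> R) :
  (forall i, F i \in L2) -> (fun w => \sum_i c i * F i w) \in L2.
Proof.
move=> FL; rewrite [X in X \in _](_ : _ = \sum_i (c i \o* F i)).
  have cF i : c i \o* F i \in L2 by apply: Lfun_scale; rewrite ?ler1n.
  by rewrite rpred_sum ?lee1n.
by apply/funext => w; rewrite fct_sumE; apply: eq_bigr => i _; rewrite /= mulrC.
Qed.

Lemma Rintegral_sum (I : finType) (F : I -> T -> R) :
  (forall i, P.-integrable setT (EFin \o F i)) ->
  (\int[P]_w (\sum_i F i w) = \sum_i \int[P]_w F i w)%R.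
Proof.
move=> FI.
rewrite /Rintegral; under eq_integral do rewrite -sumEFin.
rewrite integral_sum// -sum_fine// => i _.
exact: (integrable_fin_num measurableT (FI i)).
Qed.

End square_integrable.

Section measurable_bigmin.
Context d (T : measurableType d) (R : realType) (I : finType).
Implicit Type F : I -> T -> \bar R.

(** [T] is arbitrary, so this also yields measurability for the smaller sigma-algebras behind
    [depends_on]. *)
Lemma measurable_bigmine (K : {set I}) F :
  (forall i, i \in K -> measurable_fun setT (F i)) ->
  measurable_fun setT (fun w => \big[mine/+oo%E]_(i in K) F i w).
Proof.
move=> mF.
rewrite (_ : (fun w => _) = fun w => \big[mine/+oo%E]_(i <- enum K) F i w); last first.
  by apply/funext => w; rewrite big_enum.
have : {subset enum K <= K} by move=> i; rewrite mem_enum.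
elim: (enum K) => [_|i s IH sK].
  by rewrite (_ : (fun w => _) = cst +oo%E)//; apply/funext => w; rewrite big_nil.
rewrite (_ : (fun w => _) = fun w => mine (F i w) (\big[mine/+oo%E]_(j <- s) F j w)).
  apply: measurable_mine; first by apply: mF; apply: sK; rewrite mem_head.
  by apply: IH => j js; apply: sK; rewrite in_cons js orbT.
by apply/funext => w; rewrite big_cons.
Qed.

End measurable_bigmin.

Section independent_product.
Context d (T : measurableType d) (R : realType) (P : probability T R).
Variables (Y Z : T -> R).
Hypotheses (YL : Y \in Lfun P 2%:E) (ZL : Z \in Lfun P 2%:E).
Hypothesis YZ : forall A B, measurable A -> measurable B ->
  P (Y @^-1` A `&` Z @^-1` B) = (P (Y @^-1` A) * P (Z @^-1` B))%E.

Let mY := Lfun_measurable YL.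
Let mZ := Lfun_measurable ZL.
HB.instance Definition _ := isMeasurableFun.Build _ _ _ _ Z mZ.
Let nu : probability R R := distribution P Z.

Lemma Rintegral_indepM :
  \int[P]_w (Y w * Z w) = (\int[P]_w Y w) * (\int[P]_w Z w).
Proof.
have nuE A : measurable A -> P (Z @^-1` A) = nu A by [].
have mf : measurable_fun [set: R * R] (fun z : R * R => (z.1 * z.2)%:E).
  by apply/measurable_EFinP; exact: measurable_funM.
have [h _] := @joint_integral _ T R P _ R _ R Z Y nu mZ mY nuE
  (fun A B mA mB => YZ mB mA) _ mf (Lfun2_integrableM YL ZL).
rewrite {1}/Rintegral h.
have intZ := Lfun2_integrable ZL.
have inu : nu.-integrable setT (fun x : R => x%:E).
  apply: (@integrable_pushforward _ _ _ _ _ Z mZ P setT (fun x => x%:E)) => //.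
  exact/measurable_EFinP.
have nuZ : (\int[nu]_x x%:E = (\int[P]_w Z w)%:E)%E.
  rewrite integral_distribution//.
  by rewrite /Rintegral fineK//; exact: (integrable_fin_num measurableT intZ).
transitivity (fine (\int[P]_w ((Y w)%:E * (\int[P]_w Z w)%:E))%E).
  congr fine; apply: eq_integral => w _.
  by rewrite -nuZ -integralZl//; apply: eq_integral => x _; rewrite EFinM.
rewrite integralZr//; last exact: Lfun2_integrable.
by rewrite fineM//; exact: (integrable_fin_num measurableT (Lfun2_integrable YL)).
Qed.

End independent_product.

(** * Means and mean products of residuals *)

Section block_model.
Context d (T : measurableType d) (R : realType) (P : probability T R) (n : nat).
Variables (X : 'I_n -> T -> R) (mu : probability R R).
Hypothesis mX : forall i, measurable_fun setT (X i).
Hypothesis X_ge0 : forall i w, 0 <= X i w.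
Hypothesis indX : forall (J : {set 'I_n}) (A : 'I_n -> set R),
  (forall i, measurable (A i)) ->
  P (\bigcap_(i in [set` J]) (X i @^-1` A i)) = (\prod_(i in J) P (X i @^-1` A i))%E.
Hypothesis lawX : forall i A, measurable A -> P (X i @^-1` A) = mu A.
Variables (lam r : R) (g : 'I_n -> R) (blk : 'I_n -> nat).
Implicit Types (i j : 'I_n) (J K : {set 'I_n}) (w : T).

Let slack_ K i w := slack r g K i (X^~ w).
Let Z_ i w := truncated_residual lam r g blk i (X^~ w).
Let Z2_ i j w := truncated_residual2 lam r g blk i j (X^~ w).

(* The mean of a residual given its truncation level; it vanishes for the
   exponential law. *)
Definition psi (s : \bar R) : R := \int[mu]_x phi lam (Num.max x 0) s.

Lemma depends_on_slack K i : depends_on X K (slack_ K i).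
Proof.
apply: measurable_bigmine => j jK; apply/measurable_EFinP.
apply: measurable_funB => //; apply: measurable_funD => //.
apply: measurable_funD => //; exact: depends_on_coord.
Qed.

Lemma depends_on_xmin K : depends_on X K (fun w => xmin K (X^~ w)).
Proof.
apply: measurable_bigmine => j jK; apply/measurable_EFinP; exact: depends_on_coord.
Qed.

Lemma depends_on_phi J i (S : T -> \bar R) : i \in J -> depends_on X J S ->
  depends_on X J (fun w => phi lam (X i w) (S w)).
Proof. by move=> iJ mS; apply: measurable_phi => //; exact: depends_on_coord. Qed.

(** The conditioning step behind every occurrence of [psi] in a mean: given the errors in [J], the
    factor [G] and the level [S] are constants, and averaging over the error [i] turns [phi] into
    [psi]. *)
Lemma Rintegral_cond_phi i J (G : T -> R) (S : T -> \bar R) : i \notin J ->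
  depends_on X J G -> depends_on X J S ->
  (forall w, mu.-integrable setT (fun x => (phi lam (Num.max x 0) (S w))%:E)) ->
  P.-integrable setT (fun w => (G w * phi lam (X i w) (S w))%:E) ->
  \int[P]_w (G w * phi lam (X i w) (S w)) = \int[P]_w (G w * psi (S w)) /\
  P.-integrable setT (fun w => (G w * psi (S w))%:E).
Proof.
move=> iJ mG mS Sint GS.
pose f (z : (R * \bar R) * R) := (z.1.1 * phi lam (Num.max z.2 0) z.1.2)%:E.
have mf : measurable_fun setT f.
  apply/measurable_EFinP; apply: measurable_funM.
    exact: (measurableT_comp measurable_fst).
  apply: measurable_phi; last exact: (measurableT_comp measurable_snd).
  by apply: measurable_maxr => //.
have mW : depends_on X J (fun w => (G w, S w)) by exact: measurable_fun_pair.
have fE w : f ((G w, S w), X i w) = (G w * phi lam (X i w) (S w))%:E.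
  by rewrite /f /= max_l.
have [|h1 h2] := integral_cond mX indX lawX iJ mW mf.
  by under eq_fun do rewrite fE.
have inE w : (\int[mu]_x f ((G w, S w), x) = (G w * psi (S w))%:E)%E.
  under eq_integral do rewrite /f /= EFinM.
  rewrite integralZl// EFinM /psi /Rintegral fineK//.
  exact: (integrable_fin_num measurableT (Sint w)).
split; last by under eq_fun do rewrite -inE.
rewrite /Rintegral; congr fine.
under eq_integral do rewrite -fE.
by rewrite h1; apply: eq_integral => w _; rewrite inE.
Qed.

Hypotheses (r_ge0 : 0 <= r)
  (g_osc : forall i j, blk i = blk j -> `|g i - g j| <= r).
Notation others := (others blk).

Hypothesis ZL : forall i, Z_ i \in Lfun P 2%:E.
Hypothesis Z2L : forall i j, j \in others i -> Z2_ i j \in Lfun P 2%:E.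
Hypothesis psi_int : forall i w,
  mu.-integrable setT (fun x => (phi lam (Num.max x 0) (slack_ (others i) i w))%:E).
Hypothesis psi_int2 : forall i j w, j \in others i ->
  mu.-integrable setT (fun x => (phi lam (Num.max x 0) (slack_ (others i :\ j) i w))%:E).

Lemma others_irrefl i : i \notin others i.
Proof. by rewrite othersP !eqxx. Qed.

Lemma mean_residual i : \int[P]_w Z_ i w = \int[P]_w psi (slack_ (others i) i w) /\
  P.-integrable setT (fun w => (psi (slack_ (others i) i w))%:E).
Proof.
have m1 : depends_on X (others i) (fun _ : T => 1 : R) by exact: measurable_cst.
have h0 : P.-integrable setT (fun w => (1 * phi lam (X i w) (slack_ (others i) i w))%:E).
  by under eq_fun do rewrite mul1r; exact: Lfun2_integrable (ZL i).
have [h1 h2] := Rintegral_cond_phi (others_irrefl i) m1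
  (@depends_on_slack (others i) i) (psi_int i) h0.
split; last by under eq_fun do rewrite -[psi _]mul1r.
under eq_Rintegral do rewrite -[Z_ _ _]mul1r.
by rewrite h1; apply: eq_Rintegral => w _; rewrite mul1r.
Qed.

Lemma depends_on_residual i : depends_on X [set j | blk j == blk i]%SET (Z_ i).
Proof.
apply: depends_on_phi; first by rewrite inE.
apply: depends_onS (@depends_on_slack _ _).
by apply/fintype.subsetP => j; rewrite othersP inE => /andP[].
Qed.

Lemma mean_residualM_diff_block i j : blk i != blk j ->
  \int[P]_w (Z_ i w * Z_ j w) = (\int[P]_w Z_ i w) * (\int[P]_w Z_ j w).
Proof.
move=> ij; apply: Rintegral_indepM => // A B mA mB.
apply: (depends_on_indep mX indX _ (@depends_on_residual i) (@depends_on_residual j)) => //.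
rewrite disjoint_subset; apply/fintype.subsetP => l; rewrite !inE => /eqP ->.
by [].
Qed.

Lemma mean_residualM i j : i != j -> blk i = blk j ->
  [/\ \int[P]_w (Z_ i w * Z_ j w) =
        \int[P]_w (Z2_ i j w * psi (slack_ (others j) j w)) +
        \int[P]_w (Z2_ j i w * psi (slack_ (others i) i w)) -
        \int[P]_w (Z2_ i j w * psi (slack_ (others j :\ i) j w)),
      P.-integrable setT (fun w => (Z2_ i j w * psi (slack_ (others j) j w))%:E) &
      P.-integrable setT (fun w => (Z2_ i j w * psi (slack_ (others j :\ i) j w))%:E)].
Proof.
move=> ij bij.
have ji' : j != i by rewrite eq_sym.
have oth k l : blk k = blk l -> k != l -> l \in others k /\ others k :\ l \subset others l.
  move=> bkl kl; rewrite othersP bkl eq_sym kl eqxx; split => //.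
  by rewrite (others2_sym bkl) subD1set.
(* truncated_residual2 k l does not involve the error l *)
have h1 k l : blk k = blk l -> k != l ->
    \int[P]_w (Z2_ k l w * Z_ l w) =
      \int[P]_w (Z2_ k l w * psi (slack_ (others l) l w)) /\
    P.-integrable setT (fun w => (Z2_ k l w * psi (slack_ (others l) l w))%:E).
  move=> bkl kl; have [lk sub] := oth k l bkl kl.
  have klo : k \in others l by have [] := oth l k (esym bkl); rewrite 1?eq_sym.
  apply: (Rintegral_cond_phi (others_irrefl l)).
  - by apply: depends_on_phi => //; apply: depends_onS sub (@depends_on_slack _ _).
  - exact: depends_on_slack.
  - exact: psi_int.
  - by apply: Lfun2_integrableM; [exact: Z2L|exact: ZL].
have [ji sub] := oth i j bij ij.
have [io _] : i \in others j /\ _ := oth j i (esym bij) ji'.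
(* Neither M_ij nor the level of M_ji involves the error [j], so M_ji is the factor that is averaged
   over [j]. *)
have [e2 i2] : \int[P]_w (Z2_ i j w * Z2_ j i w) =
      \int[P]_w (Z2_ i j w * psi (slack_ (others j :\ i) j w)) /\
    P.-integrable setT (fun w => (Z2_ i j w * psi (slack_ (others j :\ i) j w))%:E).
  apply: (Rintegral_cond_phi (others_irrefl j)).
  - by apply: depends_on_phi => //; apply: depends_onS sub (@depends_on_slack _ _).
  - by apply: depends_onS (@depends_on_slack _ _); rewrite subD1set.
  - by move=> w; exact: psi_int2.
  - by apply: Lfun2_integrableM; exact: Z2L.
have [e1 i1] := h1 i j bij ij.
have [e3 i3] := h1 j i (esym bij) ji'.
split => //; rewrite -e1 -e2 -e3.
have m1 := Lfun2_integrableM (Z2L ji) (ZL j).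
have m2 := Lfun2_integrableM (Z2L io) (ZL i).
have m3 := Lfun2_integrableM (Z2L ji) (Z2L io).
rewrite -RintegralD// -RintegralB//; last exact: integrableD m1 m2.
apply: eq_Rintegral => w _.
(* Expanding this vanishing product gives Z_i Z_j pointwise as the combination under the
   integral. *)
have := truncated_residual_orth lam g r_ge0 (X^~ w) bij ij.
rewrite -/(Z_ i w) -/(Z_ j w) -/(Z2_ i j w) -/(Z2_ j i w) => h.
apply/eqP; rewrite -subr_eq0 -[X in _ == X]h; apply/eqP; ring.
Qed.

End block_model.

Section linear_statistic.
Context d (T : measurableType d) (R : realType) (P : probability T R).
Context (I : finType) (c : I -> R) (F : I -> T -> R) (t : R).
Hypothesis FL : forall i, F i \in Lfun P 2%:E.

Let D w := \sum_i c i * F i w.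

Let cF_int i : P.-integrable setT (EFin \o (fun w => c i * F i w)).
Proof.
have := Lfun2_integrable (FL i) => h.
rewrite (_ : EFin \o _ = fun w => ((c i)%:E * (F i w)%:E)%E).
  exact: integrableZl.
by apply/funext => w; rewrite /= EFinM.
Qed.

Let ED : \int[P]_w D w = \sum_i c i * \int[P]_w F i w.
Proof.
rewrite Rintegral_sum//; apply: eq_bigr => i _.
by rewrite RintegralZl//; exact: Lfun2_integrable.
Qed.

Let DL : D \in Lfun P 2%:E. Proof. exact: Lfun2_lin. Qed.

Lemma expectation_lin :
  ('E_P[fun w => (t + D w)%R])%E = (t + \sum_i c i * \int[P]_w F i w)%:E.
Proof.
rewrite unlock -ED.
under eq_integral do rewrite EFinD.
rewrite integralD//; last 2 first.
- exact: finite_measure_integrable_cst.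
- exact: Lfun2_integrable.
rewrite EFinD; congr (_ + _)%E.
  by have := expectation_cst P t; rewrite unlock.
rewrite /Rintegral fineK//.
exact: (integrable_fin_num measurableT (Lfun2_integrable DL)).
Qed.

Lemma variance_lin : ('V_P[fun w => (t + D w)%R])%E = (\sum_i \sum_j c i * c j *
  (\int[P]_w (F i w * F j w) - (\int[P]_w F i w) * (\int[P]_w F j w)))%:E.
Proof.
have intD : \int[P]_w (D w ^+ 2) = \sum_i \sum_j c i * c j * \int[P]_w (F i w * F j w).
  have FF i j : P.-integrable setT (EFin \o (fun w => c i * c j * (F i w * F j w))).
    rewrite (_ : EFin \o _ = fun w => ((c i * c j)%:E * (F i w * F j w)%:E)%E).
      by apply: integrableZl => //; exact: Lfun2_integrableM.
    by apply/funext => w; rewrite /= EFinM.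
  transitivity (\int[P]_w (\sum_(p : I * I) c p.1 * c p.2 * (F p.1 w * F p.2 w))).
    apply: eq_Rintegral => w _; rewrite expr2 /D mulr_suml -(pair_big xpredT xpredT
      (fun i j => c i * c j * (F i w * F j w)))/=.
    by apply: eq_bigr => i _; rewrite mulr_sumr; apply: eq_bigr => j _; ring.
  rewrite Rintegral_sum => [|[i j]]; last exact: FF.
  rewrite -(pair_big xpredT xpredT (fun i j =>
    \int[P]_w (c i * c j * (F i w * F j w))))/=.
  apply: eq_bigr => i _; apply: eq_bigr => j _.
  by rewrite RintegralZl//; exact: Lfun2_integrableM.
have -> : ('V_P[fun w => (t + D w)%R] = 'V_P[D])%E.
  by rewrite -(varianceD_cst_r t DL); congr variance; apply/funext => w /=; rewrite addrC.
rewrite varianceE//.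
have -> : ('E_P[(D ^+ 2)%R])%E = (\int[P]_w (D w ^+ 2))%:E.
  rewrite unlock /Rintegral fineK//.
  exact: (integrable_fin_num measurableT (Lfun2_integrable_sqr DL)).
have -> : ('E_P[D])%E = (\int[P]_w D w)%:E.
  rewrite unlock /Rintegral fineK//.
  exact: (integrable_fin_num measurableT (Lfun2_integrable DL)).
rewrite intD ED expe2 -EFinM -EFinB; congr EFin.
rewrite mulr_suml -sumrB; apply: eq_bigr => i _.
rewrite mulr_sumr -sumrB; apply: eq_bigr => j _.
ring.
Qed.

End linear_statistic.

Section almost_sure_equality.
Context d (T : measurableType d) (R : realType) (P : probability T R).
Variables (f h : T -> R).
Hypotheses (mf : measurable_fun setT f) (mh : measurable_fun setT h).
Hypothesis fh : {ae P, forall w, f w = h w}.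

Lemma ae_expectation : ('E_P[f] = 'E_P[h])%E.
Proof.
rewrite unlock; apply: ae_eq_integral => //; try exact/measurable_EFinP.
by apply: filterS fh => w -> _.
Qed.

Lemma ae_variance : ('V_P[f] = 'V_P[h])%E.
Proof.
rewrite /variance unlock ae_expectation unlock; set e := fine _.
apply: ae_eq_integral => //.
- apply/measurable_EFinP; apply: measurable_funM; apply: measurable_funB => //.
- apply/measurable_EFinP; apply: measurable_funM; apply: measurable_funB => //.
- apply: filterS fh => w fw _.
  by change (((f w - e) * (f w - e))%:E = ((h w - e) * (h w - e))%:E); rewrite fw.
Qed.

End almost_sure_equality.

Section positive_part.
Context (R : realType) (mu : probability R R).
Hypothesis mu_ge0 : mu `[0, +oo[%classic = 1%E.

Lemma probability_ge0_restr (B : set R) : measurable B -> mu B = mu (B `&` `[0, +oo[).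
Proof.
move=> mB; have mD : measurable (`[0, +oo[%classic : set R) by exact: measurable_itv.
rewrite -[LHS](congr1 mu (setUIDK B `[0, +oo[)) measureU//; last 3 first.
- exact: measurableI.
- exact: measurableD.
- by rewrite setDE setIACA setICr setI0.
rewrite [X in (_ + X)%E](_ : _ = 0%E) ?adde0//.
apply/eqP; rewrite -measure_le0.
have : mu (~` `[0, +oo[) = 0%E by rewrite probability_setC// mu_ge0 subee.
by move=> <-; apply: le_measure; rewrite ?inE; [exact: measurableD|exact: measurableC|exact: subIsetr].
Qed.

Lemma probability_positive_part (A : set R) : measurable A ->
  mu ((fun x : R => Num.max x 0) @^-1` A) = mu A.
Proof.
move=> mA; rewrite (probability_ge0_restr mA) probability_ge0_restr.
  congr (mu _); apply/seteqP; split => x /= [h]; rewrite in_itv/= andbT => x0;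
    by split => //; move: h; rewrite max_l.
rewrite -[X in measurable X]setTI.
have mm : measurable_fun [set: R] (fun x : R => Num.max x 0) by exact: measurable_maxr.
exact: mm measurableT A mA.
Qed.

End positive_part.

Section block_diagonal_form.
Context (R : realFieldType) (I : finType) (b : I -> nat).
Variables (c : I -> R) (s : I -> I -> R) (B : R) (m : nat).
Hypothesis s_diff : forall i j, b i != b j -> s i j = 0.
Hypothesis s_same : forall i j, i != j -> b i = b j -> `|s i j| <= B.
Hypothesis card_b : forall i, (#|[pred j | b j == b i]| <= m)%N.
Hypothesis B_ge0 : 0 <= B.

(** Schur's test: |c_i c_j| <= (c_i^2 + c_j^2)/2, and a row has at most [m] nonzero entries.
    Measuring the distance to the diagonal part makes one inequality serve for both the upper and
    the lower variance bound. *)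
Lemma block_diagonal_form_le :
  `|\sum_i \sum_j c i * c j * s i j - \sum_i c i ^+ 2 * s i i| <=
  m%:R * B * \sum_i c i ^+ 2.
Proof.
have half_le : \sum_i \sum_(j | b j == b i) (B / 2 * c i ^+ 2) <=
    m%:R * B / 2 * \sum_i c i ^+ 2.
  rewrite mulr_sumr; apply: ler_sum => i _.
  have -> : m%:R * B / 2 * c i ^+ 2 = (B / 2 * c i ^+ 2) *+ m.
    by rewrite -[RHS]mulr_natl; ring.
  rewrite sumr_const ler_wpMn2l//; last exact: card_b.
  by rewrite mulr_ge0 ?sqr_ge0// divr_ge0.
set S := \sum_i c i ^+ 2 in half_le *.
have -> : m%:R * B * S = m%:R * B / 2 * S + m%:R * B / 2 * S by field.
apply: le_trans (lerD half_le half_le).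
(* Lying in one block is a symmetric relation, so one of the two equal halves is reindexed to carry
   c_j^2 instead of c_i^2. *)
have -> : \sum_i \sum_(j | b j == b i) (B / 2 * c i ^+ 2) +
    \sum_i \sum_(j | b j == b i) (B / 2 * c i ^+ 2) =
    \sum_i \sum_(j | b j == b i) (B / 2 * (c i ^+ 2 + c j ^+ 2)).
  rewrite [X in _ + X](exchange_big_dep xpredT)//= -big_split/=.
  apply: eq_bigr => i _; rewrite [X in _ + X](eq_bigl (fun j => b j == b i)).
    by rewrite -big_split/=; apply: eq_bigr => j _; rewrite mulrDr.
  by move=> j; rewrite eq_sym.
rewrite -sumrB; apply: le_trans (ler_norm_sum _ _ _) _.
apply: ler_sum => i _.
rewrite (bigD1 i)//= expr2 [X in X - _]addrC addrK.
rewrite (bigID (fun j => b j == b i))/= [X in _ + X]big1 ?addr0; last first.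
  by move=> j /andP[_ ji]; rewrite s_diff ?mulr0// eq_sym.
apply: le_trans (ler_norm_sum _ _ _) _.
rewrite [leRHS](bigD1 i)//= addrC -[leLHS]addr0.
apply: lerD; last by rewrite mulr_ge0 ?divr_ge0// addr_ge0// sqr_ge0.
rewrite [leLHS](eq_bigl (fun j => (b j == b i) && (j != i))); last by move=> j; rewrite andbC.
apply: ler_sum => j /andP[/eqP ji jNi].
rewrite normrM mulrC.
have cc : `|c i * c j| <= (c i ^+ 2 + c j ^+ 2) / 2.
  rewrite ler_norml; apply/andP; split.
    by have := sqr_ge0 (c i + c j); lra.
  by have := sqr_ge0 (c i - c j); lra.
rewrite mulrAC -mulrA.
by apply: ler_pM => //; apply: s_same; rewrite // eq_sym.
Qed.

End block_diagonal_form.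

(** * Decomposition of the estimator into blocks *)

Section std_norm.
Context {R : realType}.

Lemma std_norm1E n (w : R -> R) :
  std_norm n 1 w = n%:R^-1 * \sum_(i < n) `|w (design i)|.
Proof.
rewrite /std_norm invr1 powRr1.
  by congr (_ * _); apply: eq_bigr => i _; rewrite powRr1.
by rewrite mulr_ge0// ?invr_ge0// sumr_ge0// => i _; exact: powR_ge0.
Qed.

Lemma std_norm2E n (w : R -> R) :
  std_norm n 2 w ^+ 2 = n%:R^-1 * \sum_(i < n) w (design i) ^+ 2.
Proof.
have -> : std_norm n 2 w = Num.sqrt (n%:R^-1 * \sum_(i < n) w (design i) ^+ 2).
  rewrite /std_norm powR12_sqrt; last first.
    by rewrite mulr_ge0// ?invr_ge0// sumr_ge0// => i _; exact: powR_ge0.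
  congr (Num.sqrt (_ * _)); apply: eq_bigr => i _.
  by rewrite powR_mulrn// real_normK ?num_real.
by rewrite sqr_sqrtr// mulr_ge0// ?invr_ge0// sumr_ge0// => i _; exact: sqr_ge0.
Qed.

(** The difference of the two sides is the empirical variance of |w| around its mean [M]. *)
Lemma std_norm1_le2 n (w : R -> R) : std_norm n 1 w ^+ 2 <= std_norm n 2 w ^+ 2.
Proof.
rewrite std_norm1E std_norm2E; case: n => [|n]; first by rewrite !big_ord0 !mulr0 expr0n.
set a := fun i : 'I_n.+1 => `|w (design i)|.
set M := _ * \sum_(i < _) _.
rewrite -subr_ge0.
have N0 : (0 : R) < n.+1%:R by rewrite ltr0n.
have -> : n.+1%:R^-1 * \sum_(i < n.+1) w (design i) ^+ 2 - M ^+ 2 =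
   n.+1%:R^-1 * \sum_(i < n.+1) (a i - M) ^+ 2.
  transitivity (n.+1%:R^-1 * (\sum_(i < n.+1) a i ^+ 2 - (2 * M) * \sum_(i < n.+1) a i + n.+1%:R * M ^+ 2)).
    have -> : \sum_(i < n.+1) a i = n.+1%:R * M by rewrite /M mulVKf// gt_eqF.
    have -> : \sum_(i < n.+1) a i ^+ 2 = \sum_(i < n.+1) w (design i) ^+ 2.
      by apply: eq_bigr => i _; rewrite /a real_normK ?num_real.
    by field; rewrite gt_eqF.
  congr (_ * _); rewrite mulr_sumr -sumrB.
  have -> : n.+1%:R * M ^+ 2 = \sum_(i < n.+1) M ^+ 2 by rewrite sumr_const card_ord mulr_natl.
  by rewrite -big_split; apply: eq_bigr => i _ /=; ring.
by rewrite mulr_ge0 ?invr_ge0// sumr_ge0// => i _; exact: sqr_ge0.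
Qed.

End std_norm.

Section block_decomposition.
Context {R : realType}.
Variables (n : nat) (h : R).
Hypothesis nh : admissible_block_size n h.

Definition block_size := Num.truncn (n%:R * h).
Definition blk (i : 'I_n) : nat := (i %/ block_size)%N.

Let n_gt0 : (0 < n)%N. Proof. by case: nh. Qed.
Let h_gt0 : 0 < h. Proof. by case: nh. Qed.

Lemma block_sizeE : block_size%:R = n%:R * h.
Proof. by rewrite /block_size truncnK//; case: nh. Qed.

Lemma nblocksE : (Num.truncn h^-1)%:R = h^-1.
Proof. by rewrite truncnK//; case: nh. Qed.

Lemma block_size_gt0 : (0 < block_size)%N.
Proof. by rewrite -(ltr0n R) block_sizeE mulr_gt0// ltr0n. Qed.

Lemma size_nblocks : n = (Num.truncn h^-1 * block_size)%N.
Proof.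
by apply/eqP; rewrite -(eqr_nat R) natrM nblocksE block_sizeE mulrCA mulVf ?mulr1// gt_eqF.
Qed.

(** Multiplied by n, the bounds read k m < i+1 <= (k+1) m with m the block size. As indices start at
    0 this is k m <= i < (k+1) m, that is, Euclidean division. *)
Lemma mem_block k (i : 'I_n) : (i \in block n h k) = (blk i == k).
Proof.
have n0 : (0 : R) < n%:R by rewrite ltr0n.
rewrite inE /design ltr_pdivlMr// ler_pdivrMr//.
have e l : l%:R * h * n%:R = (l * block_size)%:R by rewrite natrM block_sizeE; ring.
rewrite !e ltr_nat ler_nat ltnS /blk.
by rewrite eqn_leq leq_divRL ?block_size_gt0// andbC -[(_ %/ _ <= _)%N]ltnS ltn_divLR ?block_size_gt0.
Qed.

(** All blocks are full because n is the number of blocks times the block size; the count cuts [0,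
    n) at the two ends of the block. *)
Lemma card_blk i : #|[pred j : 'I_n | blk j == blk i]| = block_size.
Proof.
have -> : #|[pred j : 'I_n | blk j == blk i]| =
    (\sum_(0 <= j < n | (j %/ block_size == blk i)%N) 1)%N.
  by rewrite big_mkord sum1_card.
have bi : (blk i < Num.truncn h^-1)%N.
  by rewrite /blk ltn_divLR ?block_size_gt0// -size_nblocks.
have e j : (j %/ block_size == blk i)%N = (blk i * block_size <= j < (blk i).+1 * block_size)%N.
  by rewrite eqn_leq leq_divRL ?block_size_gt0// andbC -[(_ %/ _ <= _)%N]ltnS ltn_divLR ?block_size_gt0.
rewrite (eq_bigl _ _ e).
rewrite (@big_cat_nat _ _ _ (blk i * block_size))//=; last first.
  by rewrite [leqRHS]size_nblocks leq_mul2r (ltnW bi) orbT.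
rewrite (@big_cat_nat _ _ _ ((blk i).+1 * block_size) (blk i * block_size))//=; last 2 first.
  by rewrite leq_mul2r leqnSn orbT.
  by rewrite [leqRHS]size_nblocks leq_mul2r bi orbT.
rewrite big_nat_cond big_pred0 ?add0n; last first.
  by move=> j; apply/negbTE/negP => /andP[/andP[_ a]] /andP[]; rewrite leqNgt a.
rewrite [X in (_ + X)%N]big_nat_cond [X in (_ + X)%N]big_pred0 ?addn0; last first.
  by move=> j; apply/negbTE/negP => /andP[/andP[a _]] /andP[_]; rewrite ltnNge a.
rewrite big_nat_cond (eq_bigl (fun j => (blk i * block_size <= j < (blk i).+1 * block_size) && true)%N); last first.
  by move=> j; rewrite andbb andbT.
by rewrite -big_nat_cond sum_nat_const_nat muln1 mulSn addnK.
Qed.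

Lemma design_itv (i : 'I_n) : design i \in (`[0, 1] : interval R).
Proof.
have n0 : (0 : R) < n%:R by rewrite ltr0n.
rewrite in_itv/= /design divr_ge0//=.
by rewrite ler_pdivrMr// mul1r ler_nat.
Qed.

Lemma design_dist i j : blk i = blk j -> `|design i - design j : R| <= h.
Proof.
move=> /esym/eqP ij.
have : i \in block n h (blk i) by rewrite mem_block.
have : j \in block n h (blk i) by rewrite mem_block.
rewrite !inE -natr1 mulrDl mul1r => /andP[a b] /andP[c e].
by rewrite ler_norml; apply/andP; split; lra.
Qed.

Lemma holder_osc beta rad (g : R -> R) : 0 < beta -> 0 < rad ->
  holder_class beta rad g -> forall i j, blk i = blk j ->
  `|g (design i) - g (design j)| <= rad * h `^ beta.
Proof.
move=> b0 r0 gh i j ij; apply: le_trans (gh _ _ (design_itv j) (design_itv i)) _.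
apply: ler_wpM2l; first exact: ltW.
by apply: ge0_ler_powR; rewrite ?nnegrE ?(ltW b0) ?(ltW h_gt0)//; exact: design_dist.
Qed.

(** The factors 1/(nh) and h combine to 1/n. Once the sums are exchanged, each [i] occurs in exactly
    one block, whose number is below h^-1. *)
Lemma block_estimatorE beta rad lam (g w : R -> R) (x : 'I_n -> R) : 0 < rad ->
  block_estimator beta rad lam h w (fun i => g (design i) + x i) =
  theta n g w + \sum_(i < n) (n%:R^-1 * w (design i)) *
    truncated_residual lam (rad * h `^ beta) (g \o @design R n) blk i x.
Proof.
move=> r0.
set r := rad * h `^ beta.
have r_ge0 : 0 <= r by rewrite mulr_ge0 ?powR_ge0// ltW.
pose F k i := (Num.min (g (design i) + x i)
     (block_min h (fun i => g (design i) + x i) k + r) -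
   lam^-1 * (g (design i) + x i <= block_min h (fun i => g (design i) + x i) k + r)%R%:R)
   * w (design i) : R.
have n0 : (n%:R : R) != 0 by rewrite pnatr_eq0 -lt0n.
transitivity (\sum_(0 <= k < Num.truncn h^-1) \sum_(i < n | blk i == k) n%:R^-1 * F k i).
  apply: eq_bigr => k _; rewrite /block_term -mulr_sumr mulrAC; congr (_ * _).
    by field; rewrite n0 gt_eqF.
  by apply: eq_bigl => i; rewrite mem_block.
rewrite (exchange_big_dep xpredT)//=.
rewrite /theta mulr_sumr -big_split/=; apply: eq_bigr => i _.
rewrite (eq_bigl (fun k => k == blk i)); last by move=> k; rewrite eq_sym.
rewrite big_nat1_eq leq0n /blk ltn_divLR ?block_size_gt0// -size_nblocks ltn_ord.
have iK : block n h (blk i) =i [pred j | blk j == blk i].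
  by move=> j; rewrite mem_block inE.
rewrite /F /block_min (block_residualE lam (g \o @design R n) r_ge0 x iK) /=.
by ring.
Qed.

End block_decomposition.

(** * General error laws *)

Lemma bernoulli (R : realDomainType) (u : R) (n : nat) :
  -1 <= u -> 1 + n%:R * u <= (1 + u) ^+ n.
Proof.
move=> u1; elim: n => [|n IH]; first by rewrite mul0r addr0 expr0.
have u0 : 0 <= 1 + u by lra.
rewrite exprS; apply: le_trans (ler_wpM2l u0 IH).
rewrite -natr1; have : 0 <= n%:R * u ^+ 2 by rewrite mulr_ge0// sqr_ge0.
by lra.
Qed.

Section error_law_bounds.
Context {R : realType}.
Variables (lam rho : R) (mu : probability R R).
Hypotheses (lam_gt0 : 0 < lam) (rho_gt0 : 0 < rho).
Hypothesis mu_law : error_law lam rho mu.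

Definition dist (s : R) : R := fine (mu `]-oo, s]%classic).
Definition tail (s : R) : R := fine (mu `]s, +oo[%classic).

Let mu_fin (A : set R) : measurable A -> mu A \is a fin_num.
Proof. by move=> mA; exact: fin_num_measure. Qed.

Lemma dist_ge0 s : 0 <= dist s. Proof. exact: fine_ge0. Qed.

Lemma tail_ge0 s : 0 <= tail s. Proof. exact: fine_ge0. Qed.

Lemma distE s : mu `]-oo, s]%classic = (dist s)%:E.
Proof. by rewrite fineK// mu_fin. Qed.

Lemma tailE s : mu `]s, +oo[%classic = (tail s)%:E.
Proof. by rewrite fineK// mu_fin. Qed.

Lemma tail_dist s : tail s = 1 - dist s.
Proof.
apply: EFin_inj; rewrite -tailE EFinB -distE -probability_setC//.
by rewrite setCitvl.
Qed.

Lemma dist_le1 s : dist s <= 1.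
Proof. by rewrite -subr_ge0 -tail_dist tail_ge0. Qed.

Lemma tail_le1 s : tail s <= 1.
Proof. by rewrite tail_dist gerBl dist_ge0. Qed.

Lemma dist_nd s t : s <= t -> dist s <= dist t.
Proof.
move=> st; rewrite -lee_fin -!distE; apply: le_measure; rewrite ?inE//.
by apply: subset_itvl; rewrite bnd_simp.
Qed.

Lemma dist_near0 : exists d K : R, [/\ 0 < d, 0 <= K &
  forall s, 0 < s -> s <= d -> `|dist s - lam * s| <= K * s ^+ 2].
Proof.
have [_ bigOF _] := mu_law.
have /eqOP[k [kr Hk]] := bigOF.
(* Any constant above [k] is allowed; the maximum with 0 makes it nonnegative. *)
have {}Hk := Hk (Num.max (k + 1) 0).
have /Hk : k < Num.max (k + 1) 0 by rewrite lt_max ltrDl ltr01.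
rewrite /prop_near1 /at_right /=.
move=> /nbhs_ballP[e /= e0 He].
exists (e / 2), (Num.max (k + 1) 0); split; first by rewrite divr_gt0.
  by rewrite le_max lexx orbT.
move=> s s0 se; have := He s; rewrite /ball/= sub0r normrN gtr0_norm//.
move=> /(_ _ s0); rewrite [X in _ <= _ * X]ger0_norm ?sqr_ge0//; apply.
by apply: le_lt_trans se _; rewrite ltr_pdivrMr// ltr_pMr// ltr1n.
Qed.

(** The hypothesis concerns a right neighbourhood of 0 without 0 itself. At 0 the distribution
    function F vanishes by monotonicity, and away from 0 both terms are dominated by a multiple of
    s^2. *)
Lemma dist_expansion : exists2 K : R, 0 < K &
  forall s, 0 <= s -> `|dist s - lam * s| <= K * s ^+ 2.
Proof.
have [d [K [d0 K0 HK]]] := dist_near0.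
have F0 : dist 0 = 0.
  apply/eqP; rewrite eq_le dist_ge0 andbT leNgt; apply/negP => F0.
  (* At this point F(0) <= F(s) <= (lam + K) s <= F(0)/2, which contradicts F(0) > 0. *)
  pose s := Num.min d (Num.min 1 (dist 0 / (2 * (lam + K)))).
  have lK : 0 < lam + K by rewrite ltr_pwDl.
  have s0 : 0 < s by rewrite /s !lt_min d0 ltr01 divr_gt0// mulr_gt0.
  have sd : s <= d by rewrite /s ge_min lexx.
  have s1 : s <= 1 by rewrite /s !ge_min lexx orbT.
  have sF : s <= dist 0 / (2 * (lam + K)) by rewrite /s !ge_min lexx !orbT.
  have := HK s s0 sd; rewrite ler_norml => /andP[_ h].
  have h2 := dist_nd (ltW s0).
  have h3 : K * s ^+ 2 <= K * s.
    by apply: ler_wpM2l => //; rewrite expr2 ler_piMl// ltW.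
  have h4 : s * (2 * (lam + K)) <= dist 0 by rewrite -ler_pdivlMr// mulr_gt0.
  have : s * (lam + K) <= dist 0 / 2 by lra.
  have : dist 0 <= s * (lam + K) by lra.
  lra.
(* For s > d one has 1 <= d^-2 s^2 and lam s <= (lam/d) s^2. *)
exists (K + (d ^- 2 + lam / d)).
  by rewrite ltr_wpDl// addr_gt0// ?invr_gt0 ?exprn_gt0// divr_gt0.
have [d2 ld] : 0 <= d ^- 2 /\ 0 <= lam / d.
  by rewrite invr_ge0 exprn_ge0 ?(ltW d0)// divr_ge0 ?(ltW d0) ?(ltW lam_gt0).
move=> s; rewrite le_eqVlt => /predU1P[<-|s0].
  by rewrite F0 mulr0 subr0 normr0 expr0n mulr0.
have [sd|ds] := leP s d.
  apply: le_trans (HK s s0 sd) _; rewrite ler_wpM2r ?sqr_ge0//.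
  by rewrite lerDl addr_ge0.
apply: (@le_trans _ _ (1 + lam * s)).
  rewrite ler_norml; have := dist_ge0 s; have := dist_le1 s.
  have : 0 <= lam * s by rewrite mulr_ge0// ltW.
  by lra.
rewrite mulrDl; apply: (@le_trans _ _ ((d ^- 2 + lam / d) * s ^+ 2)); last first.
  by rewrite lerDr mulr_ge0// sqr_ge0.
rewrite mulrDl; apply: lerD.
  rewrite mulrC ler_pdivlMr ?exprn_gt0// mul1r ler_sqr ?nnegrE ?(ltW d0) ?(ltW s0)//.
  exact: ltW.
rewrite -mulrA ler_pM2l// mulrC ler_pdivlMr// expr2 ler_pM2l//.
exact: ltW.
Qed.

Lemma dist_linear : exists2 C : R, 0 < C & forall s, 0 <= s -> dist s <= C * s.
Proof.
have [K K0 HK] := dist_expansion.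
exists (lam + K + 1); first by rewrite !addr_gt0.
move=> s s0; have [s1|s1] := leP s 1.
  have := HK s s0; rewrite ler_norml => /andP[_].
  have : K * s ^+ 2 <= K * s by rewrite ler_pM2l// expr2 ler_piMl.
  by lra.
apply: le_trans (dist_le1 s) _; apply: le_trans (ltW s1) _.
by rewrite ler_peMl//; have := lam_gt0; lra.
Qed.

(* The minimum of K errors has tail at most 1 / (1 + y), so that minima over
   blocks have moments although a single error need not have any. *)
Lemma tail_pow : exists2 K : nat, (0 < K)%N &
  forall y, 0 <= y -> tail y ^+ K <= (1 + y)^-1.
Proof.
have [K K0 HK] := dist_expansion.
have [_ _ [C HC]] := mu_law.
(* The first entry makes the quadratic error at most half of the linear term on [0, d]; the second
   keeps q = 1 - lam d / 2 nonnegative. *)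
pose d := Num.min (lam / (2 * K)) lam^-1.
have d0 : 0 < d by rewrite lt_min divr_gt0 ?mulr_gt0//= invr_gt0.
have near0 y : 0 <= y -> y <= d -> tail y <= 1 - lam / 2 * y.
  move=> y0 yd; rewrite tail_dist lerD2l lerN2.
  have := HK y y0; rewrite ler_norml => /andP[+ _].
  have : K * y ^+ 2 <= lam / 2 * y.
    rewrite expr2 mulrA ler_wpM2r//.
    have : y <= lam / (2 * K) by apply: le_trans yd _; rewrite ge_min lexx.
    by rewrite ler_pdivlMr ?mulr_gt0//; lra.
  by lra.
pose q := 1 - lam / 2 * d.
have q1 : q < 1 by rewrite /q gtrBl mulr_gt0 ?divr_gt0.
have q0 : 0 <= q.
  rewrite /q subr_ge0 mulrAC ler_pdivrMr// mul1r.
  have : d <= lam^-1 by rewrite ge_min lexx orbT.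
  by rewrite -(ler_pM2l lam_gt0) mulfV ?gt_eqF//; lra.
(* The exponent for y <= d: with u = lam y / 2, (1 - u)^K1 <= (1 + u)^-K1 <= 1/(1 + K1 u) <= 1/(1 +
   y). *)
have [K1 hK1] : exists K1 : nat, 1 <= K1%:R * (lam / 2).
  exists (Num.truncn (2 / lam)).+1.
  rewrite -ler_pdivrMr ?divr_gt0// mul1r invf_div ltW// truncnS_gt//.
(* For y > d, [b] factors turn (1 + y)^-rho into 1/(1 + y) and leave a constant C'^b, which is
   absorbed by [a] further factors, each at most q < 1. *)
have [b hb] : exists b : nat, 1 <= b%:R * rho.
  exists (Num.truncn (rho^-1)).+1.
  by rewrite -ler_pdivrMr// mul1r ltW// truncnS_gt.
pose C' := Num.max C 1.
have C1 : 1 <= C' by rewrite le_max lexx orbT.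
have [a ha] : exists a : nat, q ^+ a * C' ^+ b <= 1.
  have : (q ^+ a @[a --> \oo] --> (0 : R))%classic by apply: cvg_expr; rewrite ger0_norm.
  move=> /cvgr0_norm_le /(_ (C' ^- b)).
  rewrite invr_gt0 exprn_gt0 ?(lt_le_trans ltr01)// => /(_ isT)[N _ HN].
  exists N; have := HN N (leqnn N); rewrite /= ger0_norm ?exprn_ge0//.
  by rewrite -ler_pdivlMr ?exprn_gt0 ?(lt_le_trans ltr01)// mul1r.
exists (K1 + (a + b)).+1; first by [].
move=> y y0; have y1 : 0 < 1 + y by rewrite ltr_pwDl.
have tail_exp (k l : nat) : (k <= l)%N -> tail y ^+ l <= tail y ^+ k.
  by move=> kl; apply: ler_wiXn2l => //; [exact: tail_ge0|exact: tail_le1].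
have [yd|dy] := leP y d.
  apply: le_trans (tail_exp K1 _ _) _; first by rewrite ltnW// ltnS leq_addr.
  set u := lam / 2 * y.
  have u0 : 0 <= u by rewrite mulr_ge0// divr_ge0// ltW.
  have tu : tail y <= 1 - u by exact: near0.
  have u1 : u <= 1 by have := tail_ge0 y; lra.
  apply: (@le_trans _ _ ((1 + u) ^- K1)).
    rewrite -exprVn; apply: lerXn2r; rewrite ?nnegrE ?tail_ge0 ?invr_ge0 ?addr_ge0//.
    apply: le_trans tu _; rewrite -[leRHS]mul1r ler_pdivlMr; last by lra.
    by have := sqr_ge0 u; lra.
  rewrite lef_pV2 ?posrE ?exprn_gt0 ?ltr_pwDl//.
  apply: (@le_trans _ _ (1 + u *+ K1)).
    rewrite lerD2l /u -mulr_natl mulrA.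
    by rewrite ler_peMl.
  by rewrite -mulr_natl bernoulli//; lra.
apply: le_trans (tail_exp (a + b)%N _ _) _; first by rewrite ltnW// ltnS leq_addl.
have tq : tail y <= q.
  apply: le_trans (near0 d _ _) => //; last exact: ltW.
  by rewrite !tail_dist lerD2l lerN2 dist_nd// ltW.
have tC : tail y <= C' * (1 + y) `^ (- rho).
  rewrite -lee_fin -tailE; apply: le_trans (HC y y0) _.
  by rewrite lee_fin ler_wpM2r ?powR_ge0// le_max lexx.
rewrite exprD; apply: (@le_trans _ _ (q ^+ a * (C' * (1 + y) `^ (- rho)) ^+ b)).
  by rewrite ler_pM ?exprn_ge0 ?tail_ge0//; apply: lerXn2r; rewrite ?nnegrE ?tail_ge0// ?mulr_ge0 ?powR_ge0// (le_trans ler01).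
rewrite exprMn mulrA; apply: (@le_trans _ _ (1 * ((1 + y) `^ (- rho)) ^+ b)).
  by rewrite ler_wpM2r// exprn_ge0// powR_ge0.
rewrite mul1r -powR_mulrn ?powR_ge0// -powRrM -powR_inv1 ?(ltW y1)//.
apply: ler_powR; first by rewrite lerDl.
by rewrite mulNr lerN2 mulrC.
Qed.

End error_law_bounds.

Section error_law_phi.
Context {R : realType}.
Variables (lam rho : R) (mu : probability R R).
Hypotheses (lam_gt0 : 0 < lam) (rho_gt0 : 0 < rho).
Hypothesis mu_law : error_law lam rho mu.
Notation dist := (dist mu).

Let D (s : R) : set R := `]-oo, s]%classic.

Let mphi (s : \bar R) : measurable_fun [set: R] (fun x : R => phi lam (Num.max x 0) s).
Proof. by apply: measurable_phi => //; exact: measurable_maxr. Qed.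

Let mD (s : R) : measurable (D s). Proof. exact: measurable_itv. Qed.

Let mI (s : R) : measurable_fun [set: R] (\1_(D s) : R -> R).
Proof. exact: measurable_indic. Qed.

Let max0 (x : R) : 0 <= Num.max x 0. Proof. by rewrite le_max lexx orbT. Qed.

Let phi_le (s x : R) : 0 <= s ->
  `|phi lam (Num.max x 0) s%:E| <= s + lam^-1 * \1_(D s) x.
Proof.
move=> s0; apply: le_trans (phi_bound lam_gt0 _ s0) _ => //.
rewrite lerD2l ler_pM2l ?invr_gt0// indicE ler_nat.
rewrite (_ : (x \in D s) = (x <= s)); last by rewrite /D mem_setE in_itv.
by rewrite ge_max s0 andbT.
Qed.

Lemma integral_affine_dist (s a b : R) : 0 <= a -> 0 <= b ->
  (\int[mu]_x (a + b * \1_(D s) x)%:E = (a + b * dist s)%:E)%E.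
Proof.
move=> a0 b0; under eq_integral do rewrite EFinD EFinM.
rewrite ge0_integralD//; last 2 first.
- by move=> x _; rewrite mule_ge0 ?lee_fin.
- by apply: emeasurable_funM => //; apply/measurable_EFinP; exact: (mI s).
rewrite ge0_integralZl//; last by apply/measurable_EFinP; exact: (mI s).
have -> : (\int[mu]_x (\1_(D s) x)%:E = (dist s)%:E)%E.
  by rewrite integral_indic// setIT; exact: distE.
rewrite EFinD EFinM; congr (_ + _)%E.
by have := expectation_cst mu a; rewrite unlock.
Qed.

Let indic_int s : mu.-integrable setT (EFin \o (\1_(D s) : R -> R)).
Proof.
apply: measurable_bounded_integrable => //; first by apply: (le_lt_trans (probability_le1 mu measurableT)); rewrite ltry.
exists 1; split => // M M1 x _ /=; rewrite indicE (le_trans _ (ltW M1))//.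
by case: (x \in _); rewrite ?normr1 ?normr0.
Qed.

Lemma Rintegral_affine_dist (s a b : R) :
  mu.-integrable setT (fun x => (a + b * \1_(D s) x)%:E) /\
  \int[mu]_x (a + b * \1_(D s) x) = a + b * dist s.
Proof.
have ib : mu.-integrable setT (fun x => (b * \1_(D s) x)%:E).
  rewrite (_ : (fun _ => _) = fun x => (b%:E * (\1_(D s) x)%:E)%E).
    by apply: integrableZl => //; exact: (indic_int s).
  by apply/funext => x; rewrite EFinM.
have ia : mu.-integrable setT (fun x => a%:E).
  exact: finite_measure_integrable_cst.
split.
  rewrite (_ : (fun _ => _) = fun x => (a%:E + (b * \1_(D s) x)%:E)%E).
    exact: integrableD.
  by apply/funext => x; rewrite EFinD.
rewrite RintegralD// RintegralZl//.
congr (_ + _ * _).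
  by have := expectation_cst mu a; rewrite unlock /Rintegral => ->.
by rewrite /Rintegral integral_indic// setIT.
Qed.

Lemma phi_integrable (s : R) : 0 <= s ->
  mu.-integrable setT (fun x => (phi lam (Num.max x 0) s%:E)%:E).
Proof.
move=> s0; apply/integrableP; split; first exact/measurable_EFinP.
apply: (@le_lt_trans _ _ (s + lam^-1 * dist s)%:E); last exact: ltry.
rewrite -integral_affine_dist// ?invr_ge0 ?(ltW lam_gt0)//.
apply: ge0_le_integral => //=.
- by apply/measurable_EFinP/measurableT_comp.
- apply/measurable_EFinP; apply: measurable_funD => //.
  by apply: measurable_funM => //; exact: (mI s).
- by move=> x _; rewrite lee_fin phi_le.
Qed.

(** The last bound is where the correction -1/lam pays off, as the linear terms of E min(e, s) and
    P(e <= s)/lam cancel. The third one, which follows from the first, is the better one for large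
    [s]. *)
Lemma phi_bounds : exists2 C : R, 0 < C & forall s : R, 0 <= s ->
  [/\ (\int[mu]_x `|phi lam (Num.max x 0) s%:E|%:E <= (C * s)%:E)%E,
      (\int[mu]_x (phi lam (Num.max x 0) s%:E ^+ 2)%:E <= (C * (s + s ^+ 2))%:E)%E,
      `|psi mu lam s%:E| <= C * s &
      `|psi mu lam s%:E| <= C * s ^+ 2].
Proof.
have [C1 C10 HC] := dist_linear lam_gt0 mu_law.
have [K K0 HK] := dist_expansion lam_gt0 mu_law.
have L0 : 0 < lam^-1 by rewrite invr_gt0.
pose C := 2 + C1 + K / lam + C1 / lam + 2 * C1 / lam ^+ 2.
have [p1 p2 p3] : [/\ 0 < K / lam, 0 < C1 / lam & 0 < 2 * C1 / lam ^+ 2].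
  by split; rewrite ?divr_gt0 ?mulr_gt0 ?exprn_gt0.
exists C; first by rewrite /C; lra.
move=> s s0.
have F0 := dist_ge0 mu s.
have F1 := HC s s0.
have abs_le : (\int[mu]_x `|phi lam (Num.max x 0) s%:E|%:E <= (C * s)%:E)%E.
  apply: (@le_trans _ _ (s + lam^-1 * dist s)%:E).
    rewrite -integral_affine_dist// ?invr_ge0 ?(ltW lam_gt0)//.
    apply: ge0_le_integral => //=.
    - exact/measurable_EFinP/measurableT_comp.
    - apply/measurable_EFinP; apply: measurable_funD => //.
      by apply: measurable_funM => //; exact: (mI s).
    - by move=> x _; rewrite lee_fin phi_le.
  rewrite lee_fin.
  have : lam^-1 * dist s <= (C1 / lam) * s.
    by rewrite mulrAC mulrC ler_pM2r.
  have [q1 q2 q3 q4] : [/\ 0 <= C1 * s, 0 <= K / lam * s, 0 <= 2 * C1 / lam ^+ 2 * s & 0 <= C1 / lam * s].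
    by split; rewrite mulr_ge0// ltW.
  by rewrite /C; lra.
split => //.
- apply: (@le_trans _ _ (2 * s ^+ 2 + 2 * lam^-2 * dist s)%:E).
    have [m1 m2] : 0 <= 2 * s ^+ 2 /\ 0 <= 2 * lam^-2.
      by split; rewrite mulr_ge0 ?sqr_ge0// invr_ge0 exprn_ge0// ltW.
    rewrite -integral_affine_dist//.
    apply: ge0_le_integral => //=.
    - by move=> x _; rewrite lee_fin sqr_ge0.
    - exact/measurable_EFinP/measurable_funX.
    - apply/measurable_EFinP; apply: measurable_funD => //.
      by apply: measurable_funM => //; exact: (mI s).
    - move=> x _; rewrite lee_fin.
      have := phi_le x s0; rewrite indicE.
      set p := phi _ _ _; set e := (x \in _)%:R => h.
      have h0 : 0 <= `|p| by exact: normr_ge0.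
      have -> : p ^+ 2 = `|p| ^+ 2 by rewrite real_normK ?num_real.
      have h1 : `|p| ^+ 2 <= (s + lam^-1 * e) ^+ 2 by apply: lerXn2r; rewrite ?nnegrE//; lra.
      have ee : e ^+ 2 = e by rewrite /e; case: (x \in _); rewrite ?expr1n ?expr0n.
      apply: le_trans h1 _.
      have -> : 2 * lam^-2 * e = 2 * (lam^-1 * e) ^+ 2 by rewrite exprMn ee exprVn; ring.
      by have := sqr_ge0 (s - lam^-1 * e); lra.
  rewrite lee_fin.
  have : 2 * lam^-2 * dist s <= (2 * C1 / lam ^+ 2) * s.
    rewrite -[leRHS]mulrA [leRHS](_ : _ = 2 * lam^-2 * (C1 * s)); last by field; rewrite gt_eqF.
    by rewrite ler_wpM2l// mulr_ge0// invr_ge0 exprn_ge0// ltW.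
  have c2 : 2 <= C by rewrite /C; lra.
  have c3 : 2 * C1 / lam ^+ 2 <= C by rewrite /C; lra.
  have := ler_wpM2r s0 c3; have := ler_wpM2r (sqr_ge0 s) c2.
  by lra.
- rewrite -lee_fin; apply: le_trans abs_le.
  rewrite -[leRHS]fineK.
    by rewrite lee_fin; exact: (le_normr_Rintegral measurableT (phi_integrable s0)).
  rewrite ge0_fin_numE ?integral_ge0//.
  by case/integrableP: (phi_integrable s0).
(* On {e <= s} the value min(e, s) lies between 0 and s, so psi(s) lies between s - F(s)/lam - s
   F(s) and s - F(s)/lam; both ends are O(s^2). *)
- have Fs := HK s s0.
  have [i1 e1] := Rintegral_affine_dist s s (- lam^-1).
  have [i2 e2] := Rintegral_affine_dist s s (- (s + lam^-1)).
  have xD x : (x \in D s) = (Num.max x 0 <= s).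
    by rewrite /D mem_setE in_itv/= ge_max s0 andbT.
  have h1 : psi mu lam s%:E <= s - lam^-1 * dist s.
    rewrite -mulNr -e1; apply: le_Rintegral => //; first exact: phi_integrable.
    move=> x _; rewrite /phi lee_fin indicE xD; case: ifP => h /=; last by lra.
    by rewrite mulr1; lra.
  have h2 : s - (s + lam^-1) * dist s <= psi mu lam s%:E.
    rewrite -mulNr -e2; apply: le_Rintegral => //; first exact: phi_integrable.
    move=> x _; rewrite /phi lee_fin indicE xD; case: ifP => h /=; last by lra.
    by have := max0 x; rewrite mulr1; lra.
  have h3 : s * dist s <= C1 * s ^+ 2.
    by rewrite expr2 [leRHS]mulrCA ler_wpM2l.
  have h4 : `|s - lam^-1 * dist s| <= K / lam * s ^+ 2.
    have -> : s - lam^-1 * dist s = - (lam^-1 * (dist s - lam * s)).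
      by field; rewrite gt_eqF.
    rewrite normrN normrM gtr0_norm// mulrAC mulrC ler_pM2r//.
  have h5 : (C1 + K / lam) * s ^+ 2 <= C * s ^+ 2.
    by rewrite ler_wpM2r ?sqr_ge0// /C; lra.
  move: h4; rewrite !ler_norml => /andP[h4 h4']; apply/andP; split; lra.
Qed.

End error_law_phi.

(** * Moments of the minimum of many errors *)

Section minimum_moment.
Context d (T : measurableType d) (R : realType) (P : probability T R) (n : nat).
Variables (X : 'I_n -> T -> R) (mu : probability R R).
Hypothesis mX : forall i, measurable_fun setT (X i).
Hypothesis X_ge0 : forall i w, 0 <= X i w.
Hypothesis indX : forall (J : {set 'I_n}) (A : 'I_n -> set R),
  (forall i, measurable (A i)) ->
  P (\bigcap_(i in [set` J]) (X i @^-1` A i)) = (\prod_(i in J) P (X i @^-1` A i))%E.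
Hypothesis lawX : forall i A, measurable A -> P (X i @^-1` A) = mu A.
Implicit Types (K : {set 'I_n}).

Let xmin_ K w := xmin K (X^~ w).

Lemma xmin_gtE K y : [set w | (y%:E < xmin_ K w)%E] =
  \bigcap_(i in [set` K]) (X i @^-1` `]y, +oo[%classic).
Proof.
apply/seteqP; split => w /=.
  move=> /bigmin_gtP[_ h] i /= iK; rewrite in_itv/= andbT.
  by have := h i iK; rewrite lte_fin.
move=> h; apply/bigmin_gtP; split; first exact: ltry.
by move=> i iK; rewrite lte_fin; have := h i iK; rewrite /= in_itv/= andbT.
Qed.

Lemma measurable_xmin_gt K y : measurable [set w | (y%:E < xmin_ K w)%E].
Proof.
rewrite xmin_gtE; apply: fin_bigcap_measurable => // i _.
by rewrite -[X in measurable X]setTI; exact: mX.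
Qed.

Lemma probability_xmin_gt K y :
  P [set w | (y%:E < xmin_ K w)%E] = (tail mu y ^+ #|K|)%:E.
Proof.
rewrite xmin_gtE indX//.
under eq_bigr do rewrite lawX// tailE.
by rewrite prodEFin prodr_const.
Qed.

Lemma sum_inv_sqr (k : nat) : \sum_(0 <= j < k) (j.+1%:R ^- 2 : R) <= 2.
Proof.
case: k => [|k]; first by rewrite big_geq.
apply: (@le_trans _ _ (2 - k.+1%:R^-1)); last by rewrite gerBl invr_ge0.
elim: k => [|k IH]; first by rewrite big_nat1 expr1n invr1; lra.
rewrite big_nat_recr//=; apply: le_trans (lerD IH (lexx _)) _.
have k0 : (0 : R) < k.+1%:R by rewrite ltr0n.
have k1 : (0 : R) < k.+2%:R by rewrite ltr0n.
have -> : (k.+2%:R : R) = k.+1%:R + 1 by rewrite natr1.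
rewrite -natr1 in k1.
rewrite -subr_ge0.
have -> : 2 - (k.+1%:R + 1)^-1 - (2 - k.+1%:R^-1 + (k.+1%:R + 1) ^- 2) =
    (k.+1%:R * (k.+1%:R + 1) ^+ 2)^-1 :> R.
  by field; rewrite !gt_eqF.
by rewrite invr_ge0 mulr_ge0 ?exprn_ge0// ltW.
Qed.

Variables (Kt : nat).
Hypothesis Kt_tail : forall y, 0 <= y -> tail mu y ^+ Kt <= (1 + y)^-1.

(** With at least 6 Kt Q errors, P(min > j/Q) <= (1 + j/Q)^(-6Q) <= (1 + j)^-6 by Bernoulli's
    inequality. Cubes are needed because mean products of residuals involve a third power of the
    minimum; (j+2)^3 (j+1)^-6 <= 8 (j+1)^-2 is summable with sum at most 16, and 17 = 1 + 16. *)
Lemma minimum_moment K (Q : nat) : (0 < Q)%N -> (6 * Kt * Q <= #|K|)%N ->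
  (0 < #|K|)%N ->
  (\int[P]_w ((1 + Q%:R * fine (xmin_ K w)) ^+ 3)%:E <= 17%:E)%E.
Proof.
move=> Q0 KQ K0.
have Q0' : (0 : R) < Q%:R by rewrite ltr0n.
pose E (j : nat) := [set w | ((j%:R / Q%:R)%:E < xmin_ K w)%E].
have mE j : measurable (E j) by exact: measurable_xmin_gt.
have PE j : (P (E j) <= (j.+1%:R ^- 6)%:E)%E.
  rewrite /E probability_xmin_gt lee_fin.
  set y := j%:R / Q%:R; have y0 : 0 <= y by rewrite divr_ge0.
  apply: (@le_trans _ _ (tail mu y ^+ (Kt * (Q * 6)))).
    by apply: ler_wiXn2l; rewrite ?tail_ge0 ?tail_le1// mulnA mulnC mulnA.
  rewrite exprM; apply: (@le_trans _ _ (((1 + y)^-1) ^+ (Q * 6))).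
    by apply: lerXn2r; rewrite ?nnegrE ?exprn_ge0 ?tail_ge0 ?invr_ge0 ?addr_ge0//; exact: Kt_tail.
  rewrite exprM -!exprVn; apply: lerXn2r; rewrite ?nnegrE ?exprn_ge0 ?invr_ge0 ?addr_ge0//.
  rewrite exprVn lef_pV2 ?posrE ?exprn_gt0 ?ltr_pwDl//.
  have := @bernoulli R y Q; rewrite /y mulrCA mulfV ?gt_eqF// mulr1 -/y.
  by rewrite addrC natr1; apply; lra.
have xminE w : exists2 x : R, 0 <= x & xmin_ K w = x%:E.
  have [j jK] : exists j, j \in K by apply/set0Pn; rewrite -card_gt0.
  have [|j0 j0K h] := eq_bigmin (x := +oo%E) j (mem K) (fun j => (X j w)%:E) jK.
    by move=> *; exact: leey.
  by exists (X j0 w) => //; exact: X_ge0.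
(* A layer decomposition: for j < Q min <= j+1 the [j]-th term alone is at least (1 + Q min)^3, and
   the case min = 0 is covered by the separate summand 1. *)
pose t (j : nat) w : \bar R := ((j.+2%:R ^+ 3)%:E * (\1_(E j) w)%:E)%E.
have t0 j w : (0 <= t j w)%E by rewrite /t mule_ge0// lee_fin.
have mt j : measurable_fun setT (t j).
  apply: emeasurable_funM => //; apply/measurable_EFinP.
  by apply: measurable_indic.
have mV : measurable_fun setT (fun w => ((1 + Q%:R * fine (xmin_ K w)) ^+ 3)%:E).
  apply/measurable_EFinP; apply: measurable_funX; apply: measurable_funD => //.
  apply: measurable_funM => //; apply: measurableT_comp => //.
  apply: measurable_bigmine => i _; exact/measurable_EFinP.
have ms : measurable_fun setT (fun w => \sum_(j <oo) t j w)%E.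
  rewrite (_ : (fun w => _) = (fun w => \sum_(j <oo | j \in xpredT) t j w)%E)//.
  exact: ge0_emeasurable_sum.
apply: (@le_trans _ _ (\int[P]_w (1 + \sum_(j <oo) t j w))%E).
  apply: ge0_le_integral => //=.
  - move=> w _; have [x x0 ->] := xminE w.
    by rewrite lee_fin exprn_ge0// addr_ge0// mulr_ge0// ltW.
  - by apply: emeasurable_funD.
  - move=> w _; have [x x0 xE] := xminE w; rewrite xE/=.
    have [->|xn0] := eqVneq x 0.
      by rewrite mulr0 addr0 expr1n leeDl// nneseries_ge0.
    have Qx : 0 < Q%:R * x by rewrite mulr_gt0// lt0r xn0.
    have [j [j1 j2]] : exists j : nat, j%:R < Q%:R * x /\ Q%:R * x <= j.+1%:R.
      have ex : exists k : nat, Q%:R * x <= k.+1%:R.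
        by exists (Num.truncn (Q%:R * x)); rewrite ltW// truncnS_gt.
      case: (ex_minnP ex) => [[|j] jx jmin]; first by exists 0%N.
      exists j.+1; split => //; rewrite ltNge; apply/negP => /jmin.
      by rewrite ltnn.
    apply: (@le_trans _ _ (t j w)).
      rewrite /t indicE mem_set ?mule1 ?lee_fin; last first.
        by rewrite /E/= xE lte_fin ltr_pdivrMr// mulrC.
      have h1 : 1 + Q%:R * x <= j.+2%:R.
        have -> : (j.+2%:R : R) = 1 + j.+1%:R by rewrite addrC natr1.
        by rewrite lerD2l.
      have h0 : 0 <= 1 + Q%:R * x by rewrite addr_ge0// ltW.
      by apply: lerXn2r => //; rewrite nnegrE ?ler0n.
    apply: le_trans (leeDr _ _) => //.
    apply: le_trans (nneseries_lim_ge j.+1 _) => //.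
    by rewrite big_nat_recr//= leeDr// sume_ge0.
rewrite ge0_integralD//=; last by move=> w _; exact: nneseries_ge0.
rewrite integral_nneseries//.
have -> : (\int[P]_w 1 = 1%:E)%E by have := expectation_cst P 1; rewrite unlock.
have -> : (17%:E = 1%:E + 16%:E :> \bar R)%E by rewrite -EFinD; congr EFin; lra.
apply: leeD => //.
apply: lime_le; first by apply: is_cvg_nneseries => *; exact: integral_ge0.
apply: nearW => k.
apply: (@le_trans _ _ (\sum_(0 <= j < k) (8 * j.+1%:R ^- 2)%:E)%E); last first.
  rewrite sumEFin lee_fin -mulr_sumr.
  by have := sum_inv_sqr k; lra.
apply: lee_sum => j _.
have mi : measurable_fun setT (fun w => (\1_(E j) w)%:E : \bar R).
  by apply/measurable_EFinP; exact: measurable_indic.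
rewrite /t ge0_integralZl//; try by rewrite lee_fin exprn_ge0.
rewrite integral_indic// setIT; apply: le_trans (lee_wpmul2l _ (PE j)) _.
  by rewrite lee_fin exprn_ge0.
rewrite -EFinM lee_fin.
have j0 : (0 : R) < j.+1%:R by rewrite ltr0n.
have j1 : (1 : R) <= j.+1%:R by rewrite ler1n.
have j2 : (j.+2%:R : R) <= 2 * j.+1%:R by rewrite -natr1; lra.
have h3 : (j.+2%:R ^+ 3 : R) <= 8 * j.+1%:R ^+ 3.
  rewrite (_ : 8 * _ = (2 * j.+1%:R) ^+ 3); last by ring.
  by apply: lerXn2r; rewrite ?nnegrE// mulr_ge0// ltW.
rewrite ler_pdivrMr ?exprn_gt0//.
apply: le_trans h3 _.
rewrite -mulrA ler_pM2l//.
have -> : j.+1%:R ^- 2 * j.+1%:R ^+ 6 = j.+1%:R ^+ 4 :> R.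
  by field; rewrite gt_eqF.
by rewrite ler_weXn2l.
Qed.

End minimum_moment.

(** * Residual moments under a general error law *)

Section general_law_moments.
Context d (T : measurableType d) (R : realType) (P : probability T R) (n : nat).
Variables (X : 'I_n -> T -> R) (mu : probability R R).
Hypothesis mX : forall i, measurable_fun setT (X i).
Hypothesis X_ge0 : forall i w, 0 <= X i w.
Hypothesis indX : forall (J : {set 'I_n}) (A : 'I_n -> set R),
  (forall i, measurable (A i)) ->
  P (\bigcap_(i in [set` J]) (X i @^-1` A i)) = (\prod_(i in J) P (X i @^-1` A i))%E.
Hypothesis lawX : forall i A, measurable A -> P (X i @^-1` A) = mu A.
Variables (lam r : R) (g : 'I_n -> R) (blk : 'I_n -> nat) (m : nat).
Hypotheses (lam_gt0 : 0 < lam) (r_ge0 : 0 <= r).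
Hypothesis g_osc : forall i j, blk i = blk j -> `|g i - g j| <= r.
Hypothesis card_b : forall i, #|[pred j | blk j == blk i]| = m.
Variables (Kt Q : nat) (C : R).
Hypothesis Q_gt0 : (0 < Q)%N.
Hypothesis m_large : (6 * Kt * Q + 3 <= m)%N.
Hypothesis Kt_tail : forall y, 0 <= y -> tail mu y ^+ Kt <= (1 + y)^-1.
Hypothesis C_gt0 : 0 < C.
Hypothesis phi_int : forall s : R, 0 <= s ->
  mu.-integrable setT (fun x => (phi lam (Num.max x 0) s%:E)%:E).
Hypothesis phi_le : forall s : R, 0 <= s ->
  [/\ (\int[mu]_x `|phi lam (Num.max x 0) s%:E|%:E <= (C * s)%:E)%E,
      (\int[mu]_x (phi lam (Num.max x 0) s%:E ^+ 2)%:E <= (C * (s + s ^+ 2))%:E)%E,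
      `|psi mu lam s%:E| <= C * s &
      `|psi mu lam s%:E| <= C * s ^+ 2].
Implicit Types (i j : 'I_n) (K : {set 'I_n}) (w : T).

Notation others := (others blk).
Let slack_ K i w := slack r g K i (X^~ w).
Let Z_ i w := truncated_residual lam r g blk i (X^~ w).
Let Z2_ i j w := truncated_residual2 lam r g blk i j (X^~ w).
(** Levels will be bounded by A V: [A], later compared with the rate, carries the size, and [V] is a
    random factor whose third moment is at most 17 when [K] is large enough. *)
Let V K w := 1 + Q%:R * fine (xmin K (X^~ w)).
Let A := 2 * r + Q%:R^-1.

Let Q0 : (0 : R) < Q%:R. Proof. by rewrite ltr0n. Qed.
Let A_gt0 : 0 < A. Proof. by rewrite ltr_wpDl ?mulr_ge0// invr_gt0. Qed.

Lemma card_others i : #|others i| = m.-1.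
Proof.
have := card_b i; rewrite (cardD1 i) inE eqxx add1n => <- /=.
by apply: eq_card => j; rewrite othersP !inE andbC.
Qed.

Lemma card_others2 i j : j \in others i -> #|others i :\ j| = m.-2.
Proof. by move=> ji; have := cardsD1 j (others i); rewrite ji card_others => ->. Qed.

Let xminE K w : (0 < #|K|)%N -> exists2 x : R, 0 <= x & xmin K (X^~ w) = x%:E.
Proof.
rewrite card_gt0 => /set0Pn[j jK].
have [|j0 j0K h] := eq_bigmin (x := +oo%E) j (mem K) (fun j => (X j w)%:E) jK.
  by move=> *; exact: leey.
by exists (X j0 w) => //; exact: X_ge0.
Qed.

Let V_ge1 K w : (0 < #|K|)%N -> 1 <= V K w.
Proof. move=> K0; have [x x0 e] := @xminE K w K0.
by rewrite /V e /= lerDl mulr_ge0// ltW. Qed.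

Lemma slack_fin K i w : (0 < #|K|)%N -> {in K, forall j, blk j = blk i} ->
  exists2 s : R, 0 <= s <= A * V K w & slack_ K i w = s%:E.
Proof.
move=> K0 Ki; have [x x0 xE] := @xminE K w K0.
have := slack_ge_xmin g_osc (X^~ w) Ki; rewrite xE.
have := slack_le_xmin g_osc (X^~ w) Ki; rewrite xE -/(slack_ K i w).
case: (slack_ K i w) => [s| |]//; rewrite -EFinD !lee_fin => sx xs.
exists s => //; rewrite (le_trans x0 xs)/=; apply: le_trans sx _.
rewrite /V xE/= /A.
have -> : (2 * r + Q%:R^-1) * (1 + Q%:R * x) = 2 * r + x + (Q%:R^-1 + 2 * r * (Q%:R * x)).
  by field; rewrite gt_eqF.
have : 0 <= Q%:R^-1 + 2 * r * (Q%:R * x).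
  by rewrite addr_ge0 ?invr_ge0 ?(ltW Q0)// !mulr_ge0// ltW.
lra.
Qed.

Let measurable_V K : measurable_fun setT (V K).
Proof.
apply: measurable_funD => //; apply: measurable_funM => //.
apply: measurableT_comp => //.
have h := @depends_on_xmin _ T R n X K.
have h2 := depends_on_measurable mX h.
exact: h2.
Qed.

Let measurable_slack K i : measurable_fun setT (slack_ K i).
Proof.
have h := @depends_on_slack _ T R n X r g K i.
exact: (depends_on_measurable mX h).
Qed.

Let depends_on_V K : depends_on X K (V K).
Proof.
apply: measurable_funD => //; apply: measurable_funM => //.
by apply: measurableT_comp => //; exact: depends_on_xmin.
Qed.

Let card_ok K := (0 < #|K|)%N /\ (6 * Kt * Q <= #|K|)%N.

Let others_ok i : card_ok (others i).
Proof. by rewrite /card_ok card_others; split; lia. Qed.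

Let others2_ok i j : j \in others i -> card_ok (others i :\ j).
Proof. by move=> ji; rewrite /card_ok card_others2//; split; lia. Qed.

Let EV K (p : nat) : card_ok K -> (p <= 3)%N ->
  (\int[P]_w (V K w ^+ p)%:E <= 17%:E)%E.
Proof.
move=> [K0 KQ] p3.
apply: le_trans (minimum_moment mX X_ge0 indX lawX Kt_tail Q_gt0 KQ K0).
apply: ge0_le_integral => //.
- by move=> w _; rewrite lee_fin exprn_ge0// (le_trans ler01 (V_ge1 w K0)).
- by apply/measurable_EFinP; apply: measurable_funX; exact: measurable_V.
- by apply/measurable_EFinP; apply: measurable_funX; exact: measurable_V.
- by move=> w _; rewrite lee_fin; apply: ler_weXn2l => //; exact: V_ge1.
Qed.

Let V_L2 K : card_ok K -> V K \in Lfun P 2%:E.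
Proof.
move=> Kok; apply: Lfun2_sqr; first exact: measurable_V.
by apply: le_lt_trans (EV Kok _) _; rewrite ?ltry.
Qed.

Let phi_L2 i K : card_ok K -> {in K, forall j, blk j = blk i} ->
  (fun w => phi lam (X i w) (slack_ K i w)) \in Lfun P 2%:E.
Proof.
move=> [K0 KQ] Ki; apply: (@Lfun2_dominated _ _ _ _ _ (fun w => A * V K w + lam^-1)).
- exact: measurable_phi.
- move=> w; have [s /andP[s0 sV] ->] := slack_fin w K0 Ki.
  apply: le_trans (phi_bound lam_gt0 (X_ge0 i w) s0) _.
  apply: lerD => //; rewrite ler_piMr ?invr_ge0 ?(ltW lam_gt0)//.
  by case: (X i w <= s).
- rewrite (_ : (fun w => _) = (A \o* V K) \+ cst lam^-1); last first.
    by apply/funext => w /=; rewrite mulrC.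
  have h1 : A \o* V K \in Lfun P 2%:E by apply: Lfun_scale; rewrite ?ler1n//; exact: V_L2.
  have h2 : cst lam^-1 \in Lfun P 2%:E by exact: Lfun_cst.
  by rewrite rpredD ?lee1n.
Qed.

Lemma residual_L2 i : Z_ i \in Lfun P 2%:E.
Proof. by apply: phi_L2; [exact: others_ok|exact: others_blk]. Qed.

Lemma residual2_L2 i j : j \in others i -> Z2_ i j \in Lfun P 2%:E.
Proof. by move=> ji; apply: phi_L2; [exact: others2_ok|exact: others2_blk]. Qed.

Lemma residual_psi_int i w :
  mu.-integrable setT (fun x => (phi lam (Num.max x 0) (slack_ (others i) i w))%:E).
Proof.
have [K0 KQ] := others_ok i.
by have [s /andP[s0 _] ->] := slack_fin w K0 (@others_blk _ blk i); exact: phi_int.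
Qed.

Lemma residual2_psi_int i j w : j \in others i ->
  mu.-integrable setT (fun x => (phi lam (Num.max x 0) (slack_ (others i :\ j) i w))%:E).
Proof.
move=> ji; have [K0 KQ] := others2_ok ji.
by have [s /andP[s0 _] ->] := slack_fin w K0 (@others2_blk _ blk i j); exact: phi_int.
Qed.

Let abs_Rintegral_le (f : T -> R) (h : T -> R) (b : R) :
  P.-integrable setT (EFin \o f) -> measurable_fun setT h ->
  (forall w, `|f w| <= h w) -> (\int[P]_w (h w)%:E <= b%:E)%E ->
  `|\int[P]_w f w| <= b.
Proof.
move=> fi mh fh hb; apply: le_trans (le_normr_Rintegral measurableT fi) _.
have /integrableP[mf foo] := fi.
rewrite -lee_fin /Rintegral fineK; last by rewrite ge0_fin_numE ?integral_ge0.
apply: le_trans hb; apply: ge0_le_integral => //.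
- by apply/measurable_EFinP/measurableT_comp => //; exact/measurable_EFinP.
- exact/measurable_EFinP.
- by move=> w _; rewrite lee_fin.
Qed.

Let psi_le (p : nat) (s : R) : (0 < p <= 2)%N -> 0 <= s -> `|psi mu lam s%:E| <= C * s ^+ p.
Proof. by case: p => [|[|[|]]]// _ s0; have [_ _ ? ?] := phi_le s0; rewrite ?expr1. Qed.

(** Fewer observations give a higher level, so the level of [K] is controlled by [V] of any nonempty
    subset. Levels over different sets can thus be compared with one [V], that of the block without
    both observations. *)
Let psi_V_le (p : nat) K K' i w : (0 < p <= 2)%N -> (0 < #|K'|)%N -> K' \subset K ->
  {in K, forall j, blk j = blk i} ->
  `|psi mu lam (slack_ K i w)| <= C * A ^+ p * V K' w ^+ p.
Proof.
move=> p12 K0 KK Ki.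
have K'i : {in K', forall j, blk j = blk i}.
  by move=> j /(fintype.subsetP KK); exact: Ki.
have [s' /andP[s'0 s'V] s'E] := slack_fin w K0 K'i.
have [s /andP[s0 _] sE] := slack_fin w (leq_trans K0 (subset_leq_card KK)) Ki.
have ss' : s <= s'.
  by have := slackS r g i (X^~ w) KK; rewrite -!/(slack_ _ _ _) sE s'E lee_fin.
rewrite sE; apply: le_trans (psi_le p12 s0) _.
rewrite -mulrA ler_pM2l// -exprMn; apply: lerXn2r; rewrite ?nnegrE//.
- by rewrite (le_trans s0)// (le_trans ss').
- exact: le_trans ss' s'V.
Qed.

Lemma mean_residual_le (p : nat) i : (0 < p <= 2)%N ->
  `|\int[P]_w Z_ i w| <= 17 * C * A ^+ p.
Proof.
move=> p12; have [-> ip] := mean_residual mX X_ge0 indX lawX residual_L2 residual_psi_int i.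
have [K0 KQ] := others_ok i.
apply: (abs_Rintegral_le (h := fun w => C * A ^+ p * V (others i) w ^+ p)) => //.
- by apply: measurable_funM => //; exact: measurable_funX.
- by move=> w; apply: psi_V_le => //; exact: others_blk.
under eq_integral do rewrite EFinM.
have CA : 0 <= C * A ^+ p by rewrite mulr_ge0 ?exprn_ge0// ltW.
have V0 w : 0 <= V (others i) w by rewrite (le_trans ler01)// V_ge1.
rewrite ge0_integralZl//; last 2 first.
- by apply/measurable_EFinP; apply: measurable_funX; exact: measurable_V.
- by move=> w _; rewrite lee_fin exprn_ge0.
apply: le_trans (lee_wpmul2l _ (EV (others_ok i) _)) _ => //.
  by move: p12 => /andP[_ /leq_trans]; apply.
by rewrite -EFinM lee_fin; lra.
Qed.

(** Averaging over the error [i] first gives E|phi(e, s)| <= C s <= C A V, which raises the power of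
    [V] from p to p+1; at p = 2 this is the third moment. *)
Let E_absphi_V (p : nat) K i : (p <= 2)%N -> i \notin K ->
  {in K, forall j, blk j = blk i} -> card_ok K ->
  (\int[P]_w (`|phi lam (X i w) (slack_ K i w)| * V K w ^+ p)%:E <= (17 * C * A)%:E)%E.
Proof.
move=> p2 iK Ki Kok; have [K0 KQ] := Kok.
pose f (z : (\bar R * R) * R) := (`|phi lam (Num.max z.2 0) z.1.1| * `|z.1.2| ^+ p)%:E.
have mf : measurable_fun setT f.
  apply/measurable_EFinP; apply: measurable_funM.
    apply: measurableT_comp => //; apply: measurable_phi.
      by apply: measurable_maxr.
    exact: (measurableT_comp measurable_fst).
  apply: measurable_funX; apply: measurableT_comp => //.
  exact: (measurableT_comp measurable_snd).
have mW : depends_on X K (fun w => (slack_ K i w, V K w)).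
  have h1 := @depends_on_slack _ T R n X r g K i; have h2 := @depends_on_V K.
  exact: measurable_fun_pair.
have V0 w : 0 <= V K w by rewrite (le_trans ler01)// V_ge1.
have fE w : f ((slack_ K i w, V K w), X i w) =
    (`|phi lam (X i w) (slack_ K i w)| * V K w ^+ p)%:E.
  by rewrite /f /= max_l// (ger0_norm (V0 w)).
under eq_integral do rewrite -fE.
rewrite (ge0_integral_cond mX indX lawX iK mW mf); last first.
  by move=> z; rewrite lee_fin mulr_ge0// exprn_ge0.
apply: (@le_trans _ _ (\int[P]_w ((C * A)%:E * (V K w ^+ p.+1)%:E))%E).
  apply: ge0_le_integral => //.
  - by move=> w _; apply: integral_ge0 => x _; rewrite lee_fin mulr_ge0// exprn_ge0.
  - apply: (@measurableT_comp _ _ _ _ _ _ (fun z => \int[mu]_x f (z, x))%E).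
      apply: measurable_fun_fubini_tonelli_F => // z.
      by rewrite lee_fin mulr_ge0// exprn_ge0.
    by apply: measurable_fun_pair.
  - apply: emeasurable_funM => //.
    by apply/measurable_EFinP; exact: measurable_funX.
  - move=> w _; have [s /andP[s0 sV] sE] := slack_fin w K0 Ki.
    rewrite sE /f /=.
    under eq_integral do rewrite EFinM.
    have mq : measurable_fun [set: R] (fun x : R => `|phi lam (Num.max x 0) s%:E|%:E).
      apply/measurable_EFinP; apply: measurableT_comp => //; apply: measurable_phi => //.
      exact: measurable_maxr.
    have vp : (0 <= (`|V K w| ^+ p)%:E :> \bar R)%E by rewrite lee_fin exprn_ge0.
    rewrite ge0_integralZr//.
    have [h _ _ _] := phi_le s0.
    apply: (@le_trans _ _ ((C * s)%:E * (`|V K w| ^+ p)%:E)%E).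
      by apply: lee_wpmul2r => //; rewrite lee_fin exprn_ge0.
    rewrite -!EFinM lee_fin (ger0_norm (V0 w)) exprS -!mulrA ler_pM2l// mulrA.
    by rewrite ler_wpM2r// exprn_ge0.
have CA : 0 <= C * A by rewrite mulr_ge0// ltW.
rewrite ge0_integralZl//; last 2 first.
- by apply/measurable_EFinP; exact: measurable_funX.
- by move=> w _; rewrite lee_fin exprn_ge0.
apply: le_trans (lee_wpmul2l _ (EV Kok _)) _ => //.
by rewrite -EFinM lee_fin; lra.
Qed.

(** The residual contributes a factor [A] through its first absolute moment and [psi] contributes
    A^p. The Cauchy-Schwarz inequality would only give order sqrt(A) for the residual when [A] is
    small. *)
Let E_Z2_psi_le (p : nat) i j k K : (0 < p <= 2)%N -> j \in others i ->
  others i :\ j \subset K -> {in K, forall l, blk l = blk k} ->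
  P.-integrable setT (fun w => (Z2_ i j w * psi mu lam (slack_ K k w))%:E) ->
  `|\int[P]_w (Z2_ i j w * psi mu lam (slack_ K k w))| <= 17 * C ^+ 2 * A ^+ p.+1.
Proof.
move=> p12 ji sub Kk fi; have Kok := others2_ok ji; have [K0 _] := Kok.
have V0 w : 0 <= V (others i :\ j) w by rewrite (le_trans ler01)// V_ge1.
have mphi : measurable_fun setT (fun w => phi lam (X i w) (slack_ (others i :\ j) i w)).
  exact: measurable_phi.
have CA : 0 <= C * A ^+ p by rewrite mulr_ge0 ?exprn_ge0// ltW.
apply: (abs_Rintegral_le (h := fun w => (C * A ^+ p) *
    (`|phi lam (X i w) (slack_ (others i :\ j) i w)| * V (others i :\ j) w ^+ p))) => //.
- apply: measurable_funM => //; apply: measurable_funM; first exact: measurableT_comp.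
  exact: measurable_funX.
- move=> w; rewrite normrM mulrCA -/(Z2_ i j w).
  by apply: ler_wpM2l => //; apply: psi_V_le.
under eq_integral do rewrite EFinM.
rewrite ge0_integralZl//; last 2 first.
- apply/measurable_EFinP; apply: measurable_funM; first exact: measurableT_comp.
  exact: measurable_funX.
- by move=> w _; rewrite lee_fin mulr_ge0// exprn_ge0.
apply: le_trans (lee_wpmul2l _ (E_absphi_V _ _ _ Kok)) _ => //.
- by case/andP: p12.
- by rewrite finset.in_setD1 negb_and (others_irrefl blk i) orbT.
- exact: others2_blk.
by rewrite -EFinM lee_fin [A ^+ p.+1]exprSr le_eqVlt; apply/orP; left; apply/eqP; ring.
Qed.

Lemma mean_residualM_same_block_le (p : nat) i j : (0 < p <= 2)%N -> i != j -> blk i = blk j ->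
  `|\int[P]_w (Z_ i w * Z_ j w)| <= 51 * C ^+ 2 * A ^+ p.+1.
Proof.
move=> p12 ij bij; have ji : j != i by rewrite eq_sym.
have oth k l : blk k = blk l -> k != l -> l \in others k /\ others k :\ l \subset others l.
  move=> bkl kl; rewrite othersP bkl eq_sym kl eqxx; split => //.
  by rewrite (others2_sym bkl) subD1set.
have [jo sub] := oth i j bij ij; have [io sub'] := oth j i (esym bij) ji.
have [-> i1 i2] := mean_residualM mX X_ge0 indX lawX r_ge0 residual_L2 residual2_L2 residual_psi_int residual2_psi_int ij bij.
have [_ i3 _] := mean_residualM mX X_ge0 indX lawX r_ge0 residual_L2 residual2_L2 residual_psi_int residual2_psi_int ji (esym bij).
have b1 := E_Z2_psi_le p12 jo sub (@others_blk _ blk j) i1.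
have b2 := E_Z2_psi_le p12 io sub' (@others_blk _ blk i) i3.
have sub2 : others i :\ j \subset others j :\ i by rewrite (others2_sym bij).
have b3 := E_Z2_psi_le p12 jo sub2 (@others2_blk _ blk j i) i2.
apply: le_trans (ler_normB _ _) _; apply: le_trans (lerD (ler_normD _ _) (lexx _)) _.
apply: le_trans (lerD (lerD b1 b2) b3) _.
by rewrite le_eqVlt; apply/orP; left; apply/eqP; ring.
Qed.

Lemma mean_residual_sq_le i : \int[P]_w (Z_ i w * Z_ i w) <= 17 * C * (A + A ^+ 2).
Proof.
have Kok := others_ok i; have [K0 KQ] := Kok.
have Ki := @others_blk _ blk i.
have V0 w : 0 <= V (others i) w by rewrite (le_trans ler01)// V_ge1.
pose f (z : \bar R * R) := (phi lam (Num.max z.2 0) z.1 ^+ 2)%:E.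
have mf : measurable_fun setT f.
  apply/measurable_EFinP; apply: measurable_funX; apply: measurable_phi => //.
  exact: measurable_maxr.
have fi := Lfun2_integrableM (residual_L2 i) (residual_L2 i).
rewrite -lee_fin /Rintegral fineK; last exact: (integrable_fin_num measurableT fi).
have fE w : (Z_ i w * Z_ i w)%:E = f (slack_ (others i) i w, X i w).
  by rewrite /f /= max_l.
under eq_integral do rewrite fE.
rewrite (ge0_integral_cond mX indX lawX (others_irrefl blk i)
  (@depends_on_slack _ T R n X r g (others i) i) mf); last first.
  by move=> z; rewrite lee_fin sqr_ge0.
apply: (@le_trans _ _ (\int[P]_w ((C * (A + A ^+ 2))%:E * (V (others i) w ^+ 2)%:E))%E).
  apply: ge0_le_integral => //.
  - by move=> w _; apply: integral_ge0 => x _; rewrite lee_fin sqr_ge0.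
  - apply: (@measurableT_comp _ _ _ _ _ _ (fun z => \int[mu]_x f (z, x))%E) => //.
    apply: measurable_fun_fubini_tonelli_F => // z.
    by rewrite lee_fin sqr_ge0.
    exact: (measurable_slack (others i) i).
  - apply: emeasurable_funM => //.
    by apply/measurable_EFinP; exact: measurable_funX.
  - move=> w _; have [s /andP[s0 sV] sE] := slack_fin w K0 Ki.
    rewrite -/(slack_ (others i) i w) sE /f /=; have [_ h _ _] := phi_le s0.
    apply: le_trans h _; rewrite -EFinM lee_fin -mulrA ler_pM2l//.
    rewrite mulrDl; apply: lerD.
      apply: le_trans sV _; rewrite ler_pM2l// expr2 ler_peMl//.
      exact: V_ge1.
    rewrite -exprMn; apply: lerXn2r; rewrite ?nnegrE//.
    exact: le_trans sV.
have CA : 0 <= C * (A + A ^+ 2).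
  apply: mulr_ge0; first exact: ltW.
  by apply: addr_ge0; [exact: ltW|exact: sqr_ge0].
rewrite ge0_integralZl//; last 2 first.
- by apply/measurable_EFinP; exact: measurable_funX.
- by move=> w _; rewrite lee_fin exprn_ge0.
apply: le_trans (lee_wpmul2l _ (EV Kok _)) _ => //.
by rewrite -EFinM lee_fin; lra.
Qed.

(** On the event that e_i <= y while all other errors of the block exceed y, the residual is e_i -
    1/lam <= -1/(2 lam), with square at least 1/(4 lam^2). The event has probability F(y) (1 -
    F(y))^(m-1), at least F(y)/2 by Bernoulli's inequality. *)
Lemma mean_residual_sq_ge i (y : R) : 0 <= y -> y <= (2 * lam)^-1 ->
  dist mu y <= (2 * m%:R)^-1 ->
  (8 * lam ^+ 2)^-1 * dist mu y <= \int[P]_w (Z_ i w * Z_ i w).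
Proof.
move=> y0 yl ym.
pose J := [set j | blk j == blk i]%SET.
pose B j : set R := if j == i then `]-oo, y]%classic else `]y, +oo[%classic.
have mB j : measurable (B j) by rewrite /B; case: ifP.
pose E := \bigcap_(j in [set` J]) (X j @^-1` B j).
have mE : measurable E.
  apply: fin_bigcap_measurable => // j _.
  by rewrite -[X in measurable X]setTI; exact: mX.
have iJ : i \in J by rewrite inE.
have PE : P E = (dist mu y * tail mu y ^+ m.-1)%:E.
  rewrite /E indX// (big_setD1 i)//= EFinM; congr (_ * _)%E.
    by rewrite lawX// /B eqxx distE.
  have -> : J :\ i = others i by apply/setP => j; rewrite !inE andbC.
  transitivity (\prod_(j in others i) (tail mu y)%:E)%E.
    apply: eq_bigr => j; rewrite othersP => /andP[_ ji].
    by rewrite lawX// /B (negbTE ji) tailE.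
  by rewrite prodEFin prodr_const card_others.
have fi := Lfun2_integrableM (residual_L2 i) (residual_L2 i).
have m0 : (0 : R) < m%:R by rewrite ltr0n (leq_trans _ m_large)// addn3.
have PE_ge : dist mu y / 2 <= dist mu y * tail mu y ^+ m.-1.
  apply: ler_wpM2l; first exact: dist_ge0.
  rewrite tail_dist; have := @bernoulli R (- dist mu y) m.-1.
  rewrite lerN2 dist_le1 => /(_ isT); apply: le_trans.
  have : m.-1%:R * dist mu y <= m%:R * (2 * m%:R)^-1.
    by rewrite ler_pM ?dist_ge0// ler_nat leq_pred.
  have -> : m%:R * (2 * m%:R)^-1 = 2^-1 :> R by field; rewrite gt_eqF.
  lra.
have L0 : 0 < (4 * lam ^+ 2)^-1 by rewrite invr_gt0 mulr_gt0// exprn_gt0.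
rewrite -lee_fin [leRHS]fineK; last exact: (integrable_fin_num measurableT fi).
apply: (@le_trans _ _ (\int[P]_w ((4 * lam ^+ 2)^-1 * \1_E w)%:E)%E).
  under eq_integral do rewrite EFinM.
  have mi : measurable_fun setT (fun w => (\1_E w)%:E : \bar R).
    by apply/measurable_EFinP; exact: measurable_indic.
  rewrite ge0_integralZl//; last by rewrite lee_fin ltW.
  have -> : (\int[P]_w (\1_E w)%:E = (dist mu y * tail mu y ^+ m.-1)%:E)%E.
    by rewrite integral_indic// setIT; exact: PE.
  rewrite -EFinM lee_fin.
  apply: le_trans (ler_wpM2l (ltW L0) PE_ge).
  rewrite [leLHS](_ : _ = (4 * lam ^+ 2)^-1 * (dist mu y / 2))//.
  by field; rewrite gt_eqF.
apply: ge0_le_integral => //.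
- by move=> w _; rewrite lee_fin mulr_ge0// ltW.
- have mi : measurable_fun setT (\1_E : T -> R) by exact: measurable_indic.
  by apply/measurable_EFinP; apply: measurable_funM => //.
- by case/integrableP: fi.
move=> w _; rewrite lee_fin indicE.
have [wE|_] := boolP (w \in E); last by rewrite mulr0 -expr2 sqr_ge0.
rewrite mulr1; have {}wE : E w by move: wE; rewrite inE.
have xi : X i w <= y.
  by have := wE i iJ; rewrite /= /B eqxx/= in_itv/=.
have ys : (y%:E <= slack_ (others i) i w)%E.
  apply: (slack_ge g_osc); first exact: others_blk.
  move=> j; rewrite othersP => /andP[bj ji]; rewrite lee_fin ltW//.
  have jJ : j \in J by rewrite inE.
  by have := wE j jJ; rewrite /= /B (negbTE ji)/= in_itv/= andbT.
have -> : Z_ i w = X i w - lam^-1.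
  by rewrite /Z_ /truncated_residual /phi ifT//; apply: le_trans ys; rewrite lee_fin.
have l2 : lam^-1 = 2 * (2 * lam)^-1 by field; rewrite gt_eqF.
have l3 : 0 <= (2 * lam)^-1 by rewrite invr_ge0 mulr_ge0// ltW.
have -> : (4 * lam ^+ 2)^-1 = (2 * lam)^-1 ^+ 2 by field; rewrite gt_eqF.
have -> : (X i w - lam^-1) * (X i w - lam^-1) = (lam^-1 - X i w) ^+ 2 by ring.
apply: lerXn2r; rewrite ?nnegrE//; lra.
Qed.

End general_law_moments.

(** * Exponential errors *)

Section exponential_model.
Context d (T : measurableType d) (R : realType) (P : probability T R) (n : nat).
Variables (X : 'I_n -> T -> R).
Variables (lam r : R) (g : 'I_n -> R) (blk : 'I_n -> nat) (m : nat).
Hypotheses (lam_gt0 : 0 < lam) (r_ge0 : 0 <= r).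
Let mu := exponential_law lam_gt0.
Hypothesis mX : forall i, measurable_fun setT (X i).
Hypothesis X_ge0 : forall i w, 0 <= X i w.
Hypothesis indX : forall (J : {set 'I_n}) (A : 'I_n -> set R),
  (forall i, measurable (A i)) ->
  P (\bigcap_(i in [set` J]) (X i @^-1` A i)) = (\prod_(i in J) P (X i @^-1` A i))%E.
Hypothesis lawX : forall i A, measurable A -> P (X i @^-1` A) = mu A.
Hypothesis g_osc : forall i j, blk i = blk j -> `|g i - g j| <= r.
Hypothesis card_b : forall i, #|[pred j | blk j == blk i]| = m.
Implicit Types (i j : 'I_n) (K : {set 'I_n}) (w : T).

Notation others := (others blk).
Let slack_ K i w := slack r g K i (X^~ w).
Let Z_ i w := truncated_residual lam r g blk i (X^~ w).
Let Z2_ i j w := truncated_residual2 lam r g blk i j (X^~ w).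
Let xmin_ K w := xmin K (X^~ w).

Let max0 (x : R) : 0 <= Num.max x 0. Proof. by rewrite le_max lexx orbT. Qed.

Let slack_ge0_ K i w : {in K, forall j, blk j = blk i} -> (0 <= slack_ K i w)%E.
Proof. by move=> Ki; apply: (slack_ge0 g_osc). Qed.

Let integral_law i (f : R -> \bar R) : measurable_fun setT f -> (forall x, 0 <= f x)%E ->
  (\int[P]_w f (X i w) = \int[mu]_x f x)%E.
Proof.
move=> mf f0.
(* Conditioning on no error at all, with a constant in the place of [W]. *)
have m0 : depends_on X finset.set0 (fun _ : T => 0 : R) by exact: measurable_cst.
have i0 : i \notin (finset.set0 : {set 'I_n}) by rewrite inE.
have mf2 : measurable_fun setT (fun z : R * R => f z.2).
  exact: (measurableT_comp mf measurable_snd).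
have := ge0_integral_cond mX indX lawX i0 m0 mf2 (fun z => f0 z.2).
move=> /= ->; have := integral_cst P measurableT.
move=> /(_ (\int[mu]_x f x)%E) ->.
by rewrite [X in (_ * X)%E](_ : _ = 1%E) ?mule1//; exact: probability_setT.
Qed.

Let X_L2 i : X i \in Lfun P 2%:E.
Proof.
apply: Lfun2_sqr => //.
have mf : measurable_fun setT (fun x : R => ((Num.max x 0) ^+ 2)%:E).
  by apply/measurable_EFinP; apply: measurable_funX; exact: measurable_maxr.
have := integral_law i mf; under eq_integral do rewrite max_l//.
move=> ->; first by rewrite integral_exponential_sq ltry.
by move=> x; rewrite lee_fin sqr_ge0.
Qed.

Let measurable_slack K i : measurable_fun setT (slack_ K i).
Proof.
have h := @depends_on_slack _ T R n X r g K i.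
exact: (depends_on_measurable mX h).
Qed.

Let phi_L2 i K : {in K, forall j, blk j = blk i} ->
  (fun w => phi lam (X i w) (slack_ K i w)) \in Lfun P 2%:E.
Proof.
move=> Ki; apply: (@Lfun2_dominated _ _ _ _ _ (fun w => X i w + lam^-1)).
- exact: measurable_phi.
- by move=> w; apply: phi_bound_dominated => //; exact: slack_ge0_.
- rewrite (_ : (fun w => _) = X i \+ cst lam^-1)//.
  have h2 : cst lam^-1 \in Lfun P 2%:E by exact: Lfun_cst.
  by rewrite rpredD ?lee1n.
Qed.

Let Z_L2_ i : Z_ i \in Lfun P 2%:E.
Proof. by apply: phi_L2; exact: others_blk. Qed.

Let Z2_L2_ i j : j \in others i -> Z2_ i j \in Lfun P 2%:E.
Proof. by move=> _; apply: phi_L2; exact: others2_blk. Qed.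

Let phi_int (s : \bar R) : (0 <= s)%E ->
  mu.-integrable setT (fun x => (phi lam (Num.max x 0) s)%:E).
Proof.
move=> s0; apply: (@Lfun2_integrable _ _ _ mu (fun x => phi lam (Num.max x 0) s)).
apply: Lfun2_sqr; first by apply: measurable_phi => //; exact: measurable_maxr.
by rewrite integral_exponential_phi_sq// ltry.
Qed.

Let psi0 (s : \bar R) : (0 <= s)%E -> psi mu lam s = 0.
Proof. by move=> s0; rewrite /psi /Rintegral integral_exponential_phi. Qed.

Let psi_int1 i w :
  mu.-integrable setT (fun x => (phi lam (Num.max x 0) (slack_ (others i) i w))%:E).
Proof. by apply: phi_int; apply: slack_ge0_; exact: others_blk. Qed.

Let psi_int2 i j w : j \in others i ->
  mu.-integrable setT (fun x => (phi lam (Num.max x 0) (slack_ (others i :\ j) i w))%:E).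
Proof. by move=> _; apply: phi_int; apply: slack_ge0_; exact: others2_blk. Qed.

Lemma exponential_residual_L2 i : Z_ i \in Lfun P 2%:E. Proof. exact: Z_L2_. Qed.

Let Rintegral0 : \int[P]_w (0 : R) = 0.
Proof. by rewrite /Rintegral integral0. Qed.

Lemma exponential_mean_residual i : \int[P]_w Z_ i w = 0.
Proof.
have [-> _] := mean_residual mX X_ge0 indX lawX Z_L2_ psi_int1 i.
rewrite -(Rintegral0); apply: eq_Rintegral => w _.
by apply: psi0; apply: slack_ge0_; exact: others_blk.
Qed.

Lemma exponential_mean_residualM i j : i != j -> \int[P]_w (Z_ i w * Z_ j w) = 0.
Proof.
move=> ij; have [bij|bij] := eqVneq (blk i) (blk j); last first.
  by rewrite (mean_residualM_diff_block mX indX Z_L2_)// exponential_mean_residual mul0r.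
have [-> _ _] := mean_residualM mX X_ge0 indX lawX r_ge0 Z_L2_ Z2_L2_ psi_int1 psi_int2 ij bij.
have e K k (G : T -> R) : {in K, forall l, blk l = blk k} ->
    \int[P]_w (G w * psi mu lam (slack_ K k w)) = 0.
  move=> Kk; rewrite -(Rintegral0); apply: eq_Rintegral => w _.
  by rewrite psi0 ?mulr0//; exact: slack_ge0_.
by rewrite !e ?addr0 ?subr0//; [exact: others2_blk|exact: others_blk|exact: others_blk].
Qed.

(** The exponential distribution function is Lipschitz with constant lam, so raising the level by 2r
    costs at most 2 r lam. *)
Let exp_tail_shift (s t : \bar R) : (0 <= s)%E -> (0 <= t)%E ->
  (s <= t + (2 * r)%:E)%E -> 1 - exp_tail lam s <= 2 * r * lam + (1 - exp_tail lam t).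
Proof.
have rl : 0 <= 2 * r * lam by rewrite !mulr_ge0// ltW.
move=> s0 t0 st.
have tl0 : 0 <= exp_tail lam s by case: (s) => [x| |] //=; exact: expR_ge0.
case: t t0 st => [t| |]// t0 st; last by rewrite /=; lra.
case: s s0 st tl0 => [s| |]// s0 st _ /=.
move: s0 t0 st; rewrite -EFinD !lee_fin => s0 t0 st.
have h1 : expR (- lam * t) * expR (- (2 * r * lam)) <= expR (- lam * s).
  rewrite -expRD ler_expR !mulNr -opprD lerN2.
  have := ler_wpM2l (ltW lam_gt0) st; rewrite mulrDr; lra.
have h2 := expR_ge1Dx (- (2 * r * lam)).
have h3 : expR (- lam * t) <= 1.
  by rewrite -expR0 ler_expR mulNr oppr_le0 mulr_ge0// ltW.
have h4 := expR_gt0 (- lam * t).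
have h5 := ler_wpM2l (ltW h4) h2.
have h6 : expR (- lam * t) * (2 * r * lam) <= 2 * r * lam by rewrite ler_piMl.
lra.
Qed.

Let integral_dist (t : \bar R) : (0 <= t)%E ->
  (\int[mu]_x (((Num.max x 0)%:E <= t)%E%:R)%:E = (1 - exp_tail lam t)%:E)%E.
Proof.
pose q : {poly R} := 1%:P.
have qqE x : q.[x] - lam^-1 * q^`().[x] = 1.
  by rewrite /q derivC !hornerC; ring.
have q0 x : 0 <= x -> 0 <= q.[x] - lam^-1 * q^`().[x] by rewrite qqE.
case: t => [t| |]//=; first rewrite lee_fin => t0.
- transitivity (\int[mu]_x (if (Num.max x 0 <= t)%R then
      (q.[Num.max x 0] - lam^-1 * q^`().[Num.max x 0])%R else 0)%:E)%E.
    by apply: eq_integral => x _; rewrite lee_fin qqE; case: ifP.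
  rewrite (integral_exponential_piece lam_gt0 t0 (lexx 0) q0) !hornerC.
  by congr EFin; ring.
- move=> _; rewrite subr0 -[X in X%:E](_ : q.[0] = 1); last by rewrite hornerC.
  rewrite -(integral_exponential_ray lam_gt0 q0).
  by apply: eq_integral => x _; rewrite leey qqE.
Qed.

Let measurable_xmin K : measurable_fun setT (xmin_ K).
Proof.
have h := @depends_on_xmin _ T R n X K.
exact: (depends_on_measurable mX h).
Qed.

Let xmin_ge0 K w : (0 <= xmin_ K w)%E.
Proof. by apply: le_bigmin => [|j _]; rewrite ?leey// lee_fin. Qed.

Let xmin_geE K y : xmin_ K @^-1` [set t | (y%:E <= t)%E] =
  \bigcap_(i in [set` K]) (X i @^-1` `[y, +oo[%classic).
Proof.
apply/seteqP; split => w /=.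
  move=> /bigmin_geP[_ h] i /= iK; rewrite in_itv/= andbT.
  by have := h i iK; rewrite lee_fin.
move=> h; apply/bigmin_geP; split; first exact: leey.
by move=> i iK; rewrite lee_fin; have := h i iK; rewrite /= in_itv/= andbT.
Qed.

Let probability_xmin_ge K y : 0 <= y ->
  P (xmin_ K @^-1` [set t | (y%:E <= t)%E]) = (expR (- lam * y) ^+ #|K|)%:E.
Proof.
move=> y0; rewrite xmin_geE indX//.
under eq_bigr do rewrite lawX// exponential_law_ray//.
by rewrite prodEFin prodr_const.
Qed.

HB.instance Definition _ K := isMeasurableFun.Build _ _ _ _ (xmin_ K) (measurable_xmin K).

(* The probability that the error of index [i] is the smallest of its block. *)
Let integral_tail_xmin i :
  (\int[P]_w (1 - exp_tail lam (xmin_ (others i) w))%:E = (m%:R^-1)%:E)%E.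
Proof.
pose K := others i.
have iK : i \notin K by exact: others_irrefl.
have m1 : (m = (#|K|).+1)%N.
  have := card_b i; rewrite (cardD1 i) inE eqxx add1n => <-; congr _.+1.
  by apply: eq_card => j; rewrite othersP !inE andbC.
pose f (z : \bar R * R) := (((Num.max z.2 0)%:E <= z.1)%E%:R)%:E : \bar R.
have f0 z : (0 <= f z)%E by rewrite lee_fin.
have mf : measurable_fun setT f.
  apply/measurable_EFinP; rewrite (_ : (fun z => _) = fun z : \bar R * R =>
    if ((Num.max z.2 0)%:E <= z.1)%E then 1 else 0 : R); last first.
    by apply/funext => z; case: (_ <= _)%E.
  apply: measurable_fun_ifT => //; apply: measurable_fun_lee => //.
  by apply/measurable_EFinP; apply: measurable_maxr.
have := ge0_integral_cond mX indX lawX iK (@depends_on_xmin _ T R n X K) mf f0.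
under [in X in _ = X -> _]eq_integral do rewrite /f /= integral_dist ?xmin_ge0//.
move=> <-.
(* The double integral is the probability that e_i is at most the minimum of the others. It is now
   computed in the other order: given e_i, the m - 1 others are all at least e_i with probability
   exp(-lam e_i)^(m-1). *)
pose nu : probability (\bar R) R := distribution P (xmin_ K).
pose f' (z : R * \bar R) := f (z.2, z.1).
have mf' : measurable_fun setT f'.
  apply: (measurableT_comp mf); exact: measurable_fun_pair.
have ind A B : measurable A -> measurable B ->
    P (X i @^-1` B `&` xmin_ K @^-1` A) = (P (X i @^-1` B) * P (xmin_ K @^-1` A))%E.
  move=> mA mB; apply: (depends_on_indep mX indX _
    (@depends_on_coord _ _ _ _ X [set i]%SET i _) (@depends_on_xmin _ T R n X K)) => //.
    by rewrite disjoints1.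
  by rewrite inE.
have := @ge0_joint_integral _ T R P _ (\bar R) _ R (xmin_ K) (X i) nu
  (measurable_xmin K) (mX i) (fun A mA => erefl) ind f' mf' (fun z => f0 _).
rewrite {1}/f' /= => ->.
have fE w : (\int[nu]_x f' (X i w, x) = (expR (- lam * Num.max (X i w) 0) ^+ #|K|)%:E)%E.
  rewrite max_l// -probability_xmin_ge//.
  have mS : measurable [set t : \bar R | ((X i w)%:E <= t)%E].
    rewrite -[X in measurable X]setTI; exact: emeasurable_fun_c_infty.
  transitivity (\int[nu]_x (\1_[set t : \bar R | ((X i w)%:E <= t)%E] x)%:E)%E.
    apply: eq_integral => x _; rewrite /f' /f /= max_l// indicE.
    by congr (_%:R%:E); rewrite mem_setE.
  by rewrite integral_indic// setIT.
under eq_integral do rewrite fE.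
have mh : measurable_fun setT (fun x : R => (expR (- lam * Num.max x 0) ^+ #|K|)%:E).
  apply/measurable_EFinP; apply: measurable_funX; apply: measurableT_comp => //.
  by apply: measurable_funM => //; exact: measurable_maxr.
by rewrite (integral_law i mh) ?integral_exponential_expR ?m1.
Qed.

(** Given its level, the residual has second moment lam^-2 F(S_i). The level is at most the minimum
    of the other errors plus 2r; the shift costs 2 r lam, and F of that minimum has mean 1/m. *)
Lemma exponential_mean_residual_sq i :
  \int[P]_w (Z_ i w * Z_ i w) <= lam^-2 * (2 * r * lam + m%:R^-1).
Proof.
have Ki := @others_blk _ blk i.
pose f (z : \bar R * R) := (phi lam (Num.max z.2 0) z.1 ^+ 2)%:E.
have mf : measurable_fun setT f.
  apply/measurable_EFinP; apply: measurable_funX; apply: measurable_phi => //.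
  exact: measurable_maxr.
have fi := Lfun2_integrableM (Z_L2_ i) (Z_L2_ i).
rewrite -lee_fin /Rintegral fineK; last exact: (integrable_fin_num measurableT fi).
have fE w : (Z_ i w * Z_ i w)%:E = f (slack_ (others i) i w, X i w).
  by rewrite /f /= max_l.
under eq_integral do rewrite fE.
rewrite (ge0_integral_cond mX indX lawX (others_irrefl blk i)
  (@depends_on_slack _ T R n X r g (others i) i) mf); last first.
  by move=> z; rewrite lee_fin sqr_ge0.
have l0 : 0 <= lam^-2 by rewrite invr_ge0 exprn_ge0// ltW.
have rl : 0 <= 2 * r * lam by rewrite !mulr_ge0// ltW.
have tl1 w : 0 <= 1 - exp_tail lam (xmin_ (others i) w).
  have := xmin_ge0 (others i) w; case: (xmin_ _ _) => [t| |]//=; rewrite ?subr0//.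
  by rewrite lee_fin => t0; rewrite subr_ge0 -expR0 ler_expR mulNr oppr_le0 mulr_ge0// ltW.
have mtl : measurable_fun setT (fun w => (1 - exp_tail lam (xmin_ (others i) w))%:E).
  apply/measurable_EFinP; apply: measurable_funB => //.
  rewrite (_ : (fun w => _) = fun w => if (xmin_ (others i) w < +oo)%E
      then expR (- lam * fine (xmin_ (others i) w)) else 0); last first.
    apply/funext => w; have := xmin_ge0 (others i) w.
    by case: (xmin_ _ _) => [t| |]//= _; rewrite ltry.
  apply: measurable_fun_ifT => //.
    by apply: measurable_fun_lte.
  apply: measurableT_comp => //; apply: measurable_funM => //.
  exact: measurableT_comp.
apply: (@le_trans _ _ (\int[P]_w ((lam^-2)%:E * ((2 * r * lam)%:E +
    (1 - exp_tail lam (xmin_ (others i) w))%:E)))%E).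
  apply: ge0_le_integral => //.
  - by move=> w _; apply: integral_ge0 => x _; rewrite lee_fin sqr_ge0.
  - apply: (@measurableT_comp _ _ _ _ _ _ (fun z => \int[mu]_x f (z, x))%E) => //.
      apply: measurable_fun_fubini_tonelli_F => // z.
      by rewrite lee_fin sqr_ge0.
    exact: (measurable_slack (others i) i).
  - by apply: emeasurable_funM => //; exact: emeasurable_funD.
  - move=> w _; rewrite -/(slack_ (others i) i w) /f /=.
    rewrite integral_exponential_phi_sq ?slack_ge0_//.
    rewrite -EFinD -EFinM lee_fin ler_wpM2l//.
    apply: exp_tail_shift; [exact: slack_ge0_|exact: xmin_ge0|].
    exact: (slack_le_xmin g_osc (X^~ w) Ki).
rewrite ge0_integralZl//; last 2 first.
- exact: emeasurable_funD.
- by move=> w _; rewrite -EFinD lee_fin addr_ge0.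
rewrite [leRHS]EFinM; apply: lee_wpmul2l; first by rewrite lee_fin.
rewrite ge0_integralD//; last by move=> w _; rewrite lee_fin.
rewrite [leRHS]EFinD; apply: leeD.
  by have := expectation_cst P (2 * r * lam); rewrite unlock => ->.
by rewrite le_eqVlt; apply/orP; left; apply/eqP; exact: integral_tail_xmin.
Qed.

End exponential_model.

(** * Bias and variance of the estimator *)

Section estimator_moments.
Context {R : realType} (mu : probability R R).
Context d (T : measurableType d) (P : probability T R) (n : nat) (h beta rad lam : R).
Variables (g w : R -> R) (eps : 'I_n -> {RV P >-> R}).
Hypothesis mu_ge0 : mu `[0, +oo[%classic = 1%E.
Hypotheses (lam_gt0 : 0 < lam) (rad_gt0 : 0 < rad).
Hypothesis eps_iid : iid_with_law mu eps.
Hypothesis nh : admissible_block_size n h.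

(* The errors are nonnegative only almost surely; their positive parts are
   nonnegative everywhere and have the same joint law. *)
Definition pos_error (i : 'I_n) (omega : T) : R := Num.max (eps i omega) 0.
Notation X := pos_error.

Let m0 : measurable_fun [set: R] (fun x : R => Num.max x 0).
Proof. exact: measurable_maxr. Qed.

Lemma pos_error_measurable i : measurable_fun setT (X i).
Proof. by apply: (measurableT_comp m0). Qed.

Lemma pos_error_ge0 i omega : 0 <= X i omega.
Proof. by rewrite le_max lexx orbT. Qed.

Let mpre (A : set R) : measurable A -> measurable ((fun x : R => Num.max x 0) @^-1` A).
Proof. by move=> mA; rewrite -[X in measurable X]setTI; exact: m0. Qed.

Lemma pos_error_law i (A : set R) : measurable A -> P (X i @^-1` A) = mu A.
Proof.
move=> mA; have [_ law] := eps_iid.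
by have := law i _ (mpre mA); rewrite probability_positive_part.
Qed.

Lemma pos_error_indep (J : {set 'I_n}) (A : 'I_n -> set R) :
  (forall i, measurable (A i)) ->
  P (\bigcap_(i in [set` J]) (X i @^-1` A i)) = (\prod_(i in J) P (X i @^-1` A i))%E.
Proof.
move=> mA; have [ind _] := eps_iid.
exact: (ind J (fun i => (fun x : R => Num.max x 0) @^-1` A i) (fun i => mpre (mA i))).
Qed.

Let r := rad * h `^ beta.
Let gd := g \o @design R n.
Let coef (i : 'I_n) : R := n%:R^-1 * w (design i).
Definition residual (i : 'I_n) (omega : T) : R := truncated_residual lam r gd (blk h) i (X^~ omega).
Definition residual_cov (i j : 'I_n) : R :=
  \int[P]_x (residual i x * residual j x) -
  (\int[P]_x residual i x) * (\int[P]_x residual j x).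
Let est := theta_block beta rad lam h g w eps.

Let raw i omega : R := truncated_residual lam r gd (blk h) i (fun j => eps j omega).

Let estE omega : est omega = theta n g w + \sum_i coef i * raw i omega.
Proof. by rewrite /est /theta_block /observation block_estimatorE. Qed.

Let raw_measurable i : measurable_fun setT (raw i).
Proof.
have ms : measurable_fun setT
    (fun omega => slack r gd (others (blk h) i) i (fun j => eps j omega)).
  rewrite /slack; apply: measurable_bigmine => j _.
  apply/measurable_EFinP; apply: measurable_funB => //.
  by apply: measurable_funD => //; apply: measurable_funD.
exact: (measurable_phi lam (@measurable_funPT _ _ _ _ (eps i)) ms).
Qed.

Let est_measurable : measurable_fun setT est.
Proof.
rewrite (_ : est = fun omega => theta n g w + \sum_(i <- index_enum 'I_n) coef i * raw i omega).
  apply: measurable_funD => //; apply: measurable_sum => i.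
  exact: measurable_funM.
by apply/funext => omega; rewrite estE.
Qed.

Let eps_ae_ge0 : {ae P, forall omega, forall i, 0 <= eps i omega}.
Proof.
apply: filter_forall => i; have [_ law] := eps_iid.
have mN : measurable (~` `[0, +oo[%classic : set R) by apply: measurableC.
exists (eps i @^-1` (~` `[0, +oo[%classic)); split.
- by rewrite -[X in measurable X]setTI; exact: measurable_funP.
- have /= := law i _ mN; rewrite /distribution /pushforward => ->.
  by rewrite probability_setC// mu_ge0 subee.
- by move=> omega /= N0; rewrite in_itv/= andbT.
Qed.

Let est_ae : {ae P, forall omega,
  est omega = theta n g w + \sum_i coef i * residual i omega}.
Proof.
apply: filterS eps_ae_ge0 => omega e0; rewrite estE; congr (_ + _).
apply: eq_bigr => i _; congr (_ * truncated_residual _ _ _ _ _ _).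
by apply/funext => j; rewrite /pos_error max_l.
Qed.

Hypothesis ZL : forall i, residual i \in Lfun P 2%:E.

Let lin_measurable (t : R) :
  measurable_fun setT (fun omega => t + \sum_i coef i * residual i omega).
Proof.
have := Lfun_measurable (Lfun2_lin coef ZL) => ml.
exact: measurable_funD.
Qed.

Lemma estimator_expectation :
  ('E_P[est])%E = (theta n g w + \sum_i coef i * \int[P]_x residual i x)%:E.
Proof.
rewrite -expectation_lin//.
exact: ae_expectation.
Qed.

Lemma estimator_bias :
  ('E_P[(fun omega => (est omega - theta n g w)%R)])%E =
  (\sum_i coef i * \int[P]_x residual i x)%:E.
Proof.
rewrite -[\sum_i _]add0r -expectation_lin//; apply: ae_expectation => //.
  exact: measurable_funB.
by apply: filterS est_ae => omega ->; rewrite addrAC subrr.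
Qed.

Lemma estimator_variance : ('V_P[est])%E =
  (\sum_i \sum_j coef i * coef j * residual_cov i j)%:E.
Proof.
by rewrite /residual_cov -(variance_lin coef (theta n g w))//; exact: ae_variance.
Qed.

Lemma sum_coef_sqr : \sum_i coef i ^+ 2 = n%:R^-1 * std_norm n 2 w ^+ 2.
Proof.
rewrite std_norm2E mulrA -expr2 mulr_sumr; apply: eq_bigr => i _.
by rewrite exprMn.
Qed.

End estimator_moments.

(** [Q] is comparable to [m] in both directions, so 1/Q can replace 1/m in the rate. The 3 leaves
    room for the two observations that are left out and keeps the remaining index set nonempty. *)
Lemma exists_quotient (K m : nat) : (0 < K)%N -> (6 * K + 3 <= m)%N ->
  exists2 Q : nat, (0 < Q)%N & (6 * K * Q + 3 <= m <= (12 * K + 3) * Q)%N.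
Proof.
move=> K_gt0 m_ge; exists ((m - 3) %/ (6 * K))%N; first by rewrite divn_gt0; lia.
have := leq_trunc_div (m - 3) (6 * K).
have : (m - 3 < ((m - 3) %/ (6 * K)).+1 * (6 * K))%N by rewrite ltn_ceil//; lia.
have : (0 < (m - 3) %/ (6 * K))%N by rewrite divn_gt0; lia.
by move: ((m - 3) %/ _)%N => Q; nia.
Qed.

(** * Bounds with constants depending only on the law *)

Section general_law_residuals.
Context {R : realType} (lam rho : R) (mu : probability R R).
Hypotheses (lam_gt0 : 0 < lam) (rho_gt0 : 0 < rho).
Hypothesis mu_law : error_law lam rho mu.

Let mu_ge0 : mu `[0, +oo[%classic = 1%E.
Proof. by case: mu_law. Qed.

Lemma residual_moments : exists K : R, exists m1 : nat, 0 < K /\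
  forall (n : nat) (h beta rad : R) (g : R -> R)
    (d : measure_display) (T : measurableType d) (P : probability T R)
    (eps : 'I_n -> {RV P >-> R}),
  0 < beta -> 0 < rad -> holder_class beta rad g ->
  iid_with_law mu eps -> admissible_block_size n h -> (m1 <= block_size n h)%N ->
  let m := block_size n h in
  let rate := rad * h `^ beta + m%:R^-1 in
  let res := residual h beta rad lam g eps in
  let cov := residual_cov h beta rad lam g eps in
  [/\ forall i, res i \in Lfun P 2%:E,
      forall i, `|\int[P]_x res i x| <= K * rate ^+ 2,
      forall i j, blk h i != blk h j -> cov i j = 0 &
      [/\ forall i, cov i i <= K * (m%:R * rate ^+ 2),
          forall i j, i != j -> blk h i = blk h j -> `|cov i j| <= K * rate ^+ 2,
          forall i j, i != j -> blk h i = blk h j ->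
            `|cov i j| <= K * (rate ^+ 3 + rate ^+ 4) &
          forall i y, 0 <= y -> y <= (2 * lam)^-1 ->
            dist mu y <= (2 * m%:R)^-1 ->
            (8 * lam ^+ 2)^-1 * dist mu y - K * rate ^+ 4 <= cov i i]].
Proof.
have [Kt Kt_gt0 Kt_tail] := tail_pow lam_gt0 rho_gt0 mu_law.
have [C C_gt0 phi_le] := phi_bounds lam_gt0 mu_law.
have phi_int := phi_integrable mu lam_gt0.
(* The factor comparing A = 2r + 1/Q with the rate r + 1/m: it bounds both 2 and m/Q. *)
pose a : R := (12 * Kt + 3)%:R.
have a_ge2 : 2 <= a by rewrite /a ler_nat; lia.
have a_gt0 : 0 < a by lra.
have C17 : 0 < 17 * C by exact: mulr_gt0 (ltr0Sn _ _) C_gt0.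
have C340 : 0 < 340 * C ^+ 2 by exact: mulr_gt0 (ltr0Sn _ _) (exprn_gt0 _ C_gt0).
(* The first summand serves the means and second moments, the second the covariances: 340 = 51 +
   289, where 51 = 3 x 17 comes from the three terms of the mean product and 289 = 17^2 from the
   product of the means. *)
exists (17 * C * (a + a ^+ 2) + 340 * C ^+ 2 * a ^+ 4), (6 * Kt + 3)%N; split.
  apply: addr_gt0; first by apply: mulr_gt0 => //; rewrite addr_gt0// exprn_gt0.
  by apply: mulr_gt0; [exact: C340 | exact: exprn_gt0].
set K := 17 * C * (a + a ^+ 2) + 340 * C ^+ 2 * a ^+ 4.
move=> n h beta rad g d T P eps beta_gt0 rad_gt0 gH iid adm m_ge m rate res cov.
have m_gt0 : 0 < m%:R :> R by rewrite ltr0n block_size_gt0.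
pose r := rad * h `^ beta.
have r_ge0 : 0 <= r by rewrite mulr_ge0 ?powR_ge0 ?ltW.
have [Q Q_gt0 /andP[m_large m_le]] := exists_quotient Kt_gt0 m_ge.
pose A := 2 * r + Q%:R^-1.
have Q0 : 0 < Q%:R :> R by rewrite ltr0n.
have A_ge0 : 0 <= A by rewrite /A addr_ge0 ?invr_ge0 ?ler0n// mulr_ge0.
have A_le : A <= a * rate.
  rewrite /rate -/r mulrDr lerD//; first by rewrite ler_wpM2r.
  by rewrite ler_pdivlMr// mulrC ler_pdivrMr// /a -natrM ler_nat.
have rate_ge0 : 0 <= rate by rewrite /rate addr_ge0 ?invr_ge0 ?ler0n.
(* This gives rate <= m rate^2, so that the second moment, of order A + A^2, fits under m rate^2. *)
have m_rate : 1 <= m%:R * rate.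
  by rewrite /rate -/r mulrDr divff ?gt_eqF// lerDr mulr_ge0// ltW.
have AX p : A ^+ p <= a ^+ p * rate ^+ p.
  by rewrite -exprMn lerXn2r// nnegrE mulr_ge0// ltW.
have mX := pos_error_measurable eps.
have X_ge0 := pos_error_ge0 eps.
have indX := pos_error_indep iid.
have lawX := pos_error_law mu_ge0 iid.
have osc := holder_osc adm beta_gt0 rad_gt0 gH.
have card_b := card_blk adm.
have ZL : forall i, res i \in Lfun P 2%:E.
  exact: (residual_L2 mX X_ge0 indX lawX lam_gt0 r_ge0 osc card_b Q_gt0 m_large Kt_tail C_gt0).
have E1 i : `|\int[P]_x res i x| <= 17 * C * A ^+ 1.
  exact: (mean_residual_le mX X_ge0 indX lawX lam_gt0 r_ge0 osc card_b Q_gt0 m_large Kt_tail C_gt0 phi_int phi_le).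
have E2 i : `|\int[P]_x res i x| <= 17 * C * A ^+ 2.
  exact: (mean_residual_le mX X_ge0 indX lawX lam_gt0 r_ge0 osc card_b Q_gt0 m_large Kt_tail C_gt0 phi_int phi_le).
have EE p i j : (0 < p <= 2)%N -> i != j -> blk h i = blk h j ->
    `|\int[P]_x (res i x * res j x)| <= 51 * C ^+ 2 * A ^+ p.+1.
  exact: (mean_residualM_same_block_le mX X_ge0 indX lawX lam_gt0 r_ge0 osc card_b Q_gt0 m_large Kt_tail C_gt0 phi_int phi_le).
have S i : \int[P]_x (res i x * res i x) <= 17 * C * (A + A ^+ 2).
  exact: (mean_residual_sq_le mX X_ge0 indX lawX lam_gt0 r_ge0 osc card_b Q_gt0 m_large Kt_tail C_gt0 phi_le).
have L i y : 0 <= y -> y <= (2 * lam)^-1 -> dist mu y <= (2 * m%:R)^-1 ->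
    (8 * lam ^+ 2)^-1 * dist mu y <= \int[P]_x (res i x * res i x).
  exact: (mean_residual_sq_ge mX X_ge0 indX lawX lam_gt0 r_ge0 osc card_b Q_gt0 m_large Kt_tail C_gt0).
have D i j : blk h i != blk h j -> cov i j = 0.
  by move=> bij; apply/eqP; rewrite subr_eq0; apply/eqP; exact: (mean_residualM_diff_block mX indX ZL bij).
have rate4 p : 0 <= rate ^+ p by rewrite exprn_ge0.
have aX1 p q : (p <= q)%N -> a ^+ p <= a ^+ q.
  by move=> pq; rewrite ler_weXn2l//; lra.
have K1 : 17 * C * (a + a ^+ 2) <= K 
  by rewrite lerDl; apply: mulr_ge0; [exact: ltW | rewrite exprn_ge0// ltW].
have K2 : 340 * C ^+ 2 * a ^+ 4 <= K.
  by rewrite lerDr; apply: mulr_ge0; [exact: ltW | rewrite addr_ge0 ?exprn_ge0// ltW].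
have C0 : 51 * C ^+ 2 + 289 * C ^+ 2 <= 340 * C ^+ 2 by rewrite -mulrDl -natrD.
have C51 : 51 * C ^+ 2 <= 340 * C ^+ 2.
  by rewrite ler_wpM2r ?sqr_ge0// ler_nat.
have C289 : 289 * C ^+ 2 <= 340 * C ^+ 2.
  by rewrite ler_wpM2r ?sqr_ge0// ler_nat.
have C_sq k : 0 <= k%:R * C ^+ 2 by exact: mulr_ge0 (ler0n _ _) (sqr_ge0 _).
have AA p : 0 <= A ^+ p by rewrite exprn_ge0.
have P1 i j p : (p <= 2)%N -> `|\int[P]_x res i x| <= 17 * C * A ^+ p ->
    `|\int[P]_x res j x| <= 17 * C * A ^+ p ->
    `|(\int[P]_x res i x) * \int[P]_x res j x| <= 289 * C ^+ 2 * A ^+ (p + p).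
  move=> p2 ei ej; rewrite normrM; apply: le_trans (ler_pM _ _ ei ej) _ => //.
  by rewrite le_eqVlt; apply/orP; left; apply/eqP; rewrite exprD; ring.
split => //.
- move=> i; apply: le_trans (E2 i) _.
  apply: (@le_trans _ _ (17 * C * (a ^+ 2 * rate ^+ 2))).
    by rewrite ler_wpM2l ?AX// (ltW C17).
  rewrite mulrA ler_wpM2r ?exprn_ge0//; apply: le_trans K1.
  by rewrite ler_wpM2l ?lerDr ?(ltW a_gt0) ?(ltW C17).
- split.
  + move=> i; rewrite /cov /residual_cov; apply: (@le_trans _ _ (17 * C * (A + A ^+ 2))).
      by apply: le_trans (S i); rewrite lerBlDr lerDl -expr2 sqr_ge0.
    apply: (@le_trans _ _ (17 * C * (a + a ^+ 2) * (m%:R * rate ^+ 2))); last first.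
      by rewrite ler_wpM2r// mulr_ge0 ?(rate4 2%N)// ltW.
    rewrite -[leRHS]mulrA ler_wpM2l ?(ltW C17)// mulrDl lerD//.
      apply: le_trans A_le _; rewrite ler_wpM2l ?(ltW a_gt0)// expr2 mulrA.
      by rewrite ler_peMl.
    apply: le_trans (AX 2) _; rewrite ler_wpM2l ?exprn_ge0 ?(ltW a_gt0)//.
    by rewrite ler_peMl ?exprn_ge0// ler1n block_size_gt0.
  + move=> i j ij bij; apply: le_trans (ler_normB _ _) _.
    have := EE 1%N i j isT ij bij; have := P1 i j 1%N isT (E1 i) (E1 j).
    move=> h1 h2; apply: le_trans (lerD h2 h1) _.
    apply: (@le_trans _ _ (340 * C ^+ 2 * (a ^+ 2 * rate ^+ 2))).
      by rewrite -mulrDl ler_pM ?addr_ge0.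
    rewrite mulrA ler_wpM2r ?exprn_ge0//; apply: le_trans K2.
    by rewrite ler_wpM2l ?aX1 ?(ltW C340).
  + move=> i j ij bij; apply: le_trans (ler_normB _ _) _.
    have := EE 2%N i j isT ij bij; have := P1 i j 2%N isT (E2 i) (E2 j).
    move=> h1 h2; apply: le_trans (lerD h2 h1) _.
    rewrite mulrDr lerD//.
      apply: (@le_trans _ _ (340 * C ^+ 2 * (a ^+ 3 * rate ^+ 3))).
        by rewrite ler_pM.
      rewrite mulrA ler_wpM2r ?exprn_ge0//; apply: le_trans K2.
      by rewrite ler_wpM2l ?aX1 ?(ltW C340).
    apply: (@le_trans _ _ (340 * C ^+ 2 * (a ^+ 4 * rate ^+ 4))).
      by rewrite ler_pM.
    by rewrite mulrA ler_wpM2r ?exprn_ge0.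
  + move=> i y y0 y1 y2; rewrite /cov /residual_cov lerB//; first exact: L.
    apply: le_trans (ler_norm _) _; apply: le_trans (P1 i i 2%N isT (E2 i) (E2 i)) _.
    apply: (@le_trans _ _ (340 * C ^+ 2 * (a ^+ 4 * rate ^+ 4))).
      by rewrite ler_pM.
    by rewrite mulrA ler_wpM2r ?exprn_ge0.
Qed.

End general_law_residuals.

Section general_law_estimator.
Context {R : realType} (lam rho : R) (mu : probability R R).
Hypotheses (lam_gt0 : 0 < lam) (rho_gt0 : 0 < rho).
Hypothesis mu_law : error_law lam rho mu.

Let mu_ge0 : mu `[0, +oo[%classic = 1%E.
Proof. by case: mu_law. Qed.

Lemma estimator_bounds : exists K : R, exists m1 : nat, 0 < K /\
  forall (n : nat) (h beta rad : R) (g w : R -> R)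
    (d : measure_display) (T : measurableType d) (P : probability T R)
    (eps : 'I_n -> {RV P >-> R}),
  0 < beta -> 0 < rad -> holder_class beta rad g ->
  iid_with_law mu eps -> admissible_block_size n h -> (m1 <= block_size n h)%N ->
  let m := block_size n h in
  let rate := rad * h `^ beta + m%:R^-1 in
  let est := theta_block beta rad lam h g w eps in
  exists b : R,
  [/\ ('E_P[(fun omega => (est omega - theta n g w)%R)])%E = b%:E,
      `|b| <= K * rate ^+ 2 * std_norm n 1 w,
      ('V_P[est] <= (K * (h * rate ^+ 2) * std_norm n 2 w ^+ 2)%:E)%E &
      forall y, 0 <= y -> y <= (2 * lam)^-1 -> dist mu y <= (2 * m%:R)^-1 ->
        ((((8 * lam ^+ 2)^-1 * dist mu y - K * m%:R * (rate ^+ 3 + rate ^+ 4)) *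
          (n%:R^-1 * std_norm n 2 w ^+ 2))%:E <= 'V_P[est])%E].
Proof.
have [K [m1 [K_gt0 res]]] := residual_moments lam_gt0 rho_gt0 mu_law.
(* One K pays for the diagonal of the covariance form, the other for the rest of the blocks. *)
exists (2 * K), m1; split; first by rewrite mulr_gt0.
move=> n h beta rad g w d T P eps beta_gt0 rad_gt0 gH iid adm m_ge m rate est.
have [ZL E1 cov0 [cov_diag cov_same cov_same3 cov_ge]] :=
  res _ _ _ _ _ _ _ _ _ beta_gt0 rad_gt0 gH iid adm m_ge.
rewrite -/m -/rate in E1 cov_diag cov_same cov_same3 cov_ge.
have m_gt0 : 0 < m%:R :> R by rewrite ltr0n block_size_gt0.
have n_gt0 : 0 < n%:R :> R by case: adm => n0 _ _ _; rewrite ltr0n.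
have h_gt0 : 0 < h by case: adm.
have rate_ge0 : 0 <= rate.
  by rewrite /rate addr_ge0 ?mulr_ge0 ?powR_ge0 ?invr_ge0 ?(ltW rad_gt0) ?ler0n.
(* The squared coefficients bring a factor 1/n, which turns m rate^2 into h rate^2. *)
have hE : h = m%:R * n%:R^-1 by rewrite block_sizeE// mulrAC divff ?mul1r// gt_eqF.
pose coef (i : 'I_n) : R := n%:R^-1 * w (design i).
have c0 : 0 <= \sum_i coef i ^+ 2 by apply: sumr_ge0 => i _; exact: sqr_ge0.
have card_b (i : 'I_n) : (#|[pred j : 'I_n | blk h j == blk h i]| <= m)%N by exact: (eq_leq (card_blk adm i)).
have rate4 p : 0 <= rate ^+ p by rewrite exprn_ge0.
rewrite (estimator_bias w mu_ge0 rad_gt0 iid adm ZL).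
rewrite (estimator_variance w mu_ge0 rad_gt0 iid adm ZL).
eexists; split; first by [].
- apply: le_trans (ler_norm_sum _ _ _) _.
  apply: (@le_trans _ _ (\sum_i n%:R^-1 * `|w (design i)| * (K * rate ^+ 2))).
    apply: ler_sum => i _; rewrite normrM normrM.
    by rewrite (ger0_norm (x := n%:R^-1)) ?invr_ge0 ?ler0n// ler_wpM2l// mulr_ge0// invr_ge0.
  rewrite -mulr_suml -mulr_sumr -std_norm1E mulrC ler_wpM2r//.
    by rewrite std_norm1E mulr_ge0 ?invr_ge0 ?ler0n// sumr_ge0.
  by rewrite -mulrA ler_peMl ?mulr_ge0 ?(ltW K_gt0)//; lra.
- rewrite lee_fin; have := block_diagonal_form_le coef cov0 cov_same card_b.
  move=> /(_ (mulr_ge0 (ltW K_gt0) (rate4 2%N))); rewrite ler_norml => /andP[_].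
  rewrite lerBlDr => /le_trans; apply.
  apply: (@le_trans _ _ (m%:R * (K * rate ^+ 2) * (\sum_i coef i ^+ 2) +
      (K * (m%:R * rate ^+ 2)) * \sum_i coef i ^+ 2)).
    rewrite lerD2l mulr_sumr; apply: ler_sum => i _.
    by rewrite mulrC ler_wpM2r// sqr_ge0.
  rewrite sum_coef_sqr le_eqVlt; apply/orP; left; apply/eqP.
  by rewrite hE; ring.
- move=> y y0 y1 y2; rewrite lee_fin.
  have := block_diagonal_form_le coef cov0 cov_same3 card_b.
  move=> /(_ (mulr_ge0 (ltW K_gt0) (addr_ge0 (rate4 3%N) (rate4 4%N)))).
  rewrite ler_norml => /andP[+ _]; rewrite lerBrDl => h1; apply: le_trans h1.
  apply: (@le_trans _ _ (((8 * lam ^+ 2)^-1 * dist mu y - K * rate ^+ 4) * (\sum_i coef i ^+ 2) -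
     m%:R * (K * (rate ^+ 3 + rate ^+ 4)) * \sum_i coef i ^+ 2)).
    rewrite -mulrBl -sum_coef_sqr ler_wpM2r// -addrA lerD2l -opprD lerN2.
    rewrite [leRHS](_ : _ = K * m%:R * (rate ^+ 3 + rate ^+ 4) +
      m%:R * (K * (rate ^+ 3 + rate ^+ 4))); last by ring.
    rewrite lerD2r -mulrA ler_wpM2l ?(ltW K_gt0)//.
    apply: (@le_trans _ _ (rate ^+ 3 + rate ^+ 4)); first by rewrite lerDr.
    by rewrite ler_peMl ?addr_ge0// ler1n block_size_gt0.
  rewrite lerD2r mulr_sumr; apply: ler_sum => i _.
  by rewrite mulrC ler_wpM2l ?sqr_ge0// cov_ge.
Qed.

Lemma estimator_variance_ge (C0 : R) : 0 <= C0 -> exists c : R, exists m1 : nat, 0 < c /\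
  forall (n : nat) (h beta rad : R) (g w : R -> R)
    (d : measure_display) (T : measurableType d) (P : probability T R)
    (eps : 'I_n -> {RV P >-> R}),
  0 < beta -> 0 < rad -> holder_class beta rad g ->
  iid_with_law mu eps -> admissible_block_size n h -> (m1 <= block_size n h)%N ->
  let m := block_size n h in
  rad * h `^ beta + m%:R^-1 <= C0 / m%:R ->
  ((c / (m%:R * n%:R) * std_norm n 2 w ^+ 2)%:E <=
    'V_P[(theta_block beta rad lam h g w eps)])%E.
Proof.
move=> C0_ge0; have [K [m1 [K_gt0 bnd]]] := estimator_bounds.
have [Cd Cd_gt0 dist_le] := dist_linear lam_gt0 mu_law.
have [Kd Kd_gt0 dist_exp] := dist_expansion lam_gt0 mu_law.
(* The test point y = delta/m then satisfies F(y) <= Cd y = 1/(2m), as the diagonal lower bound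
   requires. *)
pose delta := (2 * Cd)^-1.
have delta_gt0 : 0 < delta by rewrite invr_gt0 mulr_gt0.
have L2 : 0 < lam ^+ 2 by rewrite exprn_gt0.
(* F(y) >= lam y / 2 makes the leading diagonal term at least delta/(16 lam m) = 2c/m; half of it
   pays for the remainder. *)
pose c := delta / (32 * lam).
have c_gt0 : 0 < c by rewrite divr_gt0// mulr_gt0.
(* The three summands are lower bounds on m that ensure, in this order, y <= 1/(2 lam), Kd y^2 <=
   lam y / 2, and a remainder of at most c/m. *)
pose M := 2 * lam * delta + 2 * Kd * delta / lam + K * (C0 ^+ 3 + C0 ^+ 4) / c.
exists c, (m1 + (Num.truncn M).+1)%N; split => //.
move=> n h beta rad g w d T P eps beta_gt0 rad_gt0 gH iid adm m_ge m rate_le.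
have m_gt0 : 0 < m%:R :> R by rewrite ltr0n block_size_gt0.
have n_gt0 : 0 < n%:R :> R by case: adm => n0 _ _ _; rewrite ltr0n.
have [b [_ _ _ low]] := bnd _ _ _ _ _ w _ _ _ _ beta_gt0 rad_gt0 gH iid adm
  (leq_trans (leq_addr _ _) m_ge).
have M_le : M <= m%:R.
  apply: (@le_trans _ _ (Num.truncn M).+1%:R); first by rewrite ltW// truncnS_gt.
  by rewrite ler_nat (leq_trans _ m_ge)// leq_addl.
have M1 : 0 <= 2 * lam * delta by rewrite !mulr_ge0 ?ltW.
have M2 : 0 <= 2 * Kd * delta / lam by rewrite divr_ge0 ?mulr_ge0 ?ltW.
have M3 : 0 <= K * (C0 ^+ 3 + C0 ^+ 4) / c.
  by rewrite divr_ge0 ?(ltW c_gt0)// mulr_ge0 ?(ltW K_gt0)// addr_ge0// exprn_ge0.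
have m1_ : 2 * lam * delta <= m%:R by move: M_le; rewrite /M; lra.
have m2_ : 2 * Kd * delta / lam <= m%:R by move: M_le; rewrite /M; lra.
have m3_ : K * (C0 ^+ 3 + C0 ^+ 4) / c <= m%:R by move: M_le; rewrite /M; lra.
pose y := delta / m%:R.
have y_gt0 : 0 < y by rewrite divr_gt0.
have y1 : y <= (2 * lam)^-1.
  by rewrite /y ler_pdivrMr// ler_pdivlMl ?mulr_gt0.
have y2 : dist mu y <= (2 * m%:R)^-1.
  apply: le_trans (dist_le _ (ltW y_gt0)) _.
  rewrite /y /delta !invfM le_eqVlt; apply/orP; left; apply/eqP.
  by field; rewrite !gt_eqF.
have y3 : lam * y / 2 <= dist mu y.
  have := dist_exp _ (ltW y_gt0); rewrite ler_norml => /andP[+ _].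
  have : Kd * y ^+ 2 <= lam * y / 2.
    rewrite expr2 mulrA [leRHS]mulrAC ler_wpM2r ?(ltW y_gt0)//.
    move: m2_; rewrite ler_pdivrMr// => m2_.
    by rewrite /y mulrA ler_pdivrMr//; lra.
  lra.
apply: le_trans (low y (ltW y_gt0) y1 y2); rewrite lee_fin -/m.
rewrite invfM [c * _]mulrA -[leLHS]mulrA ler_wpM2r//.
  by rewrite mulr_ge0 ?sqr_ge0// invr_ge0.
have main : 2 * (c / m%:R) <= (8 * lam ^+ 2)^-1 * dist mu y.
  apply: (@le_trans _ _ ((8 * lam ^+ 2)^-1 * (lam * y / 2))).
    rewrite le_eqVlt; apply/orP; left; apply/eqP; rewrite /c /y.
    by field; rewrite !gt_eqF.
  by rewrite ler_wpM2l// invr_ge0 mulr_ge0// ltW.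
have rest : K * m%:R * ((rad * h `^ beta + m%:R^-1) ^+ 3 + (rad * h `^ beta + m%:R^-1) ^+ 4) <= c / m%:R.
  set rate := rad * h `^ beta + m%:R^-1.
  have rate_ge0 : 0 <= rate.
    by rewrite /rate addr_ge0 ?mulr_ge0 ?powR_ge0 ?invr_ge0 ?(ltW rad_gt0) ?ler0n.
  have rX p : rate ^+ p <= (C0 / m%:R) ^+ p.
    by rewrite lerXn2r// nnegrE divr_ge0.
  apply: (@le_trans _ _ (K * m%:R * ((C0 / m%:R) ^+ 3 + (C0 / m%:R) ^+ 4))).
    by rewrite ler_wpM2l ?lerD ?rX// mulr_ge0// ltW.
  apply: (@le_trans _ _ (K * (C0 ^+ 3 + C0 ^+ 4) / m%:R ^+ 2)).
    rewrite -[K * m%:R * _]mulrA -[leRHS]mulrA ler_wpM2l ?(ltW K_gt0)//.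
    rewrite !exprMn !exprVn mulrDr mulrDl lerD//.
      rewrite le_eqVlt; apply/orP; left; apply/eqP; field; exact: lt0r_neq0.
    rewrite mulrCA ler_wpM2l ?exprn_ge0//.
    rewrite exprS invfM mulrA divff ?gt_eqF// mul1r lef_pV2 ?posrE ?exprn_gt0//.
    by rewrite ler_weXn2l// ler1n block_size_gt0.
  move: m3_; rewrite ler_pdivrMr// => m3_.
  rewrite expr2 invfM mulrA ler_wpM2r ?invr_ge0 ?ler0n// ler_pdivrMr//.
  by rewrite [leRHS]mulrC.
lra.
Qed.

End general_law_estimator.

(** With u = (rad n)^(-1/(beta+1)) the ratio [x] of the two parts of the rate, rad h^beta and
    1/(nh), is exactly (h/u)^(beta+1), where h/u lies in [c1, c2]. Replacing the exponent beta+1 by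
    2, on bases below and above 1, makes the bounds uniform in beta. *)
Lemma balanced_bandwidth (R : realType) (n : nat) (h beta rad c1 c2 : R) :
  0 < beta <= 1 -> 0 < rad -> (0 < n)%N -> 0 < h -> 0 < c1 <= c2 ->
  c1 * (rad * n%:R) `^ (- (beta + 1)^-1) <= h
    <= c2 * (rad * n%:R) `^ (- (beta + 1)^-1) ->
  let x := rad * h `^ beta * (n%:R * h) in
  [/\ Num.min 1 c1 ^+ 2 <= x, x <= Num.max 1 c2 ^+ 2 &
      (n%:R ^+ 2 * h)^-1 <= c1^-1 *
        (rad `^ (beta + 1)^-1 * n%:R `^ (- ((2 * beta + 1) / (beta + 1))))].
Proof.
move=> /andP[b0 b1] rad0 n0 h0 /andP[c10 c12] /andP[h1 h2] x.
have N0 : 0 < n%:R :> R by rewrite ltr0n.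
have rn0 : 0 < rad * n%:R by rewrite mulr_gt0.
set u := (rad * n%:R) `^ _ in h1 h2.
have u0 : 0 < u by rewrite powR_gt0.
have B0 : 0 < beta + 1 by rewrite addr_gt0.
have uB : u `^ (beta + 1) = (rad * n%:R)^-1.
  by rewrite -powRrM mulNr mulVf ?gt_eqF// powR_inv1// ltW.
have xE : x = (h / u) `^ (beta + 1).
  rewrite powRM ?invr_ge0 ?(ltW h0) ?(ltW u0)//.
  rewrite -[u^-1]powR_inv1 ?(ltW u0)// powRAC uB powR_inv1 ?invr_ge0 ?(ltW rn0)// invrK.
  rewrite powRD ?(gt_eqF h0) ?implybT// powRr1 ?(ltW h0)//.
  by rewrite /x; ring.
have hu0 : 0 < h / u by rewrite divr_gt0.
have B2 : beta + 1 <= 2 by lra.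
have c20 : 0 < c2 by lra.
split.
- rewrite xE -powR_mulrn ?le_min ?ler01 ?(ltW c10)//.
  apply: (@le_trans _ _ (Num.min 1 c1 `^ (beta + 1))).
    by rewrite ger_powR// lt_min ltr01 c10 ge_min lexx.
  rewrite ge0_ler_powR ?nnegrE ?(ltW B0) ?(ltW hu0) ?le_min ?ler01 ?(ltW c10)//.
  by rewrite ge_min; apply/orP; right; rewrite ler_pdivlMr.
- rewrite xE -powR_mulrn ?le_max ?ler01//.
  apply: (@le_trans _ _ (Num.max 1 c2 `^ (beta + 1))); last first.
    by rewrite ler_powR// le_max lexx.
  rewrite ge0_ler_powR ?nnegrE ?(ltW B0) ?(ltW hu0) ?le_max ?ler01//.
  by apply/orP; right; rewrite ler_pdivrMr.
- apply: (@le_trans _ _ (n%:R ^+ 2 * (c1 * u))^-1).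
    by rewrite lef_pV2 ?posrE ?mulr_gt0 ?exprn_gt0// ler_wpM2l ?exprn_ge0 ?(ltW N0).
  rewrite (_ : - _ = - 2%:R + (beta + 1)^-1); last by field; rewrite gt_eqF.
  rewrite powRD ?(gt_eqF N0) ?implybT// powR_invn ?(ltW N0)//.
  rewrite /u powRN !invfM invrK powRM ?(ltW rad0) ?(ltW N0)//.
  by rewrite le_eqVlt; apply/orP; left; apply/eqP; ring.
Qed.

Section exponential_errors.
Context {R : realType} (n : nat) (h beta rad lam : R) (g w : R -> R).
Context (d : measure_display) (T : measurableType d) (P : probability T R).
Variable eps : 'I_n -> {RV P >-> R}.
Hypotheses (lam_gt0 : 0 < lam) (beta_gt0 : 0 < beta) (rad_gt0 : 0 < rad).
Hypothesis gH : holder_class beta rad g.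
Hypothesis iid : iid_with_law (exponential_prob lam) eps.
Hypothesis adm : admissible_block_size n h.
Notation est := (theta_block beta rad lam h g w eps).

Lemma exponential_estimator :
  ('E_P[est] = (theta n g w)%:E)%E /\
  ('V_P[est] <= ((2 * rad * h `^ beta + (n%:R * lam * h)^-1) / (n%:R * lam)
     * std_norm n 2 w ^+ 2)%:E)%E.
Proof.
pose mu := exponential_law lam_gt0.
have mu_ge0 : mu `[0, +oo[%classic = 1%E.
  by rewrite exponential_law_ray// mulr0 expR0.
(* The two laws take the same values on sets by definition. *)
have iid' : iid_with_law mu eps by [].
have r_ge0 : 0 <= rad * h `^ beta by rewrite mulr_ge0 ?powR_ge0 ?ltW.
have mX := pos_error_measurable eps.
have X_ge0 := pos_error_ge0 eps.
have indX := pos_error_indep iid'.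
have lawX := pos_error_law mu_ge0 iid'.
have osc := holder_osc adm beta_gt0 rad_gt0 gH.
have ZL i : residual h beta rad lam g eps i \in Lfun P 2%:E.
  exact: (exponential_residual_L2 mX X_ge0 indX lawX osc).
have E0 i : \int[P]_x residual h beta rad lam g eps i x = 0.
  exact: (exponential_mean_residual mX X_ge0 indX lawX osc).
rewrite (estimator_expectation w mu_ge0 rad_gt0 iid' adm ZL).
rewrite (estimator_variance w mu_ge0 rad_gt0 iid' adm ZL).
split.
  by rewrite big1 ?addr0// => i _; rewrite E0 mulr0.
have m_gt0 : 0 < (block_size n h)%:R :> R by rewrite ltr0n block_size_gt0.
have n_gt0 : 0 < n%:R :> R by case: adm => n0 _ _ _; rewrite ltr0n.
have h_gt0 : 0 < h by case: adm.
rewrite lee_fin; apply: (@le_trans _ _ (\sum_(i < n) (n%:R^-1 * w (design i)) ^+ 2 *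
    (lam ^- 2 * (2 * (rad * h `^ beta) * lam + (block_size n h)%:R^-1)))).
  apply: ler_sum => i _; rewrite (bigD1 i)//= big1 => [|j ji].
    rewrite addr0 -expr2 ler_wpM2l ?sqr_ge0// /residual_cov E0 mul0r subr0.
    exact: (exponential_mean_residual_sq r_ge0 mX X_ge0 indX lawX osc (card_blk adm)).
  rewrite /residual_cov E0 mul0r subr0; rewrite eq_sym in ji.
  by rewrite (exponential_mean_residualM r_ge0 mX X_ge0 indX lawX osc ji) mulr0.
rewrite -mulr_suml sum_coef_sqr block_sizeE// le_eqVlt; apply/orP; left; apply/eqP.
by field; rewrite !gt_eqF.
Qed.

End exponential_errors.

Theorem theorem2p2 (R : realType) (lambda : R) (lambda_gt0 : 0 < lambda) :
  (forall (mu : probability R R) (rho : R), 0 < rho ->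
    error_law lambda rho mu ->
    (exists C h0 m0 : R, [/\ 0 < C, 0 < h0 &
      forall (n : nat) (h beta rad : R) (g w : R -> R)
        (d : measure_display) (T : measurableType d) (P : probability T R)
        (eps : 'I_n -> {RV P >-> R}),
        0 < beta <= 1 -> 0 < rad -> holder_class beta rad g ->
        iid_with_law mu eps -> admissible_block_size n h ->
        h <= h0 -> m0 <= n%:R * h ->
        let est := theta_block beta rad lambda h g w eps in
        let rate := rad * h `^ beta + (n%:R * h)^-1 in
        (`| 'E_P[(fun omega => (est omega - theta n g w)%R)] | <=
           (C * rate ^+ 2 * std_norm n 1 w)%:E)%E /\
        ('V_P[est] <= (C * (h * rate ^+ 2) * std_norm n 2 w ^+ 2)%:E)%E])
    /\
    (forall beta0 rad0 c1 c2 : R,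
      2^-1 < beta0 -> 0 < rad0 -> 0 < c1 <= c2 ->
      (forall eta : R, 0 < eta ->
        exists h0 m0 : R, 0 < h0 /\
        forall (n : nat) (h beta rad : R) (g w : R -> R)
          (d : measure_display) (T : measurableType d) (P : probability T R)
          (eps : 'I_n -> {RV P >-> R}),
          beta0 <= beta <= 1 -> 0 < rad <= rad0 -> holder_class beta rad g ->
          iid_with_law mu eps -> admissible_block_size n h ->
          c1 * (rad * n%:R) `^ (- (beta + 1)^-1) <= h
            <= c2 * (rad * n%:R) `^ (- (beta + 1)^-1) ->
          h <= h0 -> m0 <= n%:R * h ->
          let est := theta_block beta rad lambda h g w eps in
          ('E_P[(fun omega => (est omega - theta n g w)%R)] ^+ 2
             <= eta%:E * 'V_P[est])%E)
      /\
      (exists C h0 m0 : R, [/\ 0 < C, 0 < h0 &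
        forall (n : nat) (h beta rad : R) (g w : R -> R)
          (d : measure_display) (T : measurableType d) (P : probability T R)
          (eps : 'I_n -> {RV P >-> R}),
          beta0 <= beta <= 1 -> 0 < rad <= rad0 -> holder_class beta rad g ->
          iid_with_law mu eps -> admissible_block_size n h ->
          c1 * (rad * n%:R) `^ (- (beta + 1)^-1) <= h
            <= c2 * (rad * n%:R) `^ (- (beta + 1)^-1) ->
          h <= h0 -> m0 <= n%:R * h ->
          let est := theta_block beta rad lambda h g w eps in
          ('V_P[est] <=
             (C * (rad `^ (beta + 1)^-1
                   * n%:R `^ (- ((2 * beta + 1) / (beta + 1))))
                * std_norm n 2 w ^+ 2)%:E)%E])))
  /\
  (forall (n : nat) (h beta rad : R) (g w : R -> R)
     (d : measure_display) (T : measurableType d) (P : probability T R)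
     (eps : 'I_n -> {RV P >-> R}),
     0 < beta <= 1 -> 0 < rad -> holder_class beta rad g ->
     iid_with_law (exponential_prob lambda) eps ->
     admissible_block_size n h ->
     let est := theta_block beta rad lambda h g w eps in
     ('E_P[est] = (theta n g w)%:E)%E /\
     ('V_P[est] <=
        ((2 * rad * h `^ beta + (n%:R * lambda * h)^-1) / (n%:R * lambda)
           * std_norm n 2 w ^+ 2)%:E)%E).
Proof.
split; last first.
  move=> n h beta rad g w d T P eps /andP[beta_gt0 _] rad_gt0 gH iid adm.
  exact: exponential_estimator.
move=> mu rho rho_gt0 law.
have [K [m1 [K_gt0 bnd]]] := estimator_bounds lambda_gt0 rho_gt0 law.
have size_ge (m0 : nat) n (h : R) : admissible_block_size n h ->
    m0%:R <= n%:R * h -> (m0 <= block_size n h)%N.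
  by move=> adm; rewrite -block_sizeE// ler_nat.
split.
  exists K, 1, m1%:R; split => // n h beta rad g w d T P eps.
  move=> /andP[beta_gt0 _] rad_gt0 gH iid adm _ m_ge est rate.
  have [b [-> b_le V_le _]] := bnd _ _ _ _ _ w _ _ _ _ beta_gt0 rad_gt0 gH iid adm
    (size_ge _ _ _ adm m_ge).
  by move: b_le V_le; rewrite block_sizeE// -/rate => b_le V_le; split => //=; rewrite lee_fin.
move=> beta0 rad0 c1 c2 beta0_gt rad0_gt0 c12.
have c1_gt0 : 0 < c1 by case/andP: c12.
(* [e] and [D] bound the ratio of rad h^beta to 1/(nh) from below and above; [C0] adds 1 for the
   term 1/(nh) itself. *)
pose D := Num.max 1 c2 ^+ 2; pose e := Num.min 1 c1 ^+ 2; pose C0 := D + 1.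
have e_gt0 : 0 < e by rewrite exprn_gt0// lt_min ltr01.
have C0_gt0 : 0 < C0 by rewrite ltr_wpDl// sqr_ge0.
have regime n (h beta rad : R) : beta0 <= beta <= 1 -> 0 < rad <= rad0 ->
    admissible_block_size n h ->
    c1 * (rad * n%:R) `^ (- (beta + 1)^-1) <= h
      <= c2 * (rad * n%:R) `^ (- (beta + 1)^-1) ->
    [/\ 0 < beta, 0 < rad, e <= rad * h `^ beta * (n%:R * h),
        0 <= rad * h `^ beta + (n%:R * h)^-1 <= C0 / (n%:R * h) &
        (n%:R ^+ 2 * h)^-1 <= c1^-1 *
          (rad `^ (beta + 1)^-1 * n%:R `^ (- ((2 * beta + 1) / (beta + 1))))].
  move=> /andP[beta_ge beta_le] /andP[rad_gt0 _] [n_gt0 h_gt0 _ _] hb.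
  have beta_gt0 : 0 < beta by lra.
  have beta01 : 0 < beta <= 1 by rewrite beta_gt0.
  have [x_ge x_le x_rate] := balanced_bandwidth beta01 rad_gt0 n_gt0 h_gt0 c12 hb.
  have nh_gt0 : 0 < n%:R * h by rewrite mulr_gt0// ltr0n.
  split => //; apply/andP; split.
    by rewrite addr_ge0 ?invr_ge0 ?(ltW nh_gt0)// mulr_ge0 ?powR_ge0// ltW.
  by rewrite /C0 mulrDl mul1r lerD2r ler_pdivlMr.
split.
  move=> eta eta_gt0.
  have [c [m2 [c_gt0 low]]] := estimator_variance_ge lambda_gt0 rho_gt0 law (ltW C0_gt0).
  pose s := 2 * beta0 - 1; have s_gt0 : 0 < s by rewrite /s; lra.
  (* From e <= rad0 h^beta0 m follows h m^2 >= e^2 / (rad0^2 h^s). The condition h^s <= q makes the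
     right-hand side at least K^2 C0^4 / (eta c). *)
  pose q := eta * c * e ^+ 2 / (K ^+ 2 * C0 ^+ 4 * rad0 ^+ 2).
  have q_gt0 : 0 < q.
    by apply: divr_gt0; repeat apply: mulr_gt0 => //; apply: exprn_gt0.
  exists (Num.min 1 (q `^ s^-1)), (m1 + m2)%:R; split.
    by rewrite lt_min ltr01 powR_gt0.
  move=> n h beta rad g w d T P eps beta01 rad01 gH iid adm hb h_le m_ge /=.
  have [beta_gt0 rad_gt0 x_ge /andP[rate_ge0 rate_le] _] := regime _ _ _ _ beta01 rad01 adm hb.
  have m_ge' := size_ge _ _ _ adm m_ge.
  have [n_gt0 h_gt0 _ _] := adm.
  have N_gt0 : 0 < n%:R :> R by rewrite ltr0n.
  have [b [-> b_le _ _]] := bnd _ _ _ _ _ w _ _ _ _ beta_gt0 rad_gt0 gH iid adm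
    (leq_trans (leq_addr _ _) m_ge').
  have := low _ _ _ _ _ w _ _ _ _ beta_gt0 rad_gt0 gH iid adm
    (leq_trans (leq_addl _ _) m_ge').
  rewrite /= block_sizeE// in b_le *; set m := n%:R * h in rate_ge0 rate_le x_ge b_le *.
  set rate := rad * h `^ beta + m^-1 in rate_ge0 rate_le b_le *.
  have m_gt0 : 0 < m by rewrite mulr_gt0.
  move=> /(_ rate_le) V_ge.
  apply: (@le_trans _ _ (eta%:E * (c / (m * n%:R) * std_norm n 2 w ^+ 2)%:E)%E); last first.
    by rewrite lee_wpmul2l// lee_fin ltW.
  rewrite -!EFinM lee_fin -expr2.
  have h_le1 : h <= 1 by move: h_le; rewrite le_min => /andP[].
  have hs_le : h `^ s <= q.
    move: h_le; rewrite le_min => /andP[_ hq].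
    apply: (@le_trans _ _ ((q `^ s^-1) `^ s)).
      by rewrite ge0_ler_powR ?nnegrE ?powR_ge0 ?(ltW s_gt0) ?(ltW h_gt0).
    by rewrite -powRrM mulVf ?gt_eqF// powRr1// ltW.
  (* Here h <= 1 allows beta to be replaced by its lower bound beta0, which makes the threshold
     uniform in beta. *)
  have x_le : rad * h `^ beta * m <= rad0 * h `^ beta0 * m.
    case/andP: rad01 => _ rad_le; case/andP: beta01 => beta_ge _.
    rewrite ler_wpM2r ?(ltW m_gt0)// ler_pM ?powR_ge0 ?(ltW rad_gt0)//.
    by rewrite ger_powR// h_gt0.
  have e_le : e ^+ 2 <= rad0 ^+ 2 * (h * q) * m ^+ 2.
    apply: (@le_trans _ _ ((rad0 * h `^ beta0 * m) ^+ 2)).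
      have e_le := le_trans x_ge x_le.
      by rewrite lerXn2r// nnegrE ?(le_trans _ e_le)// ltW.
    rewrite exprMn ler_wpM2r ?sqr_ge0// exprMn ler_wpM2l ?sqr_ge0//.
    rewrite -powR_mulrn ?powR_ge0// -powRrM.
    rewrite (_ : beta0 * 2%:R = 1 + s); last by rewrite /s; ring.
    by rewrite powRD ?(gt_eqF h_gt0) ?implybT// powRr1 ?(ltW h_gt0)// ler_wpM2l// ltW.
  have key : K ^+ 2 * C0 ^+ 4 <= eta * c * h * m ^+ 2.
    have W_gt0 : 0 < K ^+ 2 * C0 ^+ 4 by rewrite mulr_gt0 ?exprn_gt0.
    have E2 : 0 < e ^+ 2 by rewrite exprn_gt0.
    rewrite -(ler_pM2r E2) mulrC -ler_pdivlMr//.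
    apply: le_trans e_le _; rewrite le_eqVlt; apply/orP; left; apply/eqP.
    by rewrite /q; field; rewrite !gt_eqF.
  (* The squared bias is at most K^2 C0^4 / m^4 times the squared 2-norm, and h m^2 / m^4 = 1/(m n)
     is the order of the lower bound on the variance. *)
  apply: (@le_trans _ _ ((K * rate ^+ 2) ^+ 2 * std_norm n 2 w ^+ 2)).
    apply: (@le_trans _ _ ((K * rate ^+ 2 * std_norm n 1 w) ^+ 2)).
      by rewrite -[b ^+ 2]real_normK ?num_real// lerXn2r ?nnegrE// (le_trans _ b_le).
    rewrite [leLHS]exprMn; apply: ler_wpM2l; first exact: sqr_ge0.
    exact: std_norm1_le2.
  rewrite [leRHS]mulrA ler_wpM2r ?sqr_ge0//.
  apply: (@le_trans _ _ (K ^+ 2 * C0 ^+ 4 / m ^+ 4)).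
    rewrite exprMn -exprM -[leRHS]mulrA ler_wpM2l ?sqr_ge0//.
    by rewrite -expr_div_n lerXn2r// nnegrE divr_ge0// ltW.
  apply: (@le_trans _ _ (eta * c * h * m ^+ 2 / m ^+ 4)).
    by rewrite ler_wpM2r// invr_ge0 exprn_ge0// ltW.
  rewrite le_eqVlt; apply/orP; left; apply/eqP; rewrite /m.
  by field; rewrite !gt_eqF.
exists (K * C0 ^+ 2 * c1^-1), 1, m1%:R; split => //.
  by apply: mulr_gt0; [apply: mulr_gt0 => //; rewrite exprn_gt0 | rewrite invr_gt0].
move=> n h beta rad g w d T P eps beta01 rad01 gH iid adm hb _ m_ge /=.
have [beta_gt0 rad_gt0 _ /andP[rate_ge0 rate_le] x_rate] := regime _ _ _ _ beta01 rad01 adm hb.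
have [n_gt0 h_gt0 _ _] := adm.
have N_gt0 : 0 < n%:R :> R by rewrite ltr0n.
have [b [_ _ V_le _]] := bnd _ _ _ _ _ w _ _ _ _ beta_gt0 rad_gt0 gH iid adm
  (size_ge _ _ _ adm m_ge).
apply: le_trans V_le _; rewrite lee_fin block_sizeE// ler_wpM2r ?sqr_ge0//.
set rate := rad * h `^ beta + _ in rate_ge0 rate_le *.
rewrite -!mulrA ler_wpM2l ?(ltW K_gt0)//.
(* In the balanced regime h rate^2 is at most C0^2 / (n^2 h), and the lower bound on h converts this
   into the stated powers of rad and n. *)
apply: (@le_trans _ _ (h * (C0 / (n%:R * h)) ^+ 2)).
  rewrite ler_wpM2l ?(ltW h_gt0)// lerXn2r// nnegrE divr_ge0 ?(ltW C0_gt0)//.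
  by rewrite mulr_ge0 ?ltW.
rewrite [leLHS](_ : _ = C0 ^+ 2 * (n%:R ^+ 2 * h)^-1); last by field; rewrite !gt_eqF.
by rewrite mulrA -expr2 ler_wpM2l ?sqr_ge0.
Qed.
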